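(* Let $\Delta t>0$ and let $u_k,B_k\in U_h^{\mathrm{div}}$, $\rho_k\in F_h$ ($k\geq 0$) and $p_{k}\in Q_h$ satisfy, for every $k\ge0$, with $u_{k+1/2}=\frac{u_k+u_{k+1}}2$, $B_{k+1/2}=\frac{B_k+B_{k+1}}2$, $\rho_{k+1/2}=\frac{\rho_k+\rho_{k+1}}2$, $(\rho u)_{k+1/2}=\frac{\rho_ku_k+\rho_{k+1}u_{k+1}}2$, the scheme $$\left\langle\frac{\rho_{k+1}u_{k+1}-\rho_ku_k}{\Delta t},v\right\rangle+\langle\alpha,v\rangle+\widetilde b_h(u_{k+1/2};\theta,\rho_{k+1/2},v)-\langle p_{k+1},\operatorname{div}v\rangle=0\quad\forall v\in U_h^{\mathrm{div}},$$ $$\left\langle\frac{B_{k+1}-B_k}{\Delta t},C\right\rangle+\langle\nabla\times E,C\rangle=0\quad\forall C\in U_h^{\mathrm{div}},$$ $$\left\langle\frac{\rho_{k+1}-\rho_k}{\Delta t},\sigma\right\rangle+\widetilde b_h(u_{k+1/2};\sigma,\rho_{k+1/2},u_{k+1/2})=0\quad\forall\sigma\in F_h,$$ $$\langle\operatorname{div}u_{k+1},q\rangle=0\quad\forall q\in Q_h,$$ where $\theta\in F_h$ and $w,J,H,U,E,\alpha\in U_h^{\mathrm{curl}}$ (depending on $k$) are determined by $$\langle w,z\rangle=\langle(\rho u)_{k+1/2},\nabla\times z\rangle\quad\forall z\in U_h^{\mathrm{curl}},$$ $$\langle J,\kappa\rangle=\langle B_{k+1/2},\nabla\times\kappa\rangle\quad\forall\kappa\in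 U_h^{\mathrm{curl}},$$ $$\langle\theta,\tau\rangle=\tfrac12\langle u_k\cdot u_{k+1},\tau\rangle\quad\forall\tau\in F_h,$$ $$\langle H,G\rangle=\langle B_{k+1/2},G\rangle\quad\forall G\in U_h^{\mathrm{curl}},$$ $$\langle U,V\rangle=\langle u_{k+1/2},V\rangle\quad\forall V\in U_h^{\mathrm{curl}},$$ $$\langle E,F\rangle=-\langle U\times H,F\rangle\quad\forall F\in U_h^{\mathrm{curl}},$$ $$\langle\alpha,\beta\rangle=\langle w\times U-J\times H,\beta\rangle\quad\forall\beta\in U_h^{\mathrm{curl}}.$$ Assume $\operatorname{div}u_0\equiv0$. If $\operatorname{div}B_0\equiv0$, then for every $k$: $$\int_\Omega\rho_{k+1}\,dx=\int_\Omega\rho_k\,dx,$$ $$\int_\Omega\rho_{k+1}^2\,dx\le\int_\Omega\rho_k^2\,dx,\ \text{ with equality if }\beta_e=0\ \forall e\in\mathcal{E}_h,$$ $$\int_\Omega(\rho_{k+1}u_{k+1}\cdot u_{k+1}+B_{k+1}\cdot B_{k+1})\,dx=\int_\Omega(\rho_ku_k\cdot u_k+B_k\cdot B_k)\,dx,$$ $$\int_\Omega u_{k+1}\cdot B_{k+1}\,dx=\int_\Omega u_k\cdot B_k\,dx\quad\text{if }\rho_0\equiv1,$$ $$\int_\Omega A_{k+1}\cdot B_{k+1}\,dx=\int_\Omega A_k\cdot B_k\,dx,$$ $$\operatorname{div}u_k\equiv0,\qquad\operatorname{div}B_k\equiv0,$$ where $A_k$ denotes any vector field satisfying $\nabla\times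 A_k=B_k$ in $\Omega$ and $A_k\times n=0$ on $\partial\Omega$.
   Context: $\Omega\subset\mathbb{R}^3$ is a bounded domain with unit normal $n$ on $\partial\Omega$, $\mathcal{T}_h$ is a (conforming simplicial) triangulation of $\Omega$, and $\mathcal{E}_h$ is the set of interior 2-dimensional faces of $\mathcal{T}_h$. For $K\in\mathcal{T}_h$, $P_s(K)$ denotes the polynomials of degree at most $s$ on $K$, and $x$ denotes the position vector. $\langle\cdot,\cdot\rangle$ is the $L^2(\Omega)$ inner product of scalar or vector fields. Set $H_0(\mathrm{div},\Omega)=\{u\in L^2(\Omega)^3: \operatorname{div}u\in L^2(\Omega),\ u\cdot n=0 \text{ on }\partial\Omega\}$, $H_0(\mathrm{curl},\Omega)=\{u\in L^2(\Omega)^3:\nabla\times u\in L^2(\Omega)^3,\ u\times n=0\text{ on }\partial\Omega\}$, $L^2_{\int=0}(\Omega)=\{f\in L^2(\Omega):\int_\Omega f\,dx=0\}$. Fix integers $s\ge 0$ and $m\ge0$ and define the finite element spaces $U_h^{\mathrm{div}}=\{u\in H_0(\mathrm{div},\Omega): u|_K\in P_s(K)^3+xP_s(K)\ \forall K\in\mathcal{T}_h\}$ (Raviart-Thomas), $U_h^{\mathrm{curl}}=\{u\in H_0(\mathrm{curl},\Omega): u|_K\in P_s(K)^3+x\times P_s(K)^3\ \forall K\in\mathcal{T}_h\}$ (Nedelec, first kind), $F_h=\{f\in L^2(\Omega): f|_K\in P_m(K)\ \forall K\in\mathcal{T}_h\}$, $Q_h=\{f\in L^2_{\int=0}(\Omega):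 f|_K\in P_s(K)\ \forall K\in\mathcal{T}_h\}$. On a face $e=K_1\cap K_2\in\mathcal{E}_h$, a piecewise smooth scalar $f$ with $f_i=f|_{K_i}$ has jump $[\![ f]\!]=f_1n_1+f_2n_2$ and average $\{f\}=\frac{f_1+f_2}{2}$, where $n_1$ is the unit normal to $e$ pointing from $K_1$ to $K_2$ and $n_2=-n_1$. For $(f,g,v)\in F_h\times F_h\times U_h^{\mathrm{div}}$, $$b_h(f,g,v)=-\sum_{K\in\mathcal{T}_h}\int_K(v\cdot\nabla f)\,g\,dx+\sum_{e\in\mathcal{E}_h}\int_e v\cdot[\![ f]\!]\{g\}\,ds.$$ For each $e\in\mathcal{E}_h$, $\beta_e(u)\ge0$ is a nonnegative parameter (function on $e$) which may depend on $u$ (e.g. $\beta_e(u)=c|u\cdot n|$ with $c\in[0,\frac12]$, or $\beta_e(u)=\frac{2c}{\pi}(u\cdot n)\arctan\left(\frac{u\cdot n}{\varepsilon}\right)$ with $\varepsilon>0$), where $n$ on $e$ is a unit normal to $e$. For $u,v\in U_h^{\mathrm{div}}$ and $f,g\in F_h$, $$\widetilde b_h(u;f,g,v)=b_h(f,g,v)+\sum_{e\in\mathcal{E}_h}\int_e\beta_e(u)\left(\frac{v\cdot n}{u\cdot n}\right)[\![ f]\!]\cdot[\![ g]\!]\,ds.$$ The weight $\beta_e(u)\frac{v\cdot n}{u\cdot n}$ is understood to be well defined and integrable against piecewise polynomials on $e$, linear in $v$, and equal to $\beta_e(u)$ when $v=u$. *)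

(* Defs.v *)
From HB Require Import structures.
From mathcomp Require Import all_boot all_order all_algebra.
From mathcomp Require Import all_classical all_reals all_analysis.
From mathcomp Require mpoly.
(* The notations of mpoly clash with those of MathComp-Analysis. *)
Import -(notations) mpoly.

Set Implicit Arguments.
Unset Strict Implicit.
Unset Printing Implicit Defensive.

Import Order.TTheory GRing.Theory Num.Theory.
Import numFieldNormedType.Exports.

Local Open Scope classical_set_scope.
Local Open Scope ring_scope.

Notation "'sfield' R" := ('rV[R]_3 -> R) (at level 10, only parsing).
Notation "'vfield' R" := ('rV[R]_3 -> 'rV[R]_3) (at level 10, only parsing).

Section VectorAlgebra.
Variable R : realType.
Implicit Types (x y : 'rV[R]_3) (f g : sfield R) (u v : vfield R).

Definition dot x y : R := \sum_(i < 3) x 0 i * y 0 i.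

(* The norm [`|x|] of 'rV[R]_3 in the library is the sup norm. *)
Definition enorm x : R := Num.sqrt (dot x x).

(* Indices live in the ring 'I_3 of integers modulo 3. *)
Definition cross x y : 'rV[R]_3 :=
  \row_(i < 3) (x 0 (i + 1) * y 0 (i + 2) - x 0 (i + 2) * y 0 (i + 1)).

Definition pd (i : 'I_3) f : sfield R := fun x => 'D_(delta_mx 0 i) f x.

Definition grad f : vfield R := fun x => \row_(i < 3) pd i f x.

Definition curl u : vfield R := fun x => \row_(i < 3)
  (pd (i + 1) (fun y => u y 0 (i + 2)) x - pd (i + 2) (fun y => u y 0 (i + 1)) x).

Definition smul f u : vfield R := fun x => f x *: u x.
Definition crossf u v : vfield R := fun x => cross (u x) (v x).
Definition dotf u v : sfield R := fun x => dot (u x) (v x).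

Definition mids f g : sfield R := fun x => (f x + g x) / 2.
Definition midv u v : vfield R := fun x => 2^-1 *: (u x + v x).

End VectorAlgebra.

(* The library has no measure on 'rV[R]_3: integrals are taken on R * R * R and
   transported along the coordinate map [vec3]. *)
Notation leb1 R := (@lebesgue_measure R) (only parsing).
Notation leb2 R := (leb1 R \x leb1 R)%E (only parsing).
Notation leb3 R := ((leb1 R \x leb1 R) \x leb1 R)%E (only parsing).

Section Lebesgue.
Variable R : realType.
Implicit Types (D Omega : set 'rV[R]_3) (f g : sfield R) (u v : vfield R).

Definition vec3 (p : R * R * R) : 'rV[R]_3 :=
  \row_(i < 3) [:: p.1.1; p.1.2; p.2]`_i.

Definition vol_int D f : R :=
  \int[leb3 R]_(p in vec3 @^-1` D) f (vec3 p).

Definition ae_on D (P : 'rV[R]_3 -> Prop) : Prop :=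
  {ae leb3 R, forall p, D (vec3 p) -> P (vec3 p)}.

Definition L2 Omega f : Prop :=
  measurable_fun (vec3 @^-1` Omega) (f \o vec3) /\
  (\int[leb3 R]_(p in vec3 @^-1` Omega) (f (vec3 p) ^+ 2)%:E < +oo)%E.

Definition L2v Omega u : Prop := forall i, L2 Omega (fun x => u x 0 i).

Definition ips Omega f g : R := vol_int Omega (fun x => f x * g x).
Definition ipv Omega u v : R := vol_int Omega (dotf u v).

End Lebesgue.

Section Spaces.
Variable R : realType.
Variable Omega : set 'rV[R]_3.
Implicit Types (f phi d : sfield R) (u c psi : vfield R).

Definition C1 phi : Prop :=
  (forall x, differentiable phi x) /\ (forall i, continuous (pd i phi)).

Definition C1v psi : Prop := forall i, C1 (fun x => psi x 0 i).

Definition test phi : Prop :=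
  [/\ C1 phi, compact (closure [set x | phi x != 0])
    & closure [set x | phi x != 0] `<=` Omega].

Definition testv psi : Prop := forall i, test (fun x => psi x 0 i).

(* First-order weak derivatives are tested against compactly supported C^1
   functions. *)
Definition weak_div u d : Prop :=
  L2 Omega d /\ forall phi, test phi -> ipv Omega u (grad phi) = - ips Omega d phi.

Definition weak_curl u c : Prop :=
  L2v Omega c /\ forall psi, testv psi -> ipv Omega u (curl psi) = ipv Omega c psi.

Definition Hdiv u : Prop := L2v Omega u /\ exists d, weak_div u d.
Definition Hcurl u : Prop := L2v Omega u /\ exists c, weak_curl u c.

(* The weak divergence and curl, unique up to a null set, as total operators:
   some representative if there is one, and 0 otherwise. *)
Definition wdiv u : sfield R := xget (fun=> 0) [set d | weak_div u d].
Definition wcurl u : vfield R := xget (fun=> 0) [set c | weak_curl u c].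

(* The boundary conditions u . n = 0 and u x n = 0 are in the weak sense of
   Green's formulas: the boundary terms
     \int_{bd Omega} (u . n) phi = <u, grad phi> + <div u, phi>,
     \int_{bd Omega} (n x u) . psi = <curl u, psi> - <u, curl psi>
   vanish for all phi, psi that are C^1 up to the boundary. *)
Definition H0div u : Prop := Hdiv u /\
  forall phi, C1 phi -> ipv Omega u (grad phi) + ips Omega (wdiv u) phi = 0.

Definition H0curl u : Prop := Hcurl u /\
  forall psi, C1v psi -> ipv Omega (wcurl u) psi - ipv Omega u (curl psi) = 0.

(* Omega = int (cl Omega) excludes cracks; it holds for Lipschitz domains. *)
Definition bounded_domain : Prop :=
  [/\ open Omega, connected Omega, Omega !=set0, bounded_set Omega
    & Omega = (closure Omega)°].

End Spaces.

(* A simplex is given by the set of (the indices of) its vertices. *)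
Record mesh (R : realType) := Mesh {
  nvert : nat;
  vert : 'I_nvert -> 'rV[R]_3;
  cells : {set {set 'I_nvert}} }.

Section Mesh.
Variable R : realType.
Variable M : mesh R.
Notation simplex := {set 'I_(nvert M)}.
Implicit Types (K L e : simplex) (f g : sfield R) (u v : vfield R).

Definition hull K : set 'rV[R]_3 := [set x | exists c : 'I_(nvert M) -> R,
  [/\ forall i, 0 <= c i, \sum_(i in K) c i = 1
    & x = \sum_(i in K) c i *: vert i]].

Definition affinely_independent K : Prop := forall c : 'I_(nvert M) -> R,
  \sum_(i in K) c i = 0 -> \sum_(i in K) c i *: vert i = 0 ->
  forall i, i \in K -> c i = 0.

Definition triangulation (Omega : set 'rV[R]_3) : Prop :=
  [/\ forall K, K \in cells M -> #|K| = 4%N /\ affinely_independent K,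
      forall K L, K \in cells M -> L \in cells M ->
        hull K `&` hull L = hull (K :&: L)%SET
    & \bigcup_(K in [set K | K \in cells M]) hull K = closure Omega].

Definition cell_int K : set 'rV[R]_3 := (hull K)°.

Definition adj e : {set simplex} := [set K in cells M | e \subset K]%SET.

Definition int_faces : {set simplex} :=
  [set e : simplex | (#|e| == 3%N) && (#|adj e| == 2%N)]%SET.

(* K_1 and K_2 are [side e 0] and [side e 1]. *)
Definition side e (j : nat) : simplex := nth finset.set0 (enum (adj e)) j.

Definition vertex K (j : nat) : 'rV[R]_3 := [seq vert i | i <- enum K]`_j.

Definition face_normal e : 'rV[R]_3 :=
  cross (vertex e 1 - vertex e 0) (vertex e 2 - vertex e 0).

(* The unit normal to e pointing from K_1 to K_2, that is, away from the vertex
   of K_1 opposite to e. *)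
Definition unit_normal e : 'rV[R]_3 :=
  let N := face_normal e in
  (- Num.sg (dot N (vertex (side e 0 :\: e)%SET 0 - vertex e 0)) / enorm N) *: N.

Definition face_param e (q : R * R) : 'rV[R]_3 :=
  vertex e 0 + q.1 *: (vertex e 1 - vertex e 0) + q.2 *: (vertex e 2 - vertex e 0).

Definition ref_triangle : set (R * R) :=
  [set q | [/\ 0 <= q.1, 0 <= q.2 & q.1 + q.2 <= 1]].

(* Surface integral over e, through the affine parametrisation of e by the
   reference triangle. *)
Definition face_int e f : R :=
  enorm (face_normal e) *
  \int[leb2 R]_(q in ref_triangle) f (face_param e q).

(* The value at a boundary point x of K of the restriction of a function to K
   is the limit from the interior of K. *)
Definition trace (V : normedModType R) K (f : 'rV[R]_3 -> V) (x : 'rV[R]_3) : V :=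
  lim (f y @[y --> within (cell_int K) (nbhs x)]).

Definition jump e f : vfield R := fun x =>
  trace (side e 0) (f : _ -> R^o) x *: unit_normal e
  + trace (side e 1) (f : _ -> R^o) x *: (- unit_normal e).

Definition avg e f : sfield R := fun x =>
  (trace (side e 0) (f : _ -> R^o) x + trace (side e 1) (f : _ -> R^o) x) / 2.

(* On a face, v is only used through v . n, which is single valued for v in
   H(div): the trace from K_1 is as good as the one from K_2. *)
Definition on_face e v : vfield R := trace (side e 0) v.

Definition normal_comp e v : sfield R := fun x =>
  dot (on_face e v x) (unit_normal e).

Definition mpoly_eval (P : mpoly.mpoly 3 R) (x : 'rV[R]_3) : R :=
  mpoly.meval (fun i => x 0 i) P.

Definition mpoly_evalv (P : 'I_3 -> mpoly.mpoly 3 R) (x : 'rV[R]_3) : 'rV[R]_3 :=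
  \row_(i < 3) mpoly_eval (P i) x.

(* [msize P] is the degree of P plus one, and 0 for P = 0. *)
Definition deg_le (s : nat) (P : mpoly.mpoly 3 R) : Prop :=
  (mpoly.msize P <= s.+1)%N.

(* A finite element function is represented by a function that is polynomial in
   the interior of each cell; its values on the skeleton, a null set, are
   irrelevant. *)
Definition pw_poly (s : nat) f : Prop := forall K, K \in cells M ->
  exists2 P, deg_le s P & forall x, cell_int K x -> f x = mpoly_eval P x.

Variable Omega : set 'rV[R]_3.

Definition Udiv (s : nat) u : Prop := H0div Omega u /\
  forall K, K \in cells M -> exists (P : 'I_3 -> mpoly.mpoly 3 R) Q,
  [/\ forall i, deg_le s (P i), deg_le s Q
    & forall x, cell_int K x -> u x = mpoly_evalv P x + mpoly_eval Q x *: x].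

Definition Ucurl (s : nat) u : Prop := H0curl Omega u /\
  forall K, K \in cells M -> exists P Q : 'I_3 -> mpoly.mpoly 3 R,
  [/\ forall i, deg_le s (P i), forall i, deg_le s (Q i)
    & forall x, cell_int K x ->
        u x = mpoly_evalv P x + cross x (mpoly_evalv Q x)].

Definition Fh (m : nat) f : Prop := L2 Omega f /\ pw_poly m f.

Definition Qh (s : nat) f : Prop :=
  [/\ L2 Omega f, vol_int Omega f = 0 & pw_poly s f].

Definition bh f g v : R :=
  - (\sum_(K in cells M)
       vol_int (cell_int K) (fun x => dot (v x) (grad f x) * g x))
  + \sum_(e in int_faces)
       face_int e (fun x => dot (on_face e v x) (jump e f x) * avg e g x).

(* [beta e u] is the function beta_e(u), and [W e u v] is the weight
   beta_e(u) (v . n) / (u . n).  The quotient alone does not determine the weight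
   where u . n = 0. *)
Definition upwind_weight (s : nat) (beta : simplex -> vfield R -> sfield R)
    (W : simplex -> vfield R -> vfield R -> sfield R) : Prop :=
  forall e u, e \in int_faces -> Udiv s u ->
  [/\ forall x, hull e x -> 0 <= beta e u x,
      forall v x, Udiv s v -> hull e x -> normal_comp e u x != 0 ->
        W e u v x = beta e u x * (normal_comp e v x / normal_comp e u x),
      forall x, hull e x -> W e u u x = beta e u x,
      forall (a : R) v1 v2 x, Udiv s v1 -> Udiv s v2 -> hull e x ->
        W e u (fun y => a *: v1 y + v2 y) x = a * W e u v1 x + W e u v2 x
    & forall v P, Udiv s v ->
        (leb2 R).-integrable ref_triangle
          (fun q => (W e u v (face_param e q)
                     * mpoly_eval P (face_param e q))%:E)].

Definition bht (W : simplex -> vfield R -> vfield R -> sfield R) u f g v : R :=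
  bh f g v
  + \sum_(e in int_faces)
      face_int e (fun x => W e u v x * dot (jump e f x) (jump e g x)).

End Mesh.

(* Main.v *)
Require Import Defs.
From HB Require Import structures.
From mathcomp Require Import all_boot all_order all_algebra.
From mathcomp Require Import all_classical all_reals all_analysis.
From mathcomp Require Import measurable_realfun borel_hierarchy ring lra.
From mathcomp Require mpoly.
Import -(notations) mpoly.

Set Implicit Arguments.
Unset Strict Implicit.
Unset Printing Implicit Defensive.
Import Order.TTheory GRing.Theory Num.Theory.
Import numFieldNormedType.Exports.
Local Open Scope classical_set_scope.
Local Open Scope ring_scope.

(** The conservation laws rest on three properties of the discrete spaces; the rest is
    the choice of test functions.

    Normal fluxes cancel. On a cell, Green's formula for a Raviart-Thomas field u and a
    smooth function phi is classical. Summed over the mesh it leaves, for every face, the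
    integral of phi times the sum of the outward normal traces of u from the cells around
    that face (global_green). For u in H0(div) all these sums vanish, as one sees by
    testing with bubbles that meet a single face (fjump_eq0): the normal component is
    single valued, and zero on the boundary. If moreover div u = 0, then for g piecewise
    polynomial the sum over the cells of the integrals of u . grad g is the sum over the
    interior faces of the integrals of u . [[g]] (green_divfree). With g = f^2/2 this
    reads b_h(f, f, u) = 0, and with g = f it reads b_h(f, 1, u) = 0.

    Weak derivatives are classical on the cells. Test functions supported in a cell
    approximate all C1 functions there (cutoff_dense), so the weak divergence or curl has
    the same moments on every cell as the classical one. Thus div u_{k+1} is itself a
    discrete pressure, and the last equation of the scheme makes it vanish. The classical
    curl of a Nedelec field E lies in the Raviart-Thomas space: being the curl of a field
    without tangential trace it is orthogonal to gradients, so its normal fluxes cancel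
    (curl_conforming). Hence B_{k+1} = B_k - dt curl E exactly, and div B_k = 0 for all k.

    The curl is symmetric on fields without tangential trace. For fields that are merely
    square integrable, with a bounded and almost everywhere continuous curl, one of them is
    replaced by its convolution with Landau's kernels (1 - |x - y|^2 / r^2)^n. These are
    polynomials: the convolution is smooth on the whole space, and its curl is the
    convolution of the curl (curl_symmetric).

    With these facts, mass comes from sigma = 1, and the bound on the integral of rho^2
    from sigma = rho_{k+1/2}, where only the nonnegative stabilization remains. Energy
    comes from v = u_{k+1/2}, C = B_{k+1/2} and sigma = theta, because the works of the
    Lorentz force and of the electric field are opposite. If rho_0 = 1, conservation of
    mass and decay of the norm give rho_k = 1 for all k, and then v = B_{k+1/2},
    C = u_{k+1/2} give the cross helicity. For the magnetic helicity, symmetry of the curl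
    gives <A', B'> - <A, B> = <A + A', B' - B> = - dt <B + B', E> = - 2 dt <H, E>, which
    vanishes because E is the projection of - U x H. *)

(** * Linear changes of variables *)

Section ChangeOfVariables.
Variable R : realType.
Notation mu := (@lebesgue_measure R).
Local Open Scope ereal_scope.

(** The image of Lebesgue measure agrees with a multiple of it on intervals, hence
    everywhere. *)
Lemma ge0_integral_affine (a c : R) (f : R -> \bar R) : a != 0%R ->
  measurable_fun [set: R] f -> (forall x, 0 <= f x) ->
  \int[mu]_x f (a * x + c)%R = (`|a|^-1)%:E * \int[mu]_x f x.
Proof.
move=> a0 mf f0.
have aabs : (0 < `|a|)%R by rewrite normr_gt0.
pose g := (fun x : R => (a * x + c)%R : measurableTypeR R).
have mg : measurable_fun setT g.
  by apply: measurable_funD => //; apply: measurable_funM.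
have ka : (0 <= `|a|)%R by [].
pose nu := mscale (NngNum ka)
  (measure_function_pushforward__canonical__measure_function_Measure mu mg).
have nuE A : measurable A -> mu A = nu A.
  apply: lebesgue_measure_unique => _ [[x y]] _ <- /=.
  rewrite /mscale /= /pushforward lebesgue_measure_itv /= lte_fin.
  have [ap|an] := ltP 0%R a.
    rewrite (_ : g @^-1` `]x, y] = `](x - c) / a, (y - c) / a]%classic)%R; last first.
      apply/seteqP; split => z /=; rewrite !in_itv /= /g ltr_pdivrMr// ler_pdivlMr//;
        rewrite ltrBlDr lerBrDr (mulrC z) //.
    rewrite lebesgue_measure_itv /= lte_fin ltr_pM2r ?invr_gt0// ltrD2r.
    case: ifP => _; last by rewrite mule0.
    rewrite -!EFinD -EFinM gtr0_norm//; congr EFin; field.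
    exact: lt0r_neq0.
  have {}an : (a < 0)%R by rewrite lt_neqAle a0.
  rewrite (_ : g @^-1` `]x, y] = `[(y - c) / a, (x - c) / a[%classic)%R; last first.
    apply/seteqP; split => z /=; rewrite !in_itv /= /g ler_ndivrMr// ltr_ndivlMr//;
      rewrite ltrBlDr lerBrDr (mulrC z) // andbC //.
  rewrite lebesgue_measure_itv /= lte_fin ltr_nM2r ?invr_lt0// ltrD2r.
  case: ifP => _; last by rewrite mule0.
  rewrite -!EFinD -EFinM ltr0_norm//; congr EFin; field.
  exact: ltr0_neq0.
rewrite [in RHS](@eq_measure_integral _ _ _ setT nu mu); last by move=> A mA _; exact: nuE.
rewrite ge0_integral_mscale//.
rewrite ge0_integral_pushforward// preimage_setT /= /g.
by rewrite muleA -EFinM mulVf ?mul1e// gt_eqF.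
Qed.

(** By Tonelli's theorem a shear acts on one coordinate at a time. *)
Lemma ge0_integral_shear2 d (X : measurableType d)
    (m : {sigma_finite_measure set X -> \bar R}) (a : R) (c : X -> R)
    (f : X * R -> \bar R) : a != 0%R -> measurable_fun setT c ->
  measurable_fun setT f -> (forall p, 0 <= f p) ->
  \int[m \x mu]_p f (p.1, a * p.2 + c p.1)%R
    = (`|a|^-1)%:E * \int[m \x mu]_p f p.
Proof.
move=> a0 mc mf f0.
have mT : measurable_fun setT (fun p : X * R => (p.1, (a * p.2 + c p.1)%R)).
  apply: measurable_fun_pair => //; apply: measurable_funD.
    by apply: measurable_funM => //; exact: measurable_snd.
  by apply: measurableT_comp => //; exact: measurable_fst.
rewrite fubini_tonelli1 //=; last exact: (measurableT_comp mf mT).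
rewrite fubini_tonelli1 //=.
rewrite -ge0_integralZl//.
- apply: eq_integral => x _; rewrite /fubini_F /=.
  rewrite (@ge0_integral_affine a (c x) (fun y => f (x, y)))//.
  exact: measurable_fun_pair2.
- exact: measurable_fun_fubini_tonelli_F.
- by move=> x _; apply: integral_ge0.
Qed.

Lemma ge0_integral_shear1 d (X : measurableType d)
    (m : {sigma_finite_measure set X -> \bar R}) (a : R) (c : X -> R)
    (f : R * X -> \bar R) : a != 0%R -> measurable_fun setT c ->
  measurable_fun setT f -> (forall p, 0 <= f p) ->
  \int[mu \x m]_p f (a * p.1 + c p.2, p.2)%R
    = (`|a|^-1)%:E * \int[mu \x m]_p f p.
Proof.
move=> a0 mc mf f0.
have mT : measurable_fun setT (fun p : R * X => ((a * p.1 + c p.2)%R, p.2)).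
  apply: measurable_fun_pair => //; apply: measurable_funD.
    by apply: measurable_funM => //; exact: measurable_fst.
  by apply: measurableT_comp => //; exact: measurable_snd.
rewrite fubini_tonelli2 //=; last exact: (measurableT_comp mf mT).
rewrite fubini_tonelli2 //=.
rewrite -ge0_integralZl//.
- apply: eq_integral => x _; rewrite /fubini_G /=.
  rewrite (@ge0_integral_affine a (c x) (fun y => f (y, x)))//.
  exact: measurable_fun_pair1.
- exact: measurable_fun_fubini_tonelli_G.
- by move=> x _; apply: integral_ge0.
Qed.

Let plane_sigma_finite : sigma_finite setT (mu \x mu).
Proof.
have /sigma_finiteP[F [TF ndF Foo]] := sigma_finiteT mu.
exists (fun n => F n `*` F n).
  rewrite -setXTT predeqE => -[x y]; split=> //= _.
  have [n _ Fnx] : (\bigcup_i F i) x by rewrite -TF.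
  have [k _ Fky] : (\bigcup_i F i) y by rewrite -TF.
  exists (maxn n k) => //; split.
  - by move: x Fnx; exact/subsetPset/ndF/leq_maxl.
  - by move: y Fky; exact/subsetPset/ndF/leq_maxr.
move=> k; have [? ?] := Foo k.
split; first exact: measurableX.
by rewrite product_measure1E// lte_mul_pinfty// ge0_fin_numE.
Qed.

(** Carries the proof of sigma-finiteness that Tonelli's theorem requires for one more
    product. *)
Definition plane_measure : {sigma_finite_measure set _ -> \bar R} :=
  HB.pack (mu \x mu) (Measure_isSigmaFinite.Build _ _ _ (mu \x mu) plane_sigma_finite).

Definition rescales d (X : measurableType d) (m : {measure set X -> \bar R})
    (T : X -> X) (k : R) :=
  measurable_fun setT T /\ forall f : X -> \bar R,
  measurable_fun setT f -> (forall p, 0 <= f p) ->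
  \int[m]_p f (T p) = k%:E * \int[m]_p f p.

Lemma rescales_comp d (X : measurableType d) (m : {measure set X -> \bar R})
    T1 T2 k1 k2 :
  rescales m T1 k1 -> rescales m T2 k2 -> rescales m (T1 \o T2) (k2 * k1)%R.
Proof.
move=> [m1 h1] [m2 h2]; split; first exact: measurableT_comp.
move=> f mf f0; rewrite EFinM -muleA -h1//.
apply: (h2 (f \o T1)); first exact: (measurableT_comp mf m1).
by move=> p /=.
Qed.

Definition changes_volume (T : R * R * R -> R * R * R) (k : R) :=
  rescales (leb3 R) T k.

Definition changes_volume_comp T1 T2 k1 k2 :
  changes_volume T1 k1 -> changes_volume T2 k2 -> changes_volume (T1 \o T2) (k2 * k1)%R
  := @rescales_comp _ _ (leb3 R) T1 T2 k1 k2.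

Lemma rescales_area1 (a b t : R) : a != 0%R ->
  rescales (leb2 R) (fun q => ((a * q.1 + (b * q.2 + t))%R, q.2)) `|a|^-1.
Proof.
move=> a0; split.
  apply: measurable_fun_pair => //; repeat (apply: measurable_funD => //);
  by apply: measurable_funM.
move=> f mf f0.
apply: (@ge0_integral_shear1 _ _ mu a (fun y => b * y + t)%R f) => //.
by apply: measurable_funD => //; apply: measurable_funM.
Qed.

Lemma rescales_area2 (a b t : R) : b != 0%R ->
  rescales (leb2 R) (fun q => (q.1, (b * q.2 + (a * q.1 + t))%R)) `|b|^-1.
Proof.
move=> b0; split.
  apply: measurable_fun_pair => //; repeat (apply: measurable_funD => //);
  by apply: measurable_funM.
move=> f mf f0.
apply: (@ge0_integral_shear2 _ _ mu b (fun x => a * x + t)%R f) => //.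
by apply: measurable_funD => //; apply: measurable_funM.
Qed.

Lemma rescales_area_swap : rescales (leb2 R) (fun q => (q.2, q.1)) 1.
Proof.
have n1 : (-1 : R)%R != 0%R by rewrite oppr_eq0 oner_eq0.
have h1 := rescales_area2 1 0 (oner_neq0 R).
have h2 := rescales_area1 1 0 n1.
have h3 := rescales_area2 (-1) 0 (oner_neq0 R).
have := rescales_comp h3 (rescales_comp h2 h1).
rewrite normrN normr1 invr1 !mul1r; congr (rescales _ _ _).
by apply/funext => -[x y] /=; congr (_, _); ring.
Qed.

Let mp11 : measurable_fun setT (fun p : R * R * R => p.1.1).
Proof. by apply: (measurableT_comp (f := fst)). Qed.
Let mp12 : measurable_fun setT (fun p : R * R * R => p.1.2).
Proof. by apply: (measurableT_comp (f := snd)). Qed.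
Let mp2 : measurable_fun setT (fun p : R * R * R => p.2).
Proof. exact: measurable_snd. Qed.

Lemma changes_volume_shear3 (a b c t : R) : c != 0%R ->
  changes_volume (fun p => (p.1, (c * p.2 + (a * p.1.1 + b * p.1.2 + t))%R)) `|c|^-1.
Proof.
move=> c0; split.
  apply: measurable_fun_pair => //; repeat (apply: measurable_funD => //);
  by apply: measurable_funM.
move=> f mf f0.
apply: (@ge0_integral_shear2 _ _ plane_measure c
  (fun q => a * q.1 + b * q.2 + t)%R f)=> //.
by repeat (apply: measurable_funD => //); apply: measurable_funM.
Qed.

Lemma changes_volume_shear2 (a b c t : R) : b != 0%R ->
  changes_volume (fun p => (p.1.1, (b * p.1.2 + (a * p.1.1 + c * p.2 + t))%R, p.2))
    `|b|^-1.
Proof.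
move=> b0.
have mT : measurable_fun setT
    (fun p : R * R * R => (p.1.1, (b * p.1.2 + (a * p.1.1 + c * p.2 + t))%R, p.2)).
  apply: measurable_fun_pair => //; apply: measurable_fun_pair => //.
  by repeat (apply: measurable_funD => //); apply: measurable_funM.
split=> // f mf f0.
rewrite (@fubini_tonelli2 _ _ _ _ _ plane_measure mu) //=; last exact: (measurableT_comp mf mT).
rewrite (@fubini_tonelli2 _ _ _ _ _ plane_measure mu) //=.
rewrite -ge0_integralZl//.
- apply: eq_integral => z _; rewrite /fubini_G /=.
  rewrite (@ge0_integral_shear2 _ _ mu b (fun x => a * x + c * z + t)%R
    (fun q => f (q, z)))//; last exact: measurable_fun_pair1.
  by repeat (apply: measurable_funD => //); apply: measurable_funM.
- exact: measurable_fun_fubini_tonelli_G.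
- by move=> x _; apply: integral_ge0.
Qed.

Lemma changes_volume_shear1 (a b c t : R) : a != 0%R ->
  changes_volume (fun p => ((a * p.1.1 + (b * p.1.2 + c * p.2 + t))%R, p.1.2, p.2))
    `|a|^-1.
Proof.
move=> a0.
have mT : measurable_fun setT
    (fun p : R * R * R => ((a * p.1.1 + (b * p.1.2 + c * p.2 + t))%R, p.1.2, p.2)).
  apply: measurable_fun_pair => //; apply: measurable_fun_pair => //.
  by repeat (apply: measurable_funD => //); apply: measurable_funM.
split=> // f mf f0.
rewrite (@fubini_tonelli2 _ _ _ _ _ plane_measure mu) //=; last exact: (measurableT_comp mf mT).
rewrite (@fubini_tonelli2 _ _ _ _ _ plane_measure mu) //=.
rewrite -ge0_integralZl//.
- apply: eq_integral => z _; rewrite /fubini_G /=.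
  rewrite (@ge0_integral_shear1 _ _ mu a (fun x => b * x + c * z + t)%R
    (fun q => f (q, z)))//; last exact: measurable_fun_pair1.
  by repeat (apply: measurable_funD => //); apply: measurable_funM.
- exact: measurable_fun_fubini_tonelli_G.
- by move=> x _; apply: integral_ge0.
Qed.

Lemma changes_volume_swap12 : changes_volume (fun p => (p.1.2, p.1.1, p.2)) 1.
Proof.
have n1 : (-1 : R)%R != 0%R by rewrite oppr_eq0 oner_eq0.
have h1 := changes_volume_shear2 1 0 0 (oner_neq0 R).
have h2 := changes_volume_shear1 1 0 0 n1.
have h3 := changes_volume_shear2 (-1) 0 0 (oner_neq0 R).
have := changes_volume_comp h3 (changes_volume_comp h2 h1).
rewrite normrN normr1 invr1 !mul1r; congr (changes_volume _ _).
by apply/funext => -[[x y] z] /=; congr (_, _, _); ring.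
Qed.

Lemma changes_volume_swap23 : changes_volume (fun p => (p.1.1, p.2, p.1.2)) 1.
Proof.
have n1 : (-1 : R)%R != 0%R by rewrite oppr_eq0 oner_eq0.
have h1 := changes_volume_shear3 0 1 0 (oner_neq0 R).
have h2 := changes_volume_shear2 0 1 0 n1.
have h3 := changes_volume_shear3 0 (-1) 0 (oner_neq0 R).
have := changes_volume_comp h3 (changes_volume_comp h2 h1).
rewrite normrN normr1 invr1 !mul1r; congr (changes_volume _ _).
by apply/funext => -[[x y] z] /=; congr (_, _, _); ring.
Qed.

(** The affine map with constant term o and columns a, b, c. *)
Definition affine3 (o a b c : R * R * R) (p : R * R * R) : R * R * R :=
  ((o.1.1 + p.1.1 * a.1.1 + p.1.2 * b.1.1 + p.2 * c.1.1)%R,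
   (o.1.2 + p.1.1 * a.1.2 + p.1.2 * b.1.2 + p.2 * c.1.2)%R,
   (o.2 + p.1.1 * a.2 + p.1.2 * b.2 + p.2 * c.2)%R).

Definition det3 (a b c : R * R * R) : R :=
  (a.1.1 * (b.1.2 * c.2 - b.2 * c.1.2) - a.1.2 * (b.1.1 * c.2 - b.2 * c.1.1)
   + a.2 * (b.1.1 * c.1.2 - b.1.2 * c.1.1))%R.

(** Gaussian elimination: with nonzero pivots the map is a composition of shears. *)
Lemma changes_volume_pivot (o a b c : R * R * R) :
  a.1.1 != 0%R -> (a.1.1 * b.1.2 - a.1.2 * b.1.1 != 0)%R -> det3 a b c != 0%R ->
  changes_volume (affine3 o a b c) `|det3 a b c|^-1.
Proof.
case: o => -[t1 t2] t3; case: a => -[a1 a2] a3; case: b => -[b1 b2] b3; case: c => -[c1 c2] c3 /=.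
move=> a0 m0; rewrite /det3 /= => d0.
pose m := (a1 * b2 - a2 * b1)%R.
pose d := (a1 * (b2 * c3 - b3 * c2) - a2 * (b1 * c3 - b3 * c1)
   + a3 * (b1 * c2 - b2 * c1))%R.
have h1 := changes_volume_shear1 b1 c1 t1 a0.
have ma0 : (m / a1 != 0)%R by rewrite mulf_neq0// invr_eq0.
have dm0 : (d / m != 0)%R by rewrite mulf_neq0// invr_eq0.
(* after the first step the first coordinate is a1 x + b1 y + c1 z + t1 *)
have h2 := changes_volume_shear2 (a2 / a1) ((c2 - a2 * c1 / a1))
   (t2 - a2 * t1 / a1) ma0.
have h3 := changes_volume_shear3 (a3 / a1 - (b3 - a3 * b1 / a1) * (a2 / m))
  ((b3 - a3 * b1 / a1) * (a1 / m))
  (t3 - a3 * t1 / a1 - (b3 - a3 * b1 / a1) * (a1 / m) * (t2 - a2 * t1 / a1)) dm0.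
have := changes_volume_comp h3 (changes_volume_comp h2 h1).
rewrite -!invfM -!normrM; congr (changes_volume _ _); last first.
  by congr (`|_|^-1)%R; rewrite /d /m; field; apply/andP.
apply/funext => -[[x y] z] /=; rewrite /affine3 /=; congr (_, _, _).
- by ring.
- by rewrite /m; field.
- by rewrite /d /m; field; apply/andP.
Qed.

(** Some permutation of the columns has nonzero pivots, and permutations of the
    coordinates preserve the volume. *)
Lemma changes_volume_affine (o a b c : R * R * R) : det3 a b c != 0%R ->
  changes_volume (affine3 o a b c) `|det3 a b c|^-1.
Proof.
move=> d0.
have h12 u v w : changes_volume (affine3 o v u w) `|det3 v u w|^-1 ->
    changes_volume (affine3 o u v w) `|det3 u v w|^-1.
  move=> /changes_volume_comp/(_ changes_volume_swap12); rewrite mul1r.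
  have -> : (det3 v u w = - det3 u v w)%R by rewrite /det3; ring.
  rewrite normrN; congr (changes_volume _ _).
  by apply/funext => p; rewrite /affine3 /=; congr (_, _, _); ring.
have h23 u v w : changes_volume (affine3 o u w v) `|det3 u w v|^-1 ->
    changes_volume (affine3 o u v w) `|det3 u v w|^-1.
  move=> /changes_volume_comp/(_ changes_volume_swap23); rewrite mul1r.
  have -> : (det3 u w v = - det3 u v w)%R by rewrite /det3; ring.
  rewrite normrN; congr (changes_volume _ _).
  by apply/funext => p; rewrite /affine3 /=; congr (_, _, _); ring.
have D12 u v w : (det3 v u w != 0 <-> det3 u v w != 0)%R.
  have -> : (det3 v u w = - det3 u v w)%R by rewrite /det3; ring.
  by rewrite oppr_eq0.
have D23 u v w : (det3 u w v != 0 <-> det3 u v w != 0)%R.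
  have -> : (det3 u w v = - det3 u v w)%R by rewrite /det3; ring.
  by rewrite oppr_eq0.
(* one of the two columns of a nonzero minor provides the first pivot *)
have two u v w : (u.1.1 * v.1.2 - u.1.2 * v.1.1 != 0)%R -> det3 u v w != 0%R ->
    changes_volume (affine3 o u v w) `|det3 u v w|^-1.
  move=> m0 D; have [u0|u0] := eqVneq u.1.1 0%R; last exact: changes_volume_pivot.
  apply: h12; apply: changes_volume_pivot.
  - by apply: contraNneq m0 => ->; rewrite u0; apply/eqP; ring.
  - by apply: contraNneq m0 => e; apply/eqP; rewrite -[LHS]opprK -[RHS]oppr0 -e; congr (- _)%R; ring.
  - exact/D12.
have [m1|h] := eqVneq (a.1.1 * b.1.2 - a.1.2 * b.1.1)%R 0%R; last exact: two.
have [m2|h] := eqVneq (a.1.1 * c.1.2 - a.1.2 * c.1.1)%R 0%R; last first.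
  by apply/h23/two => //; exact/D23.
have [m3|h] := eqVneq (b.1.1 * c.1.2 - b.1.2 * c.1.1)%R 0%R; last first.
  by apply/h12/h23/two => //; apply/D23/D12.
case/eqP: d0.
transitivity (c.2 * (a.1.1 * b.1.2 - a.1.2 * b.1.1) - b.2 * (a.1.1 * c.1.2 - a.1.2 * c.1.1)
   + a.2 * (b.1.1 * c.1.2 - b.1.2 * c.1.1))%R; first by rewrite /det3; ring.
by rewrite m1 m2 m3; ring.
Qed.

End ChangeOfVariables.

(** * Coordinates and measurability in space *)

Section Coordinates.
Variable R : realType.
Notation rV3 := 'rV[R]_3.
Notation R3 := (R * R * R)%type.
Notation leb := (leb3 R).

Lemma ord3_ind (P : 'I_3 -> Prop) : P 0 -> P 1 -> P 2 -> forall i, P i.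
Proof.
by move=> P0 P1 P2; case=> -[|[|[|//]]] ?; [move: P0|move: P1|move: P2];
  congr P; apply: val_inj.
Qed.

Lemma sum3 (V : nmodType) (F : 'I_3 -> V) :
  \sum_(i < 3) F i = F 0 + F 1 + F 2.
Proof.
rewrite !big_ord_recl big_ord0 addr0 addrA.
by congr (_ + _ + _); congr F; apply: val_inj.
Qed.

Definition xyz (x : rV3) : R3 := (x 0 0, x 0 1, x 0 2).

Lemma vec3K : cancel (@vec3 R) xyz.
Proof. by move=> -[[x y] z]; rewrite /xyz /vec3 !mxE. Qed.

Lemma row3P (x y : rV3) : x 0 0 = y 0 0 -> x 0 1 = y 0 1 -> x 0 2 = y 0 2 -> x = y.
Proof. by move=> h0 h1 h2; apply/rowP; elim/ord3_ind. Qed.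

Lemma vec3E (p : R3) : (vec3 p 0 0 = p.1.1) * (vec3 p 0 1 = p.1.2) * (vec3 p 0 2 = p.2).
Proof. by rewrite /vec3 !mxE. Qed.

Lemma measurable_coordinate i : measurable_fun setT (fun p : R3 => vec3 p 0 i).
Proof.
elim/ord3_ind: i; under eq_fun do rewrite vec3E.
- by apply: (measurableT_comp (f := fst)).
- by apply: (measurableT_comp (f := snd)).
- exact: measurable_snd.
Qed.

Lemma ball_rowP (x y : rV3) e : 0 < e ->
  ball x e y <-> forall i, `|x 0 i - y 0 i| < e.
Proof.
move=> e0; split; first by case=> _ h i; exact: h.
by move=> h; split=> // i j; rewrite ord1; exact: h.
Qed.

Lemma le_coord_norm (x : rV3) i : `|x 0 i| <= `|x|.
Proof.
by rewrite [leRHS]/Num.norm /= mx_normrE; apply/bigmax_geP; right => /=; exists (0, i).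
Qed.

Lemma norm_rowP (x : rV3) e : 0 <= e -> `|x| <= e <-> forall i, `|x 0 i| <= e.
Proof.
move=> e0; split; first by move=> h i; exact: le_trans (le_coord_norm _ _) h.
move=> h; rewrite [leLHS]/Num.norm /= mx_normrE; apply/bigmax_leP; split=> //= -[i j] _ /=.
by rewrite ord1.
Qed.

(** An open set is a countable union of cubes with rational centre. *)
Lemma open_measurable3 (U : set rV3) : open U -> measurable (@vec3 R @^-1` U).
Proof.
move=> oU.
pose cube (c : rat * rat * rat * nat) : set R3 := [set p |
  `|p.1.1 - ratr c.1.1.1| < c.2.+1%:R^-1 /\ `|p.1.2 - ratr c.1.1.2| < c.2.+1%:R^-1 /\
  `|p.2 - ratr c.1.2| < c.2.+1%:R^-1].
have mcube c : measurable (cube c).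
  have mi i (r : R) e : measurable [set p : R3 | `|vec3 p 0 i - r| < e].
    have m : measurable_fun setT (fun p : R3 => `|vec3 p 0 i - r|).
      apply: measurableT_comp => //; apply: measurable_funB => //.
      exact: measurable_coordinate.
    rewrite -[X in measurable X]setTI.
    have -> : [set p : R3 | `|vec3 p 0 i - r| < e] =
        (fun p : R3 => `|vec3 p 0 i - r|) @^-1` `]-oo, e[%classic.
      by apply/seteqP; split => p /=; rewrite in_itv.
    exact: m.
  have -> : cube c = [set p : R3 | `|vec3 p 0 0 - ratr c.1.1.1| < c.2.+1%:R^-1] `&`
    ([set p : R3 | `|vec3 p 0 1 - ratr c.1.1.2| < c.2.+1%:R^-1] `&`
    [set p : R3 | `|vec3 p 0 2 - ratr c.1.2| < c.2.+1%:R^-1]).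
    by apply/seteqP; split=> p /=; rewrite !vec3E.
  by do ?apply: measurableI.
have -> : @vec3 R @^-1` U =
    \bigcup_(c in [set c | cube c `<=` @vec3 R @^-1` U]) cube c.
  apply/seteqP; split; last by move=> p [c /= h]; apply: h.
  move=> p /= Up.
  have /nbhs_ballP[e /= e0 eU] : nbhs (vec3 p) U by exact: open_nbhs_nbhs.
  have [n n0] : exists n : nat, n.+1%:R^-1 < e / 2.
    have [n ne] := ltr_add_invr (divr_gt0 e0 (ltr0n R 2)).
    by exists n; move: ne; rewrite add0r.
  have /choice[q hq] : forall r : R, exists x : rat, `|r - ratr x| < n.+1%:R^-1.
    move=> r.
    have i0 : r - n.+1%:R^-1 < r + n.+1%:R^-1.
      by rewrite ltrD2l gtrN// invr_gt0.
    have [x] := rat_in_itvoo i0; rewrite in_itv/= => /andP[h1 h2]; exists x.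
    by rewrite distrC ltr_distl h1 h2.
  exists (q p.1.1, q p.1.2, q p.2, n); last by split => //=.
  move=> r [/= h1 [h2 h3]]; apply: eU; apply/ball_rowP => //.
  move: (hq p.1.1) (hq p.1.2) (hq p.2) => k1 k2 k3.
  have tri (x y z : R) : `|x - z| < n.+1%:R^-1 -> `|y - z| < n.+1%:R^-1 -> `|x - y| < e.
    move=> a b; have -> : x - y = (x - z) - (y - z) by ring.
    apply: le_lt_trans (ler_normB _ _) _.
    by rewrite [ltRHS]splitr ltrD// (lt_trans _ n0).
  by elim/ord3_ind; rewrite !vec3E; apply: tri.
rewrite bigcup_mkcond; apply: countable_bigcupT_measurable => [|c]; first exact: countableP.
by case: ifP => // _; exact: measurable0.
Qed.

Lemma continuous_measurable3 (f : rV3 -> R) :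
  continuous f -> measurable_fun setT (fun p : R3 => f (vec3 p)).
Proof.
move=> cf; apply: (measurability _ (RGenOpens.measurableE R)).
move=> _ [_ [a [b ->] <-]]; rewrite setTI.
apply: (@open_measurable3 (f @^-1` `]a, b[)).
apply: open_comp; first by move=> x _; exact: cf.
exact: (@interval_open R (BRight a) (BLeft b) isT isT).
Qed.

Lemma closed_measurable3 (U : set rV3) : closed U -> measurable (@vec3 R @^-1` U).
Proof.
move=> cU; rewrite -[U]setCK preimage_setC; apply: measurableC.
exact: (@open_measurable3 (~` U) (closed_openC cU)).
Qed.

Lemma bounded_lebesgue (D : set rV3) : measurable (@vec3 R @^-1` D) -> bounded_set D ->
  (leb (@vec3 R @^-1` D) < +oo)%E.
Proof.
move=> mD [M [_ hM]].
pose r := `|M| + 1; pose I := `[- r, r]%classic : set R.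
have hr x : D x -> `|x| <= r.
  by move=> Dx; apply: (hM r) => //; rewrite /r (le_lt_trans (ler_norm M))// ltrDl.
have sub : @vec3 R @^-1` D `<=` (I `*` I) `*` I.
  move=> p /= /hr/norm_rowP h; have {}h := h (addr_ge0 (normr_ge0 _) ler01).
  by rewrite /I; do !split; rewrite /= in_itv /= -ler_norml; [move: (h 0)|move: (h 1)|
    move: (h 2)]; rewrite vec3E.
have mI : (lebesgue_measure I < +oo)%E.
  by rewrite /I lebesgue_measure_itv /= ; case: ifP; rewrite ?ltry// -EFinB ltry.
have mIm : measurable (I : set (measurableTypeR R)) by exact: measurable_itv.
apply: (@le_lt_trans _ _ (leb ((I `*` I) `*` I))).
  apply: le_measure => //; rewrite inE //.
  by apply: measurableX => //; apply: measurableX.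
have E1 : (leb2 R) (I `*` I) = (leb1 R I * leb1 R I)%E by exact: product_measure1E.
have -> : leb (I `*` I `*` I) = ((leb2 R) (I `*` I) * leb1 R I)%E.
  by apply: product_measure1E => //; exact: measurableX.
have Ifin : lebesgue_measure I \is a fin_num by rewrite ge0_fin_numE.
by rewrite E1 -(fineK Ifin) -!EFinM ltry.
Qed.

End Coordinates.

(** * Integrals over subsets of space *)

Section VolumeIntegral.
Variable R : realType.
Notation rV3 := 'rV[R]_3.
Notation R3 := (R * R * R)%type.
Notation leb := (leb3 R).
Implicit Types (D : set rV3) (f g : rV3 -> R).

Definition mset3 D := measurable (@vec3 R @^-1` D).
Definition mfun3 D f := measurable_fun (@vec3 R @^-1` D) (fun p : R3 => f (vec3 p)).
Definition int3 D f :=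
  leb.-integrable (@vec3 R @^-1` D) (fun p : R3 => (f (vec3 p))%:E).

Lemma eq_vol_int D f g : (forall x, D x -> f x = g x) -> vol_int D f = vol_int D g.
Proof. by move=> h; apply: eq_Rintegral => p /set_mem /= /h. Qed.

Lemma eq_int3 D f g : mset3 D -> (forall x, D x -> f x = g x) -> int3 D f -> int3 D g.
Proof.
move=> mD h; apply: eq_integrable => // p /set_mem /= /h -> //.
Qed.

Lemma int3D D f g : mset3 D -> int3 D f -> int3 D g -> int3 D (fun x => f x + g x).
Proof. move=> mD hf hg; have := integrableD (mu := leb) mD hf hg.
by apply: eq_integrable => // p _ /=; rewrite EFinD. Qed.

Lemma int3B D f g : mset3 D -> int3 D f -> int3 D g -> int3 D (fun x => f x - g x).
Proof. move=> mD hf hg; have := integrableB (mu := leb) mD hf hg.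
by apply: eq_integrable => // p _ /=; rewrite EFinB. Qed.

Lemma int3Z D f k : mset3 D -> int3 D f -> int3 D (fun x => k * f x).
Proof. move=> mD hf; have := integrableZl (mu := leb) mD k hf.
by apply: eq_integrable => // p _ /=; rewrite EFinM. Qed.

Lemma int3_0 D : mset3 D -> int3 D (fun=> 0).
Proof. by move=> mD; apply: integrable0. Qed.

Lemma int3_sum D I (r : seq I) (P : pred I) (F : I -> rV3 -> R) : mset3 D ->
  (forall i, P i -> int3 D (F i)) -> int3 D (fun x => \sum_(i <- r | P i) F i x).
Proof.
move=> mD h; elim: r => [|i r IH].
  by apply: eq_int3 (int3_0 mD) => // x _; rewrite big_nil.
case Pi: (P i); last by apply: eq_int3 IH => // x _; rewrite big_cons Pi.
by apply: eq_int3 (int3D mD (h _ Pi) IH) => // x _; rewrite big_cons Pi.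
Qed.

Lemma vol_intD D f g : mset3 D -> int3 D f -> int3 D g ->
  vol_int D (fun x => f x + g x) = vol_int D f + vol_int D g.
Proof. by move=> mD hf hg; rewrite /vol_int RintegralD. Qed.

Lemma vol_intB D f g : mset3 D -> int3 D f -> int3 D g ->
  vol_int D (fun x => f x - g x) = vol_int D f - vol_int D g.
Proof. by move=> mD hf hg; rewrite /vol_int RintegralB. Qed.

Lemma vol_intZ D f k : mset3 D -> int3 D f ->
  vol_int D (fun x => k * f x) = k * vol_int D f.
Proof. by move=> mD hf; rewrite /vol_int RintegralZl. Qed.

Lemma vol_int0 D : vol_int D (fun=> 0) = 0.
Proof. by rewrite /vol_int /Rintegral integral0. Qed.

Lemma vol_int_eq0 D f : (forall x, D x -> f x = 0) -> vol_int D f = 0.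
Proof. by move=> h; rewrite (eq_vol_int h) vol_int0. Qed.

Lemma vol_int_sum D I (r : seq I) (P : pred I) (F : I -> rV3 -> R) : mset3 D ->
  (forall i, P i -> int3 D (F i)) ->
  vol_int D (fun x => \sum_(i <- r | P i) F i x) = \sum_(i <- r | P i) vol_int D (F i).
Proof.
move=> mD h; elim: r => [|i r IH].
  by rewrite big_nil; apply: vol_int_eq0 => x _; rewrite big_nil.
rewrite big_cons; case Pi: (P i); last first.
  by rewrite -IH; apply: eq_vol_int => x _; rewrite big_cons Pi.
rewrite -IH -vol_intD//; last 2 first.
- exact: h.
- exact: int3_sum.
by apply: eq_vol_int => x _; rewrite big_cons Pi.
Qed.

Lemma vol_int_ge0 D f : (forall x, D x -> 0 <= f x) -> 0 <= vol_int D f.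
Proof. by move=> h; apply: Rintegral_ge0 => p /h. Qed.

Lemma mfun3_continuous D f : continuous f -> mfun3 D f.
Proof. by move=> cf; apply: measurable_funTS; exact: continuous_measurable3. Qed.

Lemma bounded_int3 D f M : mset3 D -> bounded_set D -> mfun3 D f ->
  (forall x, D x -> `|f x| <= M) -> int3 D f.
Proof.
move=> mD bD mf hM; apply: measurable_bounded_integrable => //.
  exact: bounded_lebesgue.
exists M; split; first by rewrite num_real.
by move=> x Mx p /= Dp; rewrite (le_trans (hM _ Dp))// ltW.
Qed.

Lemma bounded_setS (A B : set rV3) : A `<=` B -> bounded_set B -> bounded_set A.
Proof.
by move=> AB [M [Mr h]]; exists M; split=> // x Mx y /AB; exact: h.
Qed.

Lemma bounded_set_le (A : set rV3) M : (forall x, A x -> `|x| <= M) -> bounded_set A.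
Proof.
move=> h; exists M; split; first by rewrite num_real.
by move=> x Mx y Ay /=; rewrite (le_trans (h _ Ay))// ltW.
Qed.

Lemma bounded_closure (A : set rV3) : bounded_set A -> bounded_set (closure A).
Proof.
move=> [M [Mr h]]; pose r := `|M| + 1.
have hr x : A x -> `|x| <= r.
  by apply: h; rewrite /r (le_lt_trans (ler_norm M))// ltrDl.
apply: (@bounded_set_le _ r) => x.
have cl : closed [set x : rV3 | `|x| <= r].
  have -> : [set x : rV3 | `|x| <= r] = (@Num.norm R rV3) @^-1` [set y | y <= r] by [].
  by apply: closed_comp => [y _|]; [exact: norm_continuous|exact: closed_le].
by apply: (closure_subset (B := [set x : rV3 | `|x| <= r]) hr x) || (move=> /(closure_subset hr); rewrite -(closure_id _).1).
Qed.

(** The closure of a bounded set is compact. *)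
Lemma continuous_bounded (D : set rV3) f : bounded_set D -> continuous f ->
  exists2 M, 0 <= M & forall x, D x -> `|f x| <= M.
Proof.
move=> bD cf.
have cD : compact (closure D).
  by apply: bounded_closed_compact; [exact: bounded_closure|exact: closed_closure].
have : compact (f @` closure D).
  by apply: continuous_compact => //; exact: continuous_subspaceT.
move=> /compact_bounded[M [Mr h]]; exists (`|M| + 1); first by rewrite addr_ge0.
move=> x Dx; apply: (h (`|M| + 1)); first by rewrite (le_lt_trans (ler_norm M))// ltrDl.
by exists x => //; exact: subset_closure.
Qed.

Lemma continuous_int3 D f : mset3 D -> bounded_set D -> continuous f -> int3 D f.
Proof.
move=> mD bD cf; have [M _ hM] := continuous_bounded bD cf.
by apply: (bounded_int3 (M := M)) => //; exact: mfun3_continuous.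
Qed.

Lemma int3M_bounded D f g M : mset3 D -> int3 D f -> mfun3 D g ->
  (forall x, D x -> `|g x| <= M) -> int3 D (fun x => f x * g x).
Proof.
move=> mD hf mg hM.
apply: (@le_integrable _ _ _ leb _ mD _ (fun p : R3 => (`|M| * `|f (vec3 p)|)%:E)).
- apply/measurable_EFinP; apply: measurable_funM => //.
  by move/integrableP: hf => [/measurable_EFinP].
- move=> p Dp; rewrite lee_fin normrM [leRHS]ger0_norm ?mulr_ge0// mulrC.
  by rewrite ler_wpM2r// (le_trans (hM _ Dp))// ler_norm.
- have := integrableZl (mu := leb) mD `|M| (integrable_abse hf).
  by apply: eq_integrable.
Qed.

End VolumeIntegral.

Lemma Rintegral_rescales (R : realType) d (X : measurableType d)
    (m : {measure set X -> \bar R}) T k (D : set X) (g : X -> R) :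
  rescales m T k -> measurable D -> m.-integrable D (EFin \o g) ->
  \int[m]_(p in T @^-1` D) g (T p) = k * \int[m]_(p in D) g p.
Proof.
move=> [mT hT] mD ig.
rewrite Rintegral_mkcond [in RHS]Rintegral_mkcond.
have ih : m.-integrable setT (EFin \o (g \_ D)).
  by rewrite -restrict_EFin; apply/integrable_restrict => //; rewrite setTI.
have mh : measurable_fun setT (EFin \o (g \_ D)) by case/integrableP: ih.
have -> : (fun p => ((fun p => g (T p)) \_ (T @^-1` D)) p) = (g \_ D) \o T.
  by apply/funext => p; rewrite /patch /=; congr (if _ then _ else _); rewrite !mem_setE.
rewrite /Rintegral integralE [in RHS]integralE.
have hp := hT _ (measurable_funepos mh) (fun p => funepos_ge0 _ p).
have hn := hT _ (measurable_funeneg mh) (fun p => funeneg_ge0 _ p).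
rewrite [X in fine (X - _)%E = _](_ : _ = k%:E * \int[m]_p ((EFin \o (g \_ D))^\+ p))%E; last first.
  by rewrite -hp; apply: eq_integral => x _; rewrite ?funeposE.
rewrite [X in fine (_ - X)%E = _](_ : _ = k%:E * \int[m]_p ((EFin \o (g \_ D))^\- p))%E; last first.
  by rewrite -hn; apply: eq_integral => x _; rewrite ?funenegE.
have fp := integrable_pos_fin_num measurableT ih.
have fn := integrable_neg_fin_num measurableT ih.
by rewrite -(fineK fp) -(fineK fn) -!EFinM -!EFinB /= mulrBr.
Qed.

(** * Functions of class C1 and polynomials *)

Section Calculus.
Variable R : realType.
Notation rV3 := 'rV[R]_3.
Implicit Types (f g : rV3 -> R).

Lemma derive_pd f x d : differentiable f x ->
  'D_d f x = \sum_(i < 3) d 0 i * pd i f x.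
Proof.
move=> df; rewrite deriveE // {1}[d]row_sum_delta linear_sum /=.
apply: eq_bigr => i _; rewrite linearZ /= /pd deriveE //.
Qed.

Lemma pd_diff i f x : differentiable f x -> pd i f x = 'd f x (delta_mx 0 i).
Proof. by move=> df; rewrite /pd deriveE. Qed.

Lemma C1_diff f x : C1 f -> differentiable f x. Proof. by case. Qed.
Lemma C1_continuous f : C1 f -> continuous f.
Proof. by move=> [df _] x; exact: differentiable_continuous. Qed.
Lemma C1_pd f i : C1 f -> continuous (pd i f). Proof. by case. Qed.

Lemma eq_continuous_fun (T U : topologicalType) (f g : T -> U) :
  (forall x, f x = g x) -> continuous f -> continuous g.
Proof. by move=> /funext ->. Qed.

Lemma continuous_add (T : topologicalType) (f g : T -> R) :
  continuous f -> continuous g -> continuous (fun x => f x + g x).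
Proof. by move=> cf cg x; exact: (cvgD (cf x) (cg x)). Qed.

Lemma continuous_mul (T : topologicalType) (f g : T -> R) :
  continuous f -> continuous g -> continuous (fun x => f x * g x).
Proof. by move=> cf cg x; exact: (cvgM (cf x) (cg x)). Qed.

Lemma continuous_cst (T : topologicalType) (c : R) : continuous (fun _ : T => c).
Proof. exact: cst_continuous. Qed.

Lemma continuous_sum (T : topologicalType) I (r : seq I) (P : pred I) (F : I -> T -> R) :
  (forall i, P i -> continuous (F i)) -> continuous (fun x => \sum_(i <- r | P i) F i x).
Proof.
move=> h; elim: r => [|i r IH].
  by under eq_fun do rewrite big_nil; exact: continuous_cst.
under eq_fun do rewrite big_cons; case Pi: (P i) => //.
by apply: continuous_add => //; exact: h.
Qed.

Lemma pd_cst (c : R) i x : pd i (fun=> c) x = 0.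
Proof. by rewrite /pd derive_cst. Qed.

Lemma C1_cst (c : R) : C1 (fun _ : rV3 => c).
Proof.
split; first by move=> x; exact: differentiable_cst.
by move=> i; apply: (eq_continuous_fun (f := fun=> 0)) => [x|];
  [rewrite pd_cst|exact: cst_continuous].
Qed.

Lemma pdD f g i x : differentiable f x -> differentiable g x ->
  pd i (fun y => f y + g y) x = pd i f x + pd i g x.
Proof. by move=> df dg; rewrite /pd; apply: deriveD; exact: diff_derivable. Qed.

Lemma C1D f g : C1 f -> C1 g -> C1 (fun x => f x + g x).
Proof.
move=> [df cf] [dg cg]; split; first by move=> x; exact: differentiableD.
move=> i; apply: (eq_continuous_fun (f := fun x => pd i f x + pd i g x)) => x.
  by rewrite pdD.
exact: (continuous_add (cf i) (cg i)).
Qed.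

Lemma pdM f g i x : differentiable f x -> differentiable g x ->
  pd i (fun y => f y * g y) x = f x * pd i g x + g x * pd i f x.
Proof. by move=> df dg; rewrite /pd; apply: deriveM; exact: diff_derivable. Qed.

Lemma C1M f g : C1 f -> C1 g -> C1 (fun x => f x * g x).
Proof.
move=> f1 g1; have [df cf] := f1; have [dg cg] := g1.
split; first by move=> x; exact: differentiableM.
move=> i; apply: (eq_continuous_fun (f := fun x => f x * pd i g x + g x * pd i f x)) => x.
  by rewrite pdM.
move: x; apply: continuous_add; apply: continuous_mul => //; exact: C1_continuous.
Qed.

Lemma C1Z c f : C1 f -> C1 (fun x => c * f x).
Proof. by apply: C1M; exact: C1_cst. Qed.

Lemma pdZ c f i x : differentiable f x -> pd i (fun y => c * f y) x = c * pd i f x.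
Proof.
move=> df; rewrite (pdM _ (C1_diff x (C1_cst c)) df).
by rewrite pd_cst mulr0 addr0.
Qed.

Lemma C1N f : C1 f -> C1 (fun x => - f x).
Proof. by move=> /(C1Z (-1)); congr C1; apply/funext => x; rewrite mulN1r. Qed.

Lemma C1B f g : C1 f -> C1 g -> C1 (fun x => f x - g x).
Proof. by move=> hf hg; apply: C1D => //; exact: C1N. Qed.

Lemma pdB f g i x : differentiable f x -> differentiable g x ->
  pd i (fun y => f y - g y) x = pd i f x - pd i g x.
Proof. by move=> df dg; rewrite /pd; apply: deriveB; exact: diff_derivable. Qed.

Lemma pd_coord j i (x : rV3) : pd i (fun y : rV3 => y 0 j) x = (i == j)%:R.
Proof.
rewrite /pd /derive; apply: cvg_lim => //.
apply: cvg_near_cst.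
near=> h; rewrite /= !mxE eqxx /= addrK.
have h0 : h != 0 by near: h; exact: nbhs_dnbhs_neq.
by rewrite [_ *: _]mulrA mulVf// mul1r eq_sym.
Unshelve. all: by end_near. Qed.

Lemma C1_coord j : C1 (fun x : rV3 => x 0 j).
Proof.
split; first by move=> x; exact: differentiable_coord.
by move=> i; apply: (eq_continuous_fun (f := fun=> (i == j)%:R : R)) => [x|];
  [rewrite pd_coord|exact: cst_continuous].
Qed.

Lemma C1_sum I (r : seq I) (P : pred I) (F : I -> rV3 -> R) :
  (forall i, P i -> C1 (F i)) -> C1 (fun x => \sum_(i <- r | P i) F i x).
Proof.
move=> h; elim: r => [|i r IH].
  by under eq_fun do rewrite big_nil; exact: C1_cst.
under eq_fun do rewrite big_cons; case Pi: (P i) => //.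
by apply: C1D => //; exact: h.
Qed.

Lemma pd_sum I (r : seq I) (P : pred I) (F : I -> rV3 -> R) k x :
  (forall i, P i -> C1 (F i)) ->
  pd k (fun y => \sum_(i <- r | P i) F i y) x = \sum_(i <- r | P i) pd k (F i) x.
Proof.
move=> h; elim: r => [|i r IH].
  by rewrite big_nil; under eq_fun do rewrite big_nil; rewrite pd_cst.
rewrite big_cons -IH; under eq_fun do rewrite big_cons; case Pi: (P i) => //.
by rewrite pdD//; [have [] := h _ Pi|have [] := @C1_sum _ r P F h].
Qed.

Lemma C1_prod I (r : seq I) (P : pred I) (F : I -> rV3 -> R) :
  (forall i, P i -> C1 (F i)) -> C1 (fun x => \prod_(i <- r | P i) F i x).
Proof.
move=> h; elim: r => [|i r IH].
  by under eq_fun do rewrite big_nil; exact: C1_cst.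
under eq_fun do rewrite big_cons; case Pi: (P i) => //.
by apply: C1M => //; exact: h.
Qed.

Lemma C1X f n : C1 f -> C1 (fun x => f x ^+ n).
Proof.
move=> hf; elim: n => [|n IH]; first by under eq_fun do rewrite expr0; exact: C1_cst.
by under eq_fun do rewrite exprS; exact: C1M.
Qed.

Lemma pd_comp (h : R -> R) f i x : derivable h (f x) 1 -> differentiable f x ->
  pd i (fun y => h (f y)) x = h^`()%classic (f x) * pd i f x.
Proof.
move=> /[dup] dh /derivable1_diffP dh' df.
rewrite !pd_diff//; last exact: differentiable_comp.
by rewrite (@diff_comp _ _ _ _ f h) //= deriv1E// mulrC.
Qed.

Lemma C1_comp (h : R -> R) f : (forall t, derivable h t 1) -> continuous h^`()%classic ->
  C1 f -> C1 (fun x => h (f x)).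
Proof.
move=> dh ch f1; have [df cf] := f1; split.
  by move=> x; apply: differentiable_comp => //; exact/derivable1_diffP.
move=> i; apply: (eq_continuous_fun (f := fun x => h^`()%classic (f x) * pd i f x)) => x.
  by rewrite pd_comp.
move: x; apply: continuous_mul => // x.
by apply: (@continuous_comp _ _ _ f h^`()%classic x);
  [exact: C1_continuous|exact: ch].
Qed.

Lemma is_derive_line f (x d : rV3) t : differentiable f (x + t *: d) ->
  is_derive t 1 (fun s : R => f (x + s *: d)) ('D_d f (x + t *: d)).
Proof.
move=> df.
have E : (fun h : R => h^-1 *: (((fun s => f (x + s *: d)) \o shift t) (h *: 1) - f (x + t *: d)))
   = (fun h => h^-1 *: ((f \o shift (x + t *: d)) (h *: d) - f (x + t *: d))).
  apply/funext => h /=; congr (_ *: (f _ - _)).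
  by rewrite [h *: 1]mulr1 scalerDl addrCA.
apply: DeriveDef; first by rewrite /derivable E; exact: diff_derivable.
by rewrite /derive E.
Qed.

Lemma C1_derive_continuous f d : C1 f -> continuous (fun x => 'D_d f x).
Proof.
move=> f1; have -> : (fun x => 'D_d f x) = (fun x => \sum_(i < 3) d 0 i * pd i f x).
  by apply/funext => x; rewrite derive_pd//; exact: C1_diff.
apply: continuous_sum => i _; apply: continuous_mul; first exact: continuous_cst.
exact: C1_pd.
Qed.

End Calculus.

Section MultivariatePolynomials.
Variable R : realType.
Notation rV3 := 'rV[R]_3.
Notation mpoly3 := (mpoly.mpoly 3 R).
Implicit Types (P Q : mpoly3).

Lemma mpoly_evalD P Q x : mpoly_eval (P + Q) x = mpoly_eval P x + mpoly_eval Q x.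
Proof. exact: mpoly.mevalD. Qed.
Lemma mpoly_evalB P Q x : mpoly_eval (P - Q) x = mpoly_eval P x - mpoly_eval Q x.
Proof. exact: mpoly.mevalB. Qed.
Lemma mpoly_evalM P Q x : mpoly_eval (P * Q) x = mpoly_eval P x * mpoly_eval Q x.
Proof. exact: mpoly.mevalM. Qed.
Lemma mpoly_evalZ c P x : mpoly_eval (c *: P) x = c * mpoly_eval P x.
Proof. exact: mpoly.mevalZ. Qed.
Lemma mpoly_evalC (c : R) x : mpoly_eval (mpoly.mpolyC 3 c) x = c.
Proof. exact: mpoly.mevalC. Qed.
Lemma mpoly_evalX i x : mpoly_eval (mpoly.mpolyX R (mpoly.mnm1 i)) x = x 0 i.
Proof. exact: mpoly.mevalXU. Qed.

(** Both claims pass to sums, to multiples and to products by a variable. *)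
Lemma mpoly_eval_C1_pd P : C1 (mpoly_eval P) /\
  forall i x, pd i (mpoly_eval P) x = mpoly_eval (mpoly.mderiv i P) x.
Proof.
pose good P := C1 (mpoly_eval P) /\
  forall i x, pd i (mpoly_eval P) x = mpoly_eval (mpoly.mderiv i P) x.
have ED (A B : mpoly3) : mpoly_eval (A + B) = fun x => mpoly_eval A x + mpoly_eval B x.
  by apply/funext => x; rewrite mpoly_evalD.
have EM (A B : mpoly3) : mpoly_eval (A * B) = fun x => mpoly_eval A x * mpoly_eval B x.
  by apply/funext => x; rewrite mpoly_evalM.
have EC c : mpoly_eval (mpoly.mpolyC 3 c) = (fun=> c) :> (rV3 -> R).
  by apply/funext => x; rewrite mpoly_evalC.
have EX i : mpoly_eval (mpoly.mpolyX R (mpoly.mnm1 i)) = (fun x => x 0 i) :> (rV3 -> R).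
  by apply/funext => x; rewrite mpoly_evalX.
have gD A B : good A -> good B -> good (A + B).
  move=> [hA eA] [hB eB]; split.
    by rewrite ED; exact: C1D.
  move=> i x; rewrite mpoly.mderivD mpoly_evalD -eA -eB.
  by rewrite ED; apply: pdD; exact: C1_diff.
have gM A B : good A -> good B -> good (A * B).
  move=> [hA eA] [hB eB]; split.
    by rewrite EM; exact: C1M.
  move=> i x; rewrite mpoly.mderivM mpoly_evalD !mpoly_evalM -eA -eB.
  rewrite EM pdM; [|exact: C1_diff|exact: C1_diff].
  by rewrite addrC mulrC.
have gC c : good (mpoly.mpolyC 3 c).
  split; first by rewrite EC; exact: C1_cst.
  move=> i x; rewrite mpoly.mderivC -[0 in RHS]mpoly.mpolyC0 mpoly_evalC.
  by rewrite EC; exact: pd_cst.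
have gX i : good (mpoly.mpolyX R (mpoly.mnm1 i)).
  split; first by rewrite EX; exact: C1_coord.
  move=> j x; rewrite mpoly.mderivX.
  rewrite EX pd_coord.
  rewrite mpoly_evalZ mpoly.mnm1E eq_sym; case: eqP => [->|_]; last by rewrite mul0r.
  rewrite mul1r (_ : mpoly.mnm_sub _ _ = mpoly.mnm0).
    by rewrite mpoly.mpolyX0; exact: (esym (mpoly_evalC 1 x)).
  by apply/mpoly.mnmP => k; rewrite mpoly.mnmBE subnn mpoly.mnm0E.
elim/mpoly.mpolyind: P => [|c m p _ _ gp]; first by rewrite -mpoly.mpolyC0; exact: gC.
apply: (gD (c *: mpoly.mpolyX R m) p) => //.
rewrite -mpoly.mul_mpolyC; apply: (gM) => //.
rewrite mpoly.mpolyXE_id; apply: (big_ind good) => [||i _].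
- exact: (gC 1).
- move=> A B gA gB; exact: (gM A B gA gB).
- elim: (m i) => [|n IH]; first by rewrite expr0; exact: (gC 1).
by rewrite exprS; exact: gM.
Qed.

Lemma mpoly_eval_C1 P : C1 (mpoly_eval P).
Proof. by have [] := mpoly_eval_C1_pd P. Qed.
Lemma pd_mpoly_eval i P x : pd i (mpoly_eval P) x = mpoly_eval (mpoly.mderiv i P) x.
Proof. by have [] := mpoly_eval_C1_pd P. Qed.

Lemma deg_le_deriv k i P : deg_le k.+1 P -> deg_le k (mpoly.mderiv i P).
Proof.
rewrite /deg_le => h; rewrite (mpoly.mderivwE _ h).
apply: (leq_trans (mpoly.msize_sum _ _ _)); apply/bigmax_leqP => m _.
have [->|mi0] := eqVneq (val m i) 0%N.
  by rewrite mul0r scale0r mpoly.msize0.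
apply: (leq_trans (mpoly.msizeZ_le _ _)); rewrite mpoly.msizeX ltnS.
have : (mpoly.mdeg m < k.+2)%N by case: m {mi0}.
have {1}-> : val m = mpoly.mnm_add (mpoly.mnm_sub m (mpoly.mnm1 i)) (mpoly.mnm1 i).
  apply/mpoly.mnmP => j; rewrite mpoly.mnmDE mpoly.mnmBE mpoly.mnm1E.
  by case: eqP => [<-|_]; rewrite ?subn0 ?addn0// subnK// lt0n.
by rewrite mpoly.mdegD mpoly.mdeg1 addn1 !ltnS.
Qed.

Lemma deg_leW k k' P : (k <= k')%N -> deg_le k P -> deg_le k' P.
Proof. by move=> kk' h; apply: leq_trans h _. Qed.

Lemma deg_leD k P Q : deg_le k P -> deg_le k Q -> deg_le k (P + Q).
Proof.
by move=> hP hQ; apply: leq_trans (mpoly.msizeD_le _ _) _; rewrite geq_max hP hQ.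
Qed.

Lemma deg_leZ k c P : deg_le k P -> deg_le k (c *: P).
Proof. by move=> hP; apply: leq_trans (mpoly.msizeZ_le _ _) hP. Qed.

Lemma deg_leN k P : deg_le k P -> deg_le k (- P).
Proof. by move=> /(deg_leZ (-1)); rewrite scaleN1r. Qed.

Lemma deg_leC k (c : R) : deg_le k (mpoly.mpolyC 3 c).
Proof. by rewrite /deg_le mpoly.msizeC; case: eqP. Qed.

Lemma deg_le_mulX k i P : deg_le k P -> deg_le k.+1 (mpoly.mpolyX R (mpoly.mnm1 i) * P).
Proof.
rewrite /deg_le => h; have [->|P0] := eqVneq P 0; first by rewrite mulr0 mpoly.msize0.
rewrite mpoly.msizeM ?mpoly.msizeX ?mpoly.mdeg1 //.
by rewrite -mpoly.msize_poly_eq0 mpoly.msizeX.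
Qed.

Lemma deg_le_sum k I (r : seq I) (F : I -> mpoly3) : (forall i, deg_le k (F i)) ->
  deg_le k (\sum_(i <- r) F i).
Proof.
move=> h; elim: r => [|i r IH]; last by rewrite big_cons; apply: deg_leD.
by rewrite big_nil -mpoly.mpolyC0; exact: deg_leC.
Qed.

End MultivariatePolynomials.

(** * Integration over a tetrahedron *)

Section SimplexIntegration.
Variable R : realType.
Notation rV3 := 'rV[R]_3.
Notation R3 := (R * R * R)%type.
Notation leb := (leb3 R).
Notation tri := (@ref_triangle R).
Implicit Types (a b c d x y : rV3) (F : rV3 -> R).

Lemma crossE x y :
  (cross x y 0 0 = x 0 1 * y 0 2 - x 0 2 * y 0 1) *
  (cross x y 0 1 = x 0 2 * y 0 0 - x 0 0 * y 0 2) *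
  (cross x y 0 2 = x 0 0 * y 0 1 - x 0 1 * y 0 0).
Proof.
have e1 : (0 + 1 : 'I_3) = 1 by apply: val_inj.
have e2 : (0 + 2 : 'I_3) = 2 by apply: val_inj.
have e3 : (1 + 1 : 'I_3) = 2 by apply: val_inj.
have e4 : (1 + 2 : 'I_3) = 0 by apply: val_inj.
have e5 : (2 + 1 : 'I_3) = 0 by apply: val_inj.
have e6 : (2 + 2 : 'I_3) = 1 by apply: val_inj.
by rewrite /cross !mxE e1 e2 e3 e4 e5 e6.
Qed.

Lemma dotE x y : dot x y = x 0 0 * y 0 0 + x 0 1 * y 0 1 + x 0 2 * y 0 2.
Proof. by rewrite /dot sum3. Qed.

Lemma dotDr x y z : dot x (y + z) = dot x y + dot x z.
Proof. by rewrite !dotE !mxE; ring. Qed.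
Lemma dotBr x y z : dot x (y - z) = dot x y - dot x z.
Proof. by rewrite !dotE !mxE; ring. Qed.
Lemma dotZr k x y : dot x (k *: y) = k * dot x y.
Proof. by rewrite !dotE !mxE; ring. Qed.
Lemma dotC x y : dot x y = dot y x.
Proof. by rewrite !dotE; ring. Qed.
Lemma dotDl x y z : dot (x + y) z = dot x z + dot y z.
Proof. by rewrite !(dotC _ z) dotDr. Qed.
Lemma dotZl k x y : dot (k *: x) y = k * dot x y.
Proof. by rewrite !(dotC _ y) dotZr. Qed.
Lemma dot_sumr I (r : seq I) (P : pred I) (G : I -> rV3) x :
  dot x (\sum_(i <- r | P i) G i) = \sum_(i <- r | P i) dot x (G i).
Proof.
elim/big_rec2: _ => [|i y1 y2 _ <-]; last by rewrite dotDr.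
by rewrite dotE !mxE !mulr0 !addr0.
Qed.

(** Six times the signed volume of the tetrahedron with vertices a, b, c, d. *)
Definition vdet a b c d := dot (cross (b - a) (c - a)) (d - a).

(** The last coordinate runs along the edge from a to b: it is the one to which the
    fundamental theorem of calculus is applied. *)
Definition simplex_map a b c d (p : R3) : rV3 :=
  a + p.2 *: (b - a) + p.1.1 *: (c - a) + p.1.2 *: (d - a).

Definition ref_tet : set R3 :=
  [set p | [/\ 0 <= p.1.1, 0 <= p.1.2, 0 <= p.2 & p.1.1 + p.1.2 + p.2 <= 1]].

Definition tri_int (f : R * R -> R) : R := \int[leb2 R]_(q in tri) f q.

Definition face_mean a b c F : R :=
  tri_int (fun q => F (a + q.1 *: (b - a) + q.2 *: (c - a))).

Lemma measurable_ref_tet : measurable (ref_tet : set R3).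
Proof.
have m1 : measurable_fun setT (fun p : R3 => p.1.1) by apply: (measurableT_comp (f := fst)).
have m2 : measurable_fun setT (fun p : R3 => p.1.2) by apply: (measurableT_comp (f := snd)).
have m3 : measurable_fun setT (fun p : R3 => p.2) by exact: measurable_snd.
have ge0 (f : R3 -> R) : measurable_fun setT f -> measurable [set p | 0 <= f p].
  move=> mf; rewrite -[X in measurable X]setTI.
  rewrite (_ : [set p | 0 <= f p] = f @^-1` `[0, +oo[%classic); first exact: mf.
  by apply/seteqP; split=> p /=; rewrite in_itv/= andbT.
rewrite (_ : ref_tet = [set p | 0 <= p.1.1] `&` ([set p | 0 <= p.1.2] `&`
  ([set p | 0 <= p.2] `&` [set p | 0 <= 1 - (p.1.1 + p.1.2 + p.2)]))).
  by do ?[apply: measurableI]; apply: ge0 => //; apply: measurable_funB => //;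
    do ?apply: measurable_funD.
apply/seteqP; split=> p /=; first by move=> [*]; rewrite subr_ge0.
by move=> [? [? [?]]]; rewrite subr_ge0.
Qed.

Lemma measurable_ref_triangle : measurable (tri : set (R * R)).
Proof.
have m1 : measurable_fun setT (fun p : R * R => p.1) by exact: measurable_fst.
have m2 : measurable_fun setT (fun p : R * R => p.2) by exact: measurable_snd.
have ge0 (f : R * R -> R) : measurable_fun setT f -> measurable [set p | 0 <= f p].
  move=> mf; rewrite -[X in measurable X]setTI.
  rewrite (_ : [set p | 0 <= f p] = f @^-1` `[0, +oo[%classic); first exact: mf.
  by apply/seteqP; split=> p /=; rewrite in_itv/= andbT.
rewrite (_ : tri = [set p | 0 <= p.1] `&` ([set p | 0 <= p.2] `&`
  [set p | 0 <= 1 - (p.1 + p.2)])).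
  by do ?[apply: measurableI]; apply: ge0 => //; apply: measurable_funB => //;
    do ?apply: measurable_funD.
apply/seteqP; split=> p /=; first by move=> [*]; rewrite subr_ge0.
by move=> [? [?]]; rewrite subr_ge0.
Qed.

Lemma ref_triangle_fin : ((leb2 R) (tri : set (R * R)) < +oo)%E.
Proof.
pose I := `[0, 1]%classic : set R.
have mIm : measurable (I : set (measurableTypeR R)) by exact: measurable_itv.
apply: (@le_lt_trans _ _ ((leb2 R) (I `*` I))).
  apply: le_measure; rewrite ?inE//; first exact: measurable_ref_triangle.
    exact: measurableX.
  by move=> q [h1 h2 h3]; split; rewrite /I /= in_itv /=; apply/andP; split; lra.
have -> : (leb2 R) (I `*` I) = (leb1 R I * leb1 R I)%E by exact: product_measure1E.
have mI : leb1 R I = 1%E by rewrite /I lebesgue_measure_itv /= lte_fin ltr01 oppr0 adde0.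
by rewrite mI mule1 ltry.
Qed.

Lemma simplex_map_vec3 a b c d (p : R3) :
  simplex_map a b c d p = vec3 (affine3 (xyz a) (xyz (c - a)) (xyz (d - a)) (xyz (b - a)) p).
Proof.
by apply: row3P; rewrite vec3E /simplex_map /affine3 /xyz /= !mxE /=; ring.
Qed.

Lemma vdet_det3 a b c d :
  det3 (xyz (c - a)) (xyz (d - a)) (xyz (b - a)) = vdet a b c d.
Proof. by rewrite /vdet dotE !crossE /det3 /xyz /=; ring. Qed.

(** Cramer's rule. *)
Lemma simplex_mapK a b c d (p : R3) :
  [/\ dot (cross (c - a) (d - a)) (simplex_map a b c d p - a) = p.2 * vdet a b c d,
      dot (cross (d - a) (b - a)) (simplex_map a b c d p - a) = p.1.1 * vdet a b c d &
      dot (cross (b - a) (c - a)) (simplex_map a b c d p - a) = p.1.2 * vdet a b c d].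
Proof.
by split; rewrite /vdet !dotE !crossE /simplex_map !mxE; ring.
Qed.

Lemma simplex_map_inj a b c d : vdet a b c d != 0 -> injective (simplex_map a b c d).
Proof.
move=> D0 p q pq.
have [p1 p2 p3] := simplex_mapK a b c d p; have [q1 q2 q3] := simplex_mapK a b c d q.
move: p1 p2 p3; rewrite pq q1 q2 q3 => /(mulIf D0) h1 /(mulIf D0) h2 /(mulIf D0) h3.
by case: p q h1 h2 h3 {pq q1 q2 q3} => -[p1 p2] p3 [[q1 q2] q3] /= -> -> ->.
Qed.

Lemma simplex_map_continuous a b c d (f : rV3 -> R) : continuous f ->
  measurable_fun setT (fun p : R3 => f (simplex_map a b c d p)).
Proof.
move=> cf; have [mT _] : measurable_fun setT
  (affine3 (xyz a) (xyz (c - a)) (xyz (d - a)) (xyz (b - a))) /\ True.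
  split=> //; rewrite /affine3.
  have m1 : measurable_fun setT (fun p : R3 => p.1.1) by apply: (measurableT_comp (f := fst)).
  have m2 : measurable_fun setT (fun p : R3 => p.1.2) by apply: (measurableT_comp (f := snd)).
  have m3 : measurable_fun setT (fun p : R3 => p.2) by exact: measurable_snd.
  by do 2?[apply: measurable_fun_pair]; do ?[apply: measurable_funD => //];
    apply: measurable_funM.
have := measurableT_comp (continuous_measurable3 cf) mT.
by congr measurable_fun; apply/funext => p /=; rewrite simplex_map_vec3.
Qed.

Lemma bounded_simplex a b c d : bounded_set (simplex_map a b c d @` ref_tet).
Proof.
apply: (@bounded_set_le _ _ (`|a| + `|b - a| + `|c - a| + `|d - a|)) => _ [p [h1 h2 h3 h4] <-].
have h t (v : rV3) : 0 <= t -> t <= 1 -> `|t *: v| <= `|v|.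
  by move=> t0 t1; rewrite normrZ ler_piMl// ger0_norm.
rewrite /simplex_map; apply: (le_trans (ler_normD _ _)).
apply: lerD; last by apply: h => //; lra.
apply: (le_trans (ler_normD _ _)); apply: lerD; last by apply: h => //; lra.
by apply: (le_trans (ler_normD _ _)); apply: lerD => //; apply: h => //; lra.
Qed.

Lemma vol_int_simplex a b c d f : vdet a b c d != 0 ->
  mset3 (simplex_map a b c d @` ref_tet) -> int3 (simplex_map a b c d @` ref_tet) f ->
  vol_int (simplex_map a b c d @` ref_tet) f
  = `|vdet a b c d| * \int[leb]_(p in ref_tet) f (simplex_map a b c d p).
Proof.
move=> D0 mS iS; pose T := affine3 (xyz a) (xyz (c - a)) (xyz (d - a)) (xyz (b - a)).
have cT : changes_volume T `|vdet a b c d|^-1.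
  by rewrite -vdet_det3; apply: changes_volume_affine; rewrite vdet_det3.
rewrite /vol_int.
have := Rintegral_rescales cT mS iS.
have -> : T @^-1` (@vec3 R @^-1` (simplex_map a b c d @` ref_tet)) = ref_tet.
  apply/seteqP; split=> p; rewrite /preimage /= -simplex_map_vec3.
    by move=> [q qS /(simplex_map_inj D0) <-].
  by move=> pS; exists p.
under eq_Rintegral do rewrite -simplex_map_vec3.
by move=> ->; rewrite mulrA divff ?mul1r// normr_eq0.
Qed.

Lemma face_param_continuous a b c F : continuous F ->
  measurable_fun setT (fun q : R * R => F (a + q.1 *: (b - a) + q.2 *: (c - a))).
Proof.
move=> cF.
have m0 : measurable_fun setT (fun q : R * R => (q, 0 : R)) by exact: measurable_fun_pair.
have := measurableT_comp (simplex_map_continuous a a b c cF) m0.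
congr measurable_fun; apply/funext => q /=.
by rewrite /simplex_map /= subrr scaler0 addr0.
Qed.

Lemma face_integrable a b c F : continuous F ->
  (leb2 R).-integrable tri (fun q => (F (a + q.1 *: (b - a) + q.2 *: (c - a)))%:E).
Proof.
move=> cF; have [M M0 hM] := continuous_bounded (bounded_simplex a a b c) cF.
apply: (@measurable_bounded_integrable _ _ _ (leb2 R)
  (fun q : R * R => F (a + q.1 *: (b - a) + q.2 *: (c - a))) tri).
- exact: measurable_ref_triangle.
- exact: ref_triangle_fin.
- by apply: measurable_funTS; exact: face_param_continuous.
- exists M; split; first by rewrite num_real.
  move=> x Mx q [q1 q2 q3] /=; apply: le_trans (ltW Mx); apply: hM.
  exists (q, 0); last by rewrite /simplex_map /= subrr scaler0 addr0.
  by split=> //=; lra.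
Qed.

(** The parametrisation of a face depends on the order of its vertices; its mean values
    do not. *)
Lemma face_mean_swap a b c F : continuous F -> face_mean a b c F = face_mean a c b F.
Proof.
move=> cF; rewrite /face_mean /tri_int.
have := Rintegral_rescales (rescales_area_swap R) measurable_ref_triangle (face_integrable a c b cF).
rewrite mul1r => <-.
rewrite (_ : (fun q => (q.2, q.1)) @^-1` tri = tri).
  by apply: eq_Rintegral => q _ /=; rewrite addrAC.
by apply/seteqP; split=> q [/= h1 h2 h3]; split=> //=; lra.
Qed.

Lemma face_mean_rot a b c F : continuous F -> face_mean a b c F = face_mean b a c F.
Proof.
move=> cF; rewrite /face_mean /tri_int.
have n1 : -1 != 0 :> R by rewrite oppr_eq0 oner_eq0.
have := Rintegral_rescales (rescales_area1 (-1) 1 n1) measurable_ref_triangle (face_integrable a b c cF).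
rewrite normrN normr1 invr1 mul1r => <-.
rewrite (_ : (fun q => (-1 * q.1 + (-1 * q.2 + 1), q.2)) @^-1` tri = tri).
  apply: eq_Rintegral => q _ /=; congr F; apply: row3P; rewrite !mxE; ring.
by apply/seteqP; split=> q [/= h1 h2 h3]; split=> //=; lra.
Qed.

Lemma int_line a v (F : rV3 -> R) (u : R) : C1 F -> 0 <= u ->
  (\int[leb1 R]_(t in `[0%R, u]) ('D_v F (a + t *: v))%:E
   = (F (a + u *: v) - F a)%:E)%E.
Proof.
move=> F1; rewrite le_eqVlt => /predU1P[<-|u0].
  by rewrite set_itv1 integral_set1 scale0r addr0 subrr.
have dF (t : R) : is_derive t 1 (fun s : R => F (a + s *: v)) ('D_v F (a + t *: v)).
  by apply: is_derive_line; exact: C1_diff.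
have cl (G : rV3 -> R) : continuous G -> continuous (fun t : R => G (a + t *: v)).
  move=> cG t; apply: (@continuous_comp R rV3 R (fun t => a + t *: v) G); last exact: cG.
  by apply: cvgD; [exact: cvg_cst|exact: scalel_continuous].
rewrite (@continuous_FTC2 _ _ (fun t : R => F (a + t *: v)))//.
- by rewrite scale0r addr0 EFinB.
- apply: continuous_subspaceT.
  exact: (cl (fun x => 'D_v F x) (C1_derive_continuous (d := v) F1)).
- split=> [t _||].
  + by case: (dF t).
  + by apply: cvg_at_right_filter; apply: cl; exact: C1_continuous.
  + by apply: cvg_at_left_filter; apply: cl; exact: C1_continuous.
- by move=> t _; rewrite derive1E; case: (dF t).
Qed.

Lemma tet_integrable a b c d F : continuous F ->
  leb.-integrable ref_tet (fun p => (F (simplex_map a b c d p))%:E).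
Proof.
move=> cF; have [M M0 hM] := continuous_bounded (bounded_simplex a b c d) cF.
have fin : (leb (ref_tet : set R3) < +oo)%E.
  pose e i : rV3 := delta_mx 0 i.
  have b0 : bounded_set (@xyz R @^-1` ref_tet).
    apply: (@bounded_set_le _ _ 1) => x [/= h1 h2 h3 h4]; apply/norm_rowP => // i.
    by elim/ord3_ind: i; rewrite ger0_norm//; lra.
  have := bounded_lebesgue _ b0.
  have -> : @vec3 R @^-1` (@xyz R @^-1` ref_tet) = ref_tet.
    by apply/seteqP; split=> p; rewrite /preimage /= vec3K.
  by apply; exact: measurable_ref_tet.
apply: (@measurable_bounded_integrable _ _ _ leb
  (fun p : R3 => F (simplex_map a b c d p)) ref_tet) => //.
- exact: measurable_ref_tet.
- by apply: measurable_funTS; exact: simplex_map_continuous.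
- exists M; split; first by rewrite num_real.
  by move=> x Mx p hp /=; apply: le_trans (ltW Mx); apply: hM; exists p.
Qed.

(** The fundamental theorem of calculus on the segments parallel to b - a: their end
    points run over the faces opposite to a and to b. *)
Lemma int_tet_derive a b c d F : C1 F ->
  \int[leb]_(p in ref_tet) 'D_(b - a) F (simplex_map a b c d p)
  = face_mean b c d F - face_mean a c d F.
Proof.
move=> F1; have cF := C1_continuous F1.
pose dh (p : R3) : R := 'D_(b - a) F (simplex_map a b c d p).
have ih : leb.-integrable ref_tet (fun p => (dh p)%:E).
  exact: (tet_integrable a b c d (C1_derive_continuous (d := b - a) F1)).
pose G (q : R * R) := F (b + q.1 *: (c - b) + q.2 *: (d - b))
  - F (a + q.1 *: (c - a) + q.2 *: (d - a)).
transitivity (\int[leb2 R]_(q in tri) G q); last first.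
  rewrite /G RintegralB//; [exact: measurable_ref_triangle|exact: face_integrable|exact: face_integrable].
rewrite Rintegral_mkcond [in RHS]Rintegral_mkcond /Rintegral; congr fine.
have ih' : leb.-integrable setT (EFin \o (dh \_ ref_tet)).
  rewrite -restrict_EFin.
  exact: ((integrable_mkcond (mu := leb) _ measurable_ref_tet).1 ih).
have := @integral12_prod_meas1 _ _ _ _ _ (plane_measure R) (@lebesgue_measure R) _ ih'.
move=> <-; apply: eq_integral => q _.
rewrite /fubini_F /= /patch.
case: ifPn => [/set_mem [q1 q2 q3]|qt].
  pose u := 1 - (q.1 + q.2).
  have u0 : 0 <= u by rewrite /u subr_ge0.
  rewrite /G; have -> : b + q.1 *: (c - b) + q.2 *: (d - b) =
      (a + q.1 *: (c - a) + q.2 *: (d - a)) + u *: (b - a).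
    by apply: row3P; rewrite /u !mxE; ring.
  rewrite -(int_line _ _ F1 u0) [RHS]integral_mkcond; apply: eq_integral => t _.
  rewrite /patch /=; have -> : ((q, t) \in ref_tet) = (t \in `[0, u]%classic).
    apply/idP/idP => /set_mem.
      by move=> [/= h1 h2 h3 h4]; apply/mem_set; rewrite /= in_itv /= h3 /u; lra.
    by rewrite /= in_itv /= /u => /andP[h1 h2]; apply/mem_set; split=> //=; lra.
  case: ifP => _; last by [].
  have -> : a + q.1 *: (c - a) + q.2 *: (d - a) + t *: (b - a) = simplex_map a b c d (q, t).
    by rewrite /simplex_map /=; apply: row3P; rewrite !mxE; ring.
  by [].
apply: integral0_eq => t _; rewrite ifN//; apply: contra qt => /set_mem[/= h1 h2 h3 h4].
by apply/mem_set; split=> //; lra.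
Qed.

Lemma vol_int_derive a b c d F : vdet a b c d != 0 -> C1 F ->
  closed (simplex_map a b c d @` ref_tet) ->
  vol_int (simplex_map a b c d @` ref_tet) (fun x => 'D_(b - a) F x)
  = `|vdet a b c d| * (face_mean b c d F - face_mean a c d F).
Proof.
move=> D0 F1 cl; rewrite vol_int_simplex ?int_tet_derive//.
  exact: closed_measurable3.
apply: continuous_int3; [exact: closed_measurable3|exact: bounded_simplex|].
exact: C1_derive_continuous.
Qed.

(** Expansion of n in the basis p, q, r, multiplied by the determinant. *)
Lemma triple_product_expansion (p q r n : rV3) :
  dot n (cross q r) *: p + dot n (cross r p) *: q + dot n (cross p q) *: r
  = dot (cross p q) r *: n.
Proof. by apply: row3P; rewrite !mxE !dotE !crossE; ring. Qed.

(** A direction is a combination of the three edges at a vertex. *)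
Lemma int_simplex_derive (S : set rV3) a b d g w F :
  vdet a b d g != 0 -> C1 F -> closed S ->
  S = simplex_map a b d g @` ref_tet -> S = simplex_map a d g b @` ref_tet ->
  S = simplex_map a g b d @` ref_tet ->
  vol_int S (fun x => 'D_w F x) = Num.sg (vdet a b d g) *
    (dot w (cross (d - b) (g - b)) * face_mean b d g F
     - dot w (cross (d - a) (g - a)) * face_mean a d g F
     + dot w (cross (b - a) (g - a)) * face_mean a b g F
     - dot w (cross (b - a) (d - a)) * face_mean a b d F).
Proof.
move=> D0 F1 clS S1 S2 S3; have cF := C1_continuous F1.
have D2 : vdet a d g b = vdet a b d g by rewrite /vdet !dotE !crossE; ring.
have D3 : vdet a g b d = vdet a b d g by rewrite /vdet !dotE !crossE; ring.
have I1 : vol_int S (fun x => 'D_(b - a) F x) = `|vdet a b d g| *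
    (face_mean b d g F - face_mean a d g F).
  by have := vol_int_derive D0 F1; rewrite -S1; apply.
have I2 : vol_int S (fun x => 'D_(d - a) F x) = `|vdet a b d g| *
    (face_mean b d g F - face_mean a b g F).
  have := D0; rewrite -{1}D2 => /vol_int_derive/(_ F1); rewrite -S2 D2 => /(_ clS) ->.
  by rewrite (face_mean_swap d g b cF) (face_mean_rot d b g cF) (face_mean_swap a g b cF).
have I3 : vol_int S (fun x => 'D_(g - a) F x) = `|vdet a b d g| *
    (face_mean b d g F - face_mean a b d F).
  have := D0; rewrite -{1}D3 => /vol_int_derive/(_ F1); rewrite -S3 D3 => /(_ clS) ->.
  by rewrite (face_mean_rot g b d cF) (face_mean_swap b g d cF).
set D := vdet a b d g in D0 D2 D3 I1 I2 I3 *.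
pose c1 := dot (cross (d - a) (g - a)) w / D.
pose c2 := dot (cross (g - a) (b - a)) w / D.
pose c3 := dot (cross (b - a) (d - a)) w / D.
have wE : w = c1 *: (b - a) + c2 *: (d - a) + c3 *: (g - a).
  apply: (scalerI D0); rewrite !(scalerDr D) !scalerA /c1 /c2 /c3 !(mulrCA D) divff// !mulr1.
  by rewrite -[LHS](triple_product_expansion (b - a) (d - a) (g - a) w) !(dotC w).
have dE x : 'D_w F x = c1 * 'D_(b - a) F x + c2 * 'D_(d - a) F x + c3 * 'D_(g - a) F x.
  have dF := C1_diff x F1.
  rewrite !(derive_pd _ dF) !sum3.
  have wt t : w 0 t = c1 * (b - a) 0 t + c2 * (d - a) 0 t + c3 * (g - a) 0 t.
    by rewrite {1}wE !mxE.
  rewrite (wt 0) (wt 1) (wt 2).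
  move: (pd 0 F x) (pd 1 F x) (pd 2 F x) => f0 f1 f2.
  move: ((b - a) 0 0) ((b - a) 0 1) ((b - a) 0 2) => b0 b1 b2.
  move: ((d - a) 0 0) ((d - a) 0 1) ((d - a) 0 2) => d0 d1 d2.
  move: ((g - a) 0 0) ((g - a) 0 1) ((g - a) 0 2) => g0 g1 g2.
  by move: c1 c2 c3 {wE wt} => k1 k2 k3; ring.
have mS : mset3 S by exact: closed_measurable3.
have bS : bounded_set S by rewrite S1; exact: bounded_simplex.
have ii u : int3 S (fun x => 'D_u F x).
  by apply: continuous_int3 => //; exact: C1_derive_continuous.
rewrite (eq_vol_int (g := fun x => c1 * 'D_(b - a) F x + c2 * 'D_(d - a) F x + c3 * 'D_(g - a) F x)) => [|x _]; last exact: dE.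
have ij k u : int3 S (fun x => k * 'D_u F x) by apply: int3Z.
rewrite (vol_intD mS (int3D mS (ij c1 _) (ij c2 _)) (ij c3 _)).
rewrite (vol_intD mS (ij c1 _) (ij c2 _)) !(vol_intZ _ mS (ii _)) I1 I2 I3.
have sD : `|D| = Num.sg D * D by rewrite normrEsg.
have E1 : dot w (cross (d - a) (g - a)) = D * c1.
  by rewrite /c1 mulrCA divff// mulr1 dotC.
have E2 : dot w (cross (b - a) (g - a)) = - (D * c2).
  by rewrite /c2 mulrCA divff// mulr1 !dotE !crossE; ring.
have E3 : dot w (cross (b - a) (d - a)) = D * c3.
  by rewrite /c3 mulrCA divff// mulr1 dotC.
have E0 : dot w (cross (d - b) (g - b)) = D * (c1 + c2 + c3).
  rewrite !mulrDr -E1 -[D * c2]opprK -E2 -E3 !dotE !crossE !mxE; ring.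
rewrite E0 E1 E2 E3 sD.
move: (face_mean b d g F) (face_mean a d g F) (face_mean a b g F) (face_mean a b d F)
  {I1 I2 I3} => m0 m1 m2 m3.
by move: (c1) (c2) (c3) (Num.sg D) (D) => k1 k2 k3 s D'; ring.
Qed.

End SimplexIntegration.

(** * Barycentric coordinates and Green's formula on a cell *)

Section Barycentric.
Variable R : realType.
Variable M : mesh R.
Notation rV3 := 'rV[R]_3.
Notation simplex := {set 'I_(nvert M)}.
Notation v := (@vert R M).
Implicit Types (K L e : simplex) (x y : rV3).

Lemma dot_delta t y : dot (delta_mx 0 t) y = y 0 t.
Proof. by elim/ord3_ind: t; rewrite dotE !mxE /=; ring. Qed.

Definition tetrahedron K := #|K| = 4%N /\ affinely_independent K.

Definition labels4 K i j k l := uniq [:: i; j; k; l] /\ K =i [:: i; j; k; l].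

Lemma sum_labels4 (V : nmodType) K i j k l (F : 'I_(nvert M) -> V) :
  labels4 K i j k l -> \sum_(x in K) F x = F i + F j + F k + F l.
Proof.
move=> [u h]; transitivity (\sum_(x <- [:: i; j; k; l]) F x).
  by rewrite [RHS]big_uniq//; apply: eq_bigl.
by rewrite !big_cons big_nil addr0 !addrA.
Qed.

Lemma enum_labels4 K : #|K| = 4%N -> exists i j k l,
  enum K = [:: i; j; k; l] /\ labels4 K i j k l.
Proof.
move=> c; have := cardE K; rewrite c; have := enum_uniq K; have := mem_enum K.
case: (enum K) => [|i [|j [|k [|l [|? ?]]]]] //= h u _.
by exists i, j, k, l; split=> //; split=> // x; rewrite -h.
Qed.

Lemma enum_labels3 e : #|e| = 3%N -> exists i j k,
  [/\ enum e = [:: i; j; k], uniq [:: i; j; k] & e =i [:: i; j; k]].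
Proof.
move=> c; have := cardE e; rewrite c; have := enum_uniq e; have := mem_enum e.
case: (enum e) => [|i [|j [|k [|? ?]]]] //= h u _.
by exists i, j, k; split=> // x; rewrite -h.
Qed.

Lemma vertex_enum3 e i j k : enum e = [:: i; j; k] ->
  [/\ vertex e 0 = v i, vertex e 1 = v j & vertex e 2 = v k].
Proof. by move=> h; rewrite /vertex h. Qed.

Lemma face_labels4 K i : #|K| = 4%N -> i \in K -> exists j k l,
  [/\ enum (K :\ i)%SET = [:: j; k; l], labels4 K j k l i & #|(K :\ i)%SET| = 3%N].
Proof.
move=> c iK; have c3 : #|(K :\ i)%SET| = 3%N.
  by have := cardsD1 i K; rewrite iK c => -[].
have [j [k [l [h u m]]]] := enum_labels3 c3.
exists j, k, l; split=> //; split.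
  have : i \notin [:: j; k; l] by rewrite -m !inE eqxx.
  by move: u; rewrite /= !inE !negb_or !andbT => /andP[/andP[-> ->] ->] /and3P[];
    rewrite !(eq_sym i) => -> -> ->.
move=> x; have := m x; rewrite !inE; case: eqP => [-> _|_ /= ->]; last by rewrite orbF !orbA.
by rewrite iK !orbT.
Qed.

(** If the determinant vanished, the expansion of every n would be a linear relation
    between the edges, with coefficients that are not all zero. *)
Lemma affinely_independent_vdet K i j k l : affinely_independent K ->
  labels4 K i j k l -> vdet (v i) (v j) (v k) (v l) != 0.
Proof.
move=> ai lab; have [u h] := lab.
have free (a b c : R) : a *: (v j - v i) + b *: (v k - v i) + c *: (v l - v i) = 0 ->
    [/\ a = 0, b = 0 & c = 0].
  move=> E.
  pose f (x : 'I_(nvert M)) := if x == i then - (a + b + c) else if x == j then a else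
              if x == k then b else c.
  move: u; rewrite /= !inE !negb_or => /and4P[/and3P[ij ik il] /andP[jk jl] kl _].
  have fi : f i = - (a + b + c) by rewrite /f eqxx.
  have fj : f j = a by rewrite /f eqxx eq_sym (negbTE ij).
  have fk : f k = b by rewrite /f eqxx !(eq_sym k) (negbTE ik) (negbTE jk).
  have fl : f l = c by rewrite /f !(eq_sym l) (negbTE il) (negbTE jl) (negbTE kl).
  have s0 : \sum_(x in K) f x = 0.
    by rewrite (sum_labels4 _ lab) fi fj fk fl; ring.
  have s1 : \sum_(x in K) f x *: v x = 0.
    rewrite (sum_labels4 _ lab) fi fj fk fl -[RHS]E.
    by apply: row3P; rewrite !mxE; ring.
  have z := ai f s0 s1.
  split; [rewrite -fj|rewrite -fk|rewrite -fl]; apply: z; rewrite h !inE eqxx ?orbT//.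
apply/eqP => D0.
set p := v j - v i in free *; set q := v k - v i in free *; set r := v l - v i in free *.
have E n : dot n (cross q r) *: p + dot n (cross r p) *: q + dot n (cross p q) *: r = 0.
  transitivity (vdet (v i) (v j) (v k) (v l) *: n); last by rewrite D0 scale0r.
  by rewrite triple_product_expansion.
have c0 : cross p q = 0.
  have e0 t : cross p q 0 t = 0.
    by rewrite -dot_delta; have [] := free _ _ _ (E (delta_mx 0 t)).
  by apply: row3P; rewrite e0 mxE.
have c00 : p 0 1 * q 0 2 - p 0 2 * q 0 1 = 0 by have := crossE p q; rewrite c0 !mxE => -[[]].
have c01 : p 0 2 * q 0 0 - p 0 0 * q 0 2 = 0 by have := crossE p q; rewrite c0 !mxE => -[[]].
have c02 : p 0 0 * q 0 1 - p 0 1 * q 0 0 = 0 by have := crossE p q; rewrite c0 !mxE => -[[]].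
clearbody p q r.
have pt t : q 0 t *: p + (- p 0 t) *: q + 0 *: r = 0.
  elim/ord3_ind: t; apply: row3P; rewrite !mxE; lra.
have p0 : p = 0.
  have z t : p 0 t = 0 by have [_ /eqP] := free _ _ _ (pt t); rewrite oppr_eq0 => /eqP.
  by apply: row3P; rewrite !z mxE.
have : 1 *: p + 0 *: q + 0 *: r = 0 by rewrite p0 scaler0 !scale0r !addr0.
by move=> /free[/eqP]; rewrite oner_eq0.
Qed.

Notation opp K i := (K :\ i)%SET.

Definition height K i := dot (face_normal (opp K i)) (v i - vertex (opp K i) 0).

(** As a quotient of distances to a face, the coordinate is affine on the whole space,
    and hulls are described by signs. *)
Definition bary K i x :=
  dot (face_normal (opp K i)) (x - vertex (opp K i) 0) / height K i.

Definition gbary K i : rV3 := (height K i)^-1 *: face_normal (opp K i).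

Lemma height_neq0 K i : tetrahedron K -> i \in K -> height K i != 0.
Proof.
move=> [c ai] iK; have [j [k [l [/vertex_enum3[e0 e1 e2] lab _]]]] := face_labels4 c iK.
rewrite /height /face_normal e0 e1 e2.
exact: (affinely_independent_vdet ai lab).
Qed.

Lemma baryE K i x y : bary K i x = bary K i y + dot (gbary K i) (x - y).
Proof.
rewrite /bary /gbary dotZl mulrC [_ / _]mulrC -mulrDr; congr (_ * _).
by rewrite !dotBr; ring.
Qed.

Lemma bary_vert K i j : tetrahedron K -> i \in K -> j \in K ->
  bary K i (v j) = (i == j)%:R.
Proof.
move=> tK iK jK; have h0 := height_neq0 tK iK.
have [<-|ij] := eqVneq i j; first by rewrite /bary divff.
have [c ai] := tK; have [a [b [d [/vertex_enum3[e0 e1 e2] [_ lab] _]]]] := face_labels4 c iK.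
rewrite /bary /face_normal e0 e1 e2.
move: jK; rewrite lab !inE (eq_sym j i) (negbTE ij) orbF => /or3P[] /eqP ->;
  by apply/eqP; rewrite mulf_eq0; apply/orP; left; apply/eqP; rewrite !dotE !crossE !mxE; ring.
Qed.

Lemma bary_sum K i (c : 'I_(nvert M) -> R) : tetrahedron K -> i \in K ->
  \sum_(j in K) c j = 1 -> bary K i (\sum_(j in K) c j *: v j) = c i.
Proof.
move=> tK iK c1; rewrite (baryE _ _ _ 0) subr0 dot_sumr.
transitivity (\sum_(j in K) c j * bary K i (v j)).
  rewrite -[X in X + _]mul1r -c1 mulr_suml -big_split /=; apply: eq_bigr => j _.
  by rewrite dotZr -mulrDr [in RHS](baryE _ _ _ 0) subr0.
rewrite (bigD1 i)//= bary_vert// eqxx mulr1 big1 ?addr0// => j /andP[jK ji].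
by rewrite bary_vert// eq_sym (negbTE ji) mulr0.
Qed.

(** Four affinely independent points span the space: Cramer's rule again. *)
Lemma bary_span K x : tetrahedron K -> exists c : 'I_(nvert M) -> R,
  \sum_(j in K) c j = 1 /\ x = \sum_(j in K) c j *: v j.
Proof.
move=> [c ai]; have [i [j [k [l [_ lab]]]]] := enum_labels4 c.
have D0 := affinely_independent_vdet ai lab.
have [] := lab; rewrite /= !inE !negb_or => /and4P[/and3P[ij ik il] /andP[jk jl] kl _] _.
set a := v i; set b := v j; set d := v k; set g := v l; rewrite -/a -/b -/d -/g in D0.
set D := vdet a b d g in D0.
pose cj := dot (cross (d - a) (g - a)) (x - a) / D.
pose ck := dot (cross (g - a) (b - a)) (x - a) / D.
pose cl := dot (cross (b - a) (d - a)) (x - a) / D.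
pose f t := if t == i then 1 - (cj + ck + cl) else if t == j then cj else
              if t == k then ck else cl.
have fi : f i = 1 - (cj + ck + cl) by rewrite /f eqxx.
have fj : f j = cj by rewrite /f eqxx eq_sym (negbTE ij).
have fk : f k = ck by rewrite /f eqxx !(eq_sym k) (negbTE ik) (negbTE jk).
have fl : f l = cl by rewrite /f !(eq_sym l) (negbTE il) (negbTE jl) (negbTE kl).
exists f; rewrite !(sum_labels4 _ lab) fi fj fk fl; split; first by ring.
have E : D *: (x - a) = (D * cj) *: (b - a) + (D * ck) *: (d - a) + (D * cl) *: (g - a).
  rewrite /cj /ck /cl !(mulrCA D) divff// !mulr1 /D /vdet.
  by apply: row3P; rewrite !mxE !dotE !crossE !mxE; ring.
have {}E : x - a = cj *: (b - a) + ck *: (d - a) + cl *: (g - a).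
  by apply: (scalerI D0); rewrite E !scalerDr !scalerA.
rewrite -[LHS](subrK a) E.
by apply: row3P; rewrite /a /b /d /g !mxE; ring.
Qed.

Lemma bary_sum1 K x : tetrahedron K -> \sum_(i in K) bary K i x = 1.
Proof.
move=> tK; have [c [c1 ->]] := bary_span x tK.
by rewrite -[RHS]c1; apply: eq_bigr => i iK; rewrite bary_sum.
Qed.

Lemma bary_point K x : tetrahedron K -> \sum_(i in K) bary K i x *: v i = x.
Proof.
move=> tK; have [c [c1 ->]] := bary_span x tK.
by apply: eq_bigr => i iK; rewrite bary_sum.
Qed.

Lemma hullP K x : tetrahedron K -> hull K x <-> forall i, i \in K -> 0 <= bary K i x.
Proof.
move=> tK; split=> [[c [c0 c1 ->]] i iK|h]; first by rewrite bary_sum.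
exists (fun i => if i \in K then bary K i x else 0); split.
- by move=> i; case: ifP => // /h.
- by rewrite -[RHS](bary_sum1 x tK); apply: eq_bigr => i ->.
- by rewrite -[LHS](bary_point x tK); apply: eq_bigr => i ->.
Qed.

Lemma hull_sub_bary K e x : tetrahedron K -> e \subset K -> hull e x ->
  hull K x /\ forall i, i \in K -> i \notin e -> bary K i x = 0.
Proof.
move=> tK /fintype.subsetP eK [c [c0 c1 ->]].
pose f i := if i \in e then c i else 0.
have s (V : nmodType) (g : 'I_(nvert M) -> V) (z : 'I_(nvert M) -> V) :
    (forall i, i \in e -> z i = g i) -> (forall i, i \notin e -> z i = 0) ->
    \sum_(i in K) z i = \sum_(i in e) g i.
  move=> h1 h2; rewrite (big_setID e) /= [X in _ + X]big1 ?addr0; last first.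
    by move=> i; rewrite inE => /andP[/h2].
  apply: eq_big => [i|i]; rewrite inE; first by apply: andb_idl; exact: eK.
  by move=> /andP[_ /h1].
have f1 : \sum_(i in K) f i = 1.
  by rewrite -[RHS]c1; apply: s => i ie; rewrite /f; [rewrite ie|rewrite (negbTE ie)].
have fx : \sum_(i in K) f i *: v i = \sum_(i in e) c i *: v i.
  by apply: s => i ie; rewrite /f; [rewrite ie|rewrite (negbTE ie) scale0r].
rewrite -fx; split.
  by exists f; split=> // i; rewrite /f; case: ifP.
by move=> i iK /negbTE ie; rewrite bary_sum// /f ie.
Qed.

Lemma bary_eq0_hull K e x : tetrahedron K -> e \subset K -> hull K x ->
  (forall i, i \in K -> i \notin e -> bary K i x = 0) -> hull e x.
Proof.
move=> tK /fintype.subsetP eK /(hullP _ tK) h z.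
exists (fun i => if i \in K then bary K i x else 0); split.
- by move=> i; case: ifP => // /h.
- rewrite -[RHS](bary_sum1 x tK) [RHS](big_setID e) /= [X in _ + X]big1 ?addr0.
    by apply: eq_big => [i|i ie]; rewrite ?inE; [rewrite andb_idl//; exact: eK|rewrite eK].
  by move=> i; rewrite inE => /andP[ie iK]; exact: z.
- rewrite -[LHS](bary_point x tK) (big_setID e) /= [X in _ + X]big1 ?addr0.
    by apply: eq_big => [i|i]; rewrite ?inE; [rewrite andb_idl//; exact: eK|move=> /andP[-> _]].
  by move=> i; rewrite inE => /andP[ie iK]; rewrite z// scale0r.
Qed.

Lemma bary_C1 K i : C1 (bary K i).
Proof.
have -> : bary K i = (fun x => bary K i 0 + \sum_(t < 3) gbary K i 0 t * x 0 t).
  by apply/funext => x; rewrite (baryE _ _ _ 0) subr0 /dot.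
apply: C1D; first exact: C1_cst.
by apply: C1_sum => t _; apply: C1Z; exact: C1_coord.
Qed.

Lemma bary_continuous K i : continuous (bary K i).
Proof. exact: C1_continuous (bary_C1 K i). Qed.

Lemma hull_closed K : tetrahedron K -> closed (hull K).
Proof.
move=> tK; have -> : hull K = \bigcap_(i in [set i | i \in K]) (bary K i @^-1` [set y | 0 <= y]).
  by apply/seteqP; split=> x; rewrite hullP.
apply: closed_bigI => i iK; apply: closed_comp => [x _|]; first exact: bary_continuous.
exact: closed_ge.
Qed.

Lemma hull_simplex_map K i j k l : tetrahedron K -> labels4 K i j k l ->
  hull K = simplex_map (v i) (v j) (v k) (v l) @` @ref_tet R.
Proof.
move=> tK lab; have [u _] := lab.
move: u; rewrite /= !inE !negb_or => /and4P[/and3P[ij ik il] /andP[jk jl] kl _].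
apply/seteqP; split=> x.
  move=> [c [c0]]; rewrite !(sum_labels4 _ lab) => c1 ->.
  exists (c k, c l, c j) => /=; first by split=> //=; have := c0 i; lra.
  have -> : c i = 1 - c j - c k - c l by rewrite -c1; ring.
  by rewrite /simplex_map /=; apply: row3P; rewrite !mxE; ring.
move=> [[[pk pl] pj] [/= hk hl hj h1] <-].
pose f t := if t == i then 1 - (pj + pk + pl) else if t == j then pj else
            if t == k then pk else if t == l then pl else 0.
have fi : f i = 1 - (pj + pk + pl) by rewrite /f eqxx.
have fj : f j = pj by rewrite /f eqxx eq_sym (negbTE ij).
have fk : f k = pk by rewrite /f eqxx !(eq_sym k) (negbTE ik) (negbTE jk).
have fl : f l = pl by rewrite /f eqxx !(eq_sym l) (negbTE il) (negbTE jl) (negbTE kl).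
exists f; rewrite !(sum_labels4 _ lab) fi fj fk fl; split.
- by move=> t; rewrite /f; do 4 (case: ifP => _; first lra).
- by ring.
- by apply: row3P; rewrite /simplex_map !mxE /=; ring.
Qed.

Lemma hull_bounded K : tetrahedron K -> bounded_set (hull K).
Proof.
move=> tK; have [i [j [k [l [_ lab]]]]] := enum_labels4 tK.1.
by rewrite (hull_simplex_map tK lab); exact: bounded_simplex.
Qed.

Lemma hull_mset K : tetrahedron K -> mset3 (hull K).
Proof. by move=> tK; apply: closed_measurable3; exact: hull_closed. Qed.

Lemma cell_int_mset K : mset3 (cell_int K).
Proof. by apply: open_measurable3; exact: open_interior. Qed.

Lemma tetrahedron_other K i : tetrahedron K -> i \in K -> exists2 j, j \in K & j != i.
Proof.
move=> [c _] iK; have [j [k [l [_ [/= u m] _]]]] := face_labels4 c iK.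
exists j; first by rewrite m inE eqxx.
by move: u; rewrite !inE !negb_or => /andP[/and3P[]].
Qed.

(** A point of the hull with a vanishing coordinate leaves the hull when it moves away
    from the corresponding vertex. *)
Lemma cell_intP K x : tetrahedron K ->
  cell_int K x <-> forall i, i \in K -> 0 < bary K i x.
Proof.
move=> tK; split; last first.
  move=> h; rewrite /cell_int /interior /=.
  have : \forall y \near x, forall i, i \in K -> 0 <= bary K i y.
    apply: (@filter_forall rV3 'I_(nvert M) (fun i y => i \in K -> 0 <= bary K i y) (nbhs x)) => i; case iK: (i \in K); last by near=> y.
    have : \forall y \near x, 0 < bary K i y.
      exact: (@bary_continuous K i x _ (lt_nbhsr (h i iK))).
    by apply: filterS => y /ltW hy _.
  by apply: filterS => y; rewrite hullP.
move=> xK i iK.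
have hx := interior_subset xK.
rewrite lt_neqAle (hullP _ tK).1// andbT eq_sym; apply/eqP => b0.
have [j jK ji] := tetrahedron_other tK iK.
have : \forall t \near (0 : R), hull K (x + t *: (v j - v i)).
  have c : (fun t : R => x + t *: (v j - v i)) @ 0 --> x.
    rewrite -[X in _ --> X](addr0 x) -(scale0r (v j - v i)).
    by apply: cvgD; [exact: cvg_cst|exact: scalel_continuous].
  exact: c.
move=> /nbhs_ballP[e /= e0 he].
have : hull K (x + (e / 2) *: (v j - v i)).
  by apply: he; rewrite /ball /= sub0r normrN gtr0_norm ?divr_gt0// ltr_pdivrMr// mulr_natr mulr2n ltrDl.
move=> /(hullP _ tK)/(_ i iK).
rewrite (baryE _ _ _ x) b0 add0r addrC addKr dotZr.
have -> : dot (gbary K i) (v j - v i) = -1.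
  have := baryE K i (v j) (v i); rewrite !bary_vert// eqxx eq_sym (negbTE ji) => h.
  by apply/eqP; rewrite -subr_eq0 opprK addrC -h.
by rewrite mulrN1 oppr_ge0 leNgt divr_gt0.
Unshelve. all: by end_near. Qed.

Lemma cell_int_hull K : cell_int K `<=` hull K.
Proof. exact: interior_subset. Qed.

(** The segment from a point of the hull to the barycentre enters the open cell at once,
    so limits from inside are unique. *)
Lemma within_cell_proper K x : tetrahedron K -> hull K x ->
  ProperFilter (within (cell_int K) (nbhs x)).
Proof.
move=> tK hx; apply: within_nbhs_proper => B /nbhs_ballP[e /= e0 he].
pose c := \sum_(i in K) 4^-1 *: v i.
have s1 : \sum_(i in K) (4^-1 : R) = 1.
  by rewrite sumr_const tK.1 -[RHS](@mulVf R 4) ?pnatr_eq0// mulr_natr.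
have bc i : i \in K -> bary K i c = 4^-1 by move=> iK; rewrite /c bary_sum.
pose t := Num.min 2^-1 (e / (2 * (1 + `|c - x|))).
have d0 : 0 < 2 * (1 + `|c - x|) by rewrite mulr_gt0// ltr_pwDl.
have t0 : 0 < t by rewrite lt_min invr_gt0 ltr0n divr_gt0.
have t1 : t <= 2^-1 by rewrite ge_min lexx.
have te : t * `|c - x| < e.
  have : t <= e / (2 * (1 + `|c - x|)) by rewrite ge_min lexx orbT.
  rewrite ler_pdivlMr// => h; apply: lt_le_trans h.
  by rewrite ltr_pM2l//; have := normr_ge0 (c - x); lra.
exists (x + t *: (c - x)); split.
  apply/(cell_intP _ tK) => i iK; rewrite (baryE _ _ _ x) [x + _ - x]addrAC subrr add0r dotZr.
  have -> : dot (gbary K i) (c - x) = 4^-1 - bary K i x.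
    by have := baryE K i c x; rewrite bc// => ->; rewrite addrAC subrr add0r.
  have := (hullP _ tK).1 hx i iK.
  set bx := bary K i x => bx0.
  have -> : bx + t * (4^-1 - bx) = (1 - t) * bx + t * 4^-1 by ring.
  have h1 : 0 <= (1 - t) * bx by apply: mulr_ge0 => //; lra.
  by rewrite ltr_wpDl// mulr_gt0// invr_gt0.
by apply: he; rewrite -ball_normE /= opprD addNKr normrN normrZ gtr0_norm.
Qed.

Lemma trace_eq (V : normedModType R) K (f g : rV3 -> V) x : tetrahedron K -> hull K x ->
  (forall y, cell_int K y -> f y = g y) -> {for x, continuous g} -> trace K f x = g x.
Proof.
move=> tK hx fg cg; rewrite /trace.
have pf := within_cell_proper tK hx.
apply: cvg_lim => //; apply: (@cvg_trans _ (g @ within (cell_int K) (nbhs x))).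
  apply: near_eq_cvg; rewrite near_withinE; near=> y => /fg -> //.
by apply: cvg_within_filter; exact: cg.
Unshelve. all: by end_near. Qed.

(** A plane is the image of a coordinate plane under an affine change of variables. *)
Lemma plane_null (a b c d : rV3) : vdet a b c d != 0 ->
  leb3 R [set p | dot (cross (c - a) (d - a)) (vec3 p - a) = 0] = 0%E.
Proof.
move=> D0; set S := [set p | _].
have mS : measurable (S : set (R * R * R)).
  apply: (@closed_measurable3 _ [set x | dot (cross (c - a) (d - a)) (x - a) = 0]).
  have -> : [set x | dot (cross (c - a) (d - a)) (x - a) = 0] =
     (fun x : rV3 => dot (cross (c - a) (d - a)) (x - a)) @^-1` [set 0] by [].
  apply: closed_comp; last exact: closed_eq.
  move=> x _; have C : C1 (fun x : rV3 => dot (cross (c - a) (d - a)) (x - a)).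
    apply: C1_sum => t _; apply: C1Z.
    have -> : (fun y : rV3 => (y - a) 0 t) = (fun y => y 0 t - a 0 t).
      by apply/funext => y; rewrite !mxE.
    by apply: C1B; [exact: C1_coord|exact: C1_cst].
  exact: C1_continuous C x.
have cT : changes_volume (affine3 (xyz a) (xyz (c - a)) (xyz (d - a)) (xyz (b - a))) `|vdet a b c d|^-1.
  by rewrite -vdet_det3; apply: changes_volume_affine; rewrite vdet_det3.
have [mT hT] := cT.
have mf : measurable_fun setT (fun p : R * R * R => (\1_S p : R)%:E).
  by apply/measurable_EFinP; exact: measurable_indic.
have := hT _ mf (fun p => _); rewrite /= => /(_ (fun p => ltac:(by rewrite lee_fin))).
have -> : (\int[leb3 R]_p (\1_S p : R)%:E = leb3 R S)%E by rewrite integral_indic// setIT.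
move=> E.
have Z : (\int[leb3 R]_p (\1_S (affine3 (xyz a) (xyz (c - a)) (xyz (d - a)) (xyz (b - a)) p) : R)%:E = 0)%E.
  transitivity (\int[leb3 R]_p (\1_([set: R * R] `*` [set (0 : R)]) p : R)%:E)%E.
    apply: eq_integral => p _; rewrite !indicE; congr ((nat_of_bool _)%:R%:E).
    rewrite /S; apply/idP/idP => /set_mem.
      rewrite /= -simplex_map_vec3; have [-> _ _] := simplex_mapK a b c d p.
      by move=> /eqP; rewrite mulf_eq0 (negbTE D0) orbF => /eqP p0; apply/mem_set.
    move=> [_ /= p0]; apply/mem_set; rewrite /= -simplex_map_vec3.
    by have [-> _ _] := simplex_mapK a b c d p; rewrite p0 mul0r.
  have m0 : measurable ([set: R * R] `*` [set (0 : R)]) by apply: measurableX.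
  rewrite integral_indic// setIT.
  pose Z0 : set R := [set 0].
  transitivity (leb2 R [set: R * R] * leb1 R Z0)%E.
    by apply: product_measure1E; [exact: measurableT|exact: measurable_set1].
  by rewrite lebesgue_measure_set1 mule0.
move: E; rewrite Z => /esym/eqP; rewrite mule_eq0 => /orP[|/eqP//].
by rewrite eqe invr_eq0 normr_eq0 (negbTE D0).
Qed.

Lemma hull_boundary_null K : tetrahedron K ->
  leb3 R (@vec3 R @^-1` (hull K `\` cell_int K)) = 0%E.
Proof.
move=> tK; have [c ai] := tK.
pose S i := @vec3 R @^-1` [set x | bary K i x = 0].
have mS i : measurable (S i : set (R * R * R)).
  apply: closed_measurable3.
  have -> : [set x | bary K i x = 0] = bary K i @^-1` [set 0] by [].
  by apply: closed_comp => [x _|]; [exact: bary_continuous|exact: closed_eq].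
have S0 i : i \in K -> leb3 R (S i) = 0%E.
  move=> iK; have [j [k [l [/vertex_enum3[e0 e1 e2] lab _]]]] := face_labels4 c iK.
  have D0 := affinely_independent_vdet ai lab.
  have D1 : vdet (v j) (v i) (v k) (v l) != 0.
    apply: contra_neq D0 => h; rewrite -[RHS]h /vdet !dotE !crossE !mxE; ring.
  rewrite -[RHS](plane_null D1); congr (leb3 R _); apply/seteqP; split=> p /=.
    rewrite /S /bary /= => /eqP; rewrite mulf_eq0 invr_eq0 (negbTE (height_neq0 tK iK)) orbF.
    by rewrite /face_normal e0 e1 e2 => /eqP.
  by rewrite /S /bary /= /face_normal e0 e1 e2 => ->; rewrite mul0r.
have neg i : i \in K -> (leb3 R).-negligible (S i).
  by move=> iK; apply/negligibleP; [exact: mS|exact: S0].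
apply: (measure_negligible (mu := leb3 R)).
  by apply: (@measurableD _ (R * R * R)%type); [exact: hull_mset|exact: cell_int_mset].
have [i [j [k [l [_ [u lab]]]]]] := enum_labels4 c.
apply: (@negligibleS _ _ _ (leb3 R) (S i `|` S j `|` S k `|` S l)).
  move=> p [/= hp hi]; have [t tK' b0] : exists2 t, t \in K & bary K t (vec3 p) = 0.
    apply: contrapT => H; apply: hi; apply/(cell_intP _ tK) => t tK'.
    rewrite lt_neqAle ((hullP _ tK).1 hp)// andbT eq_sym; apply/eqP => b0.
    by apply: H; exists t.
  move: tK'; rewrite lab !inE => /or4P[] /eqP ? ; subst t.
  - by left; left; left.
  - by left; left; right.
  - by left; right.
  - by right.
by do ?apply: negligibleU; apply: neg; rewrite lab !inE eqxx ?orbT.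
Qed.

Definition face_avg e (F : rV3 -> R) := tri_int (fun q => F (face_param e q)).

(** The outward normal of the face of K opposite to i, of length twice its area. *)
Definition onormal K i : rV3 :=
  - Num.sg (height K i) *: face_normal (opp K i).

Lemma face_avg_enum e i j k F : enum e = [:: i; j; k] ->
  face_avg e F = face_mean (v i) (v j) (v k) F.
Proof.
by move=> /vertex_enum3[e0 e1 e2]; rewrite /face_avg /face_mean /face_param e0 e1 e2.
Qed.

Lemma enum_filter_face K i : enum (opp K i) = [seq j <- enum K | j != i].
Proof.
by rewrite /enum_mem -filter_predI; apply: eq_filter => j; rewrite /= !inE.
Qed.

(** The formula on a labelled tetrahedron, once each face is designated by the opposite
    vertex. *)
Lemma int_hull_derive K w F : tetrahedron K -> C1 F ->
  vol_int (hull K) (fun x => 'D_w F x)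
  = \sum_(i in K) dot w (onormal K i) * face_avg (opp K i) F.
Proof.
move=> tK F1; have cF := C1_continuous F1.
have [c ai] := tK; have [i0 [i1 [i2 [i3 [eK lab]]]]] := enum_labels4 c.
have [] := lab; rewrite /= !inE !negb_or => /and4P[/and3P[n01 n02 n03] /andP[n12 n13] n23 _] mK.
have E0 : enum (opp K i0) = [:: i1; i2; i3].
  by rewrite enum_filter_face eK /= eqxx !(eq_sym _ i0) n01 n02 n03.
have E1 : enum (opp K i1) = [:: i0; i2; i3].
  by rewrite enum_filter_face eK /= eqxx n01 !(eq_sym _ i1) n12 n13.
have E2 : enum (opp K i2) = [:: i0; i1; i3].
  by rewrite enum_filter_face eK /= eqxx n02 n12 (eq_sym _ i2) n23.
have E3 : enum (opp K i3) = [:: i0; i1; i2].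
  by rewrite enum_filter_face eK /= eqxx n03 n13 n23.
rewrite (sum_labels4 _ lab) (face_avg_enum _ E0) (face_avg_enum _ E1) (face_avg_enum _ E2)
  (face_avg_enum _ E3) /onormal /height /face_normal.
have [-> -> ->] := vertex_enum3 E0; have [-> -> ->] := vertex_enum3 E1.
have [-> -> ->] := vertex_enum3 E2; have [-> -> ->] := vertex_enum3 E3.
have hK1 := hull_simplex_map tK lab.
have lab2 : labels4 K i0 i2 i3 i1.
  split; last by move=> x; rewrite mK !inE; do !case: (_ == _).
  by rewrite /= !inE !negb_or n01 n02 n03 n23 !(eq_sym _ i1) n12 n13.
have lab3 : labels4 K i0 i3 i1 i2.
  split; last by move=> x; rewrite mK !inE; do !case: (_ == _).
  by rewrite /= !inE !negb_or n01 n02 n03 n12 !(eq_sym i3) n13 n23.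
have hK2 := hull_simplex_map tK lab2; have hK3 := hull_simplex_map tK lab3.
have D0 := affinely_independent_vdet ai lab.
rewrite (int_simplex_derive w D0 F1 (hull_closed tK) hK1 hK2 hK3).
have H0 (a b d g : rV3) : dot (cross (d - b) (g - b)) (a - b) = - vdet a b d g.
  by rewrite /vdet !dotE !crossE !mxE; ring.
have H1 (a b d g : rV3) : dot (cross (d - a) (g - a)) (b - a) = vdet a b d g.
  by rewrite /vdet !dotE !crossE !mxE; ring.
have H2 (a b d g : rV3) : dot (cross (b - a) (g - a)) (d - a) = - vdet a b d g.
  by rewrite /vdet !dotE !crossE !mxE; ring.
have H3 (a b d g : rV3) : dot (cross (b - a) (d - a)) (g - a) = vdet a b d g by [].
rewrite (H0 _ _ (v i2)) (H1 _ _ _ (v i3)) (H2 _ _ _ (v i3)) H3 sgrN opprK !dotZr.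
move: (dot w _) (dot w _) (dot w _) (dot w _) => x0 x1 x2 x3.
by move: (face_mean _ _ _ _) (face_mean _ _ _ _) (face_mean _ _ _ _) (face_mean _ _ _ _)
  => f0 f1 f2 f3; ring.
Qed.

End Barycentric.

(** * Properties that hold almost everywhere *)

Section AlmostEverywhere.
Variable R : realType.
Notation rV3 := 'rV[R]_3.
Notation leb := (leb3 R).
Implicit Types (C D : set rV3) (f g : rV3 -> R).

Lemma patch_vec3 f D :
  (fun p : R * R * R => (f \_ D) (vec3 p)) = (fun p => f (vec3 p)) \_ (@vec3 R @^-1` D).
Proof.
apply/funext => p; rewrite /patch.
by rewrite (_ : (p \in @vec3 R @^-1` D) = (vec3 p \in D)).
Qed.

Lemma vol_int_patch D C f : C `<=` D -> vol_int D (f \_ C) = vol_int C f.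
Proof.
move=> CD; rewrite /vol_int.
have -> : @vec3 R @^-1` C = (@vec3 R @^-1` D) `&` (@vec3 R @^-1` C).
  by rewrite -preimage_setI setIidr.
rewrite Rintegral_mkcondr; apply: eq_Rintegral => p _.
by rewrite -[LHS]/((fun p => (f \_ C) (vec3 p)) p) patch_vec3.
Qed.

Lemma int3_patch D C f : mset3 D -> mset3 C -> C `<=` D -> int3 C f -> int3 D (f \_ C).
Proof.
move=> mD mC CD h; rewrite /int3.
have -> : (fun p : R * R * R => ((f \_ C) (vec3 p))%:E) =
   (fun p => (f (vec3 p))%:E) \_ (@vec3 R @^-1` C).
  by rewrite -[RHS]/((EFin \o (fun p => f (vec3 p))) \_ _) restrict_EFin -patch_vec3.
have K : leb.-integrable ((@vec3 R @^-1` D) `&` (@vec3 R @^-1` C)) (fun p => (f (vec3 p))%:E).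
  by rewrite -preimage_setI setIidr.
have := (iffLR (@integrable_restrict _ _ _ leb (@vec3 R @^-1` C) mC (@vec3 R @^-1` D) mD
  (fun p => (f (vec3 p))%:E))) K.
by apply: eq_integrable.
Qed.

Lemma int3S C D f : mset3 C -> mset3 D -> C `<=` D -> int3 D f -> int3 C f.
Proof.
move=> mC mD CD h; apply: (integrableS (mu := leb) mD mC _ h) => p; exact: CD.
Qed.

Lemma int3_mfun3 D f : int3 D f -> mfun3 D f.
Proof. by move=> /integrableP[/measurable_EFinP]. Qed.

Lemma ae_onW D (P : rV3 -> Prop) : (forall x, D x -> P x) -> ae_on D P.
Proof.
move=> h; exists set0; split=> // p /= hp; apply: hp => Dp; exact: h.
Qed.

Lemma ae_onS D (P Q : rV3 -> Prop) : (forall x, D x -> P x -> Q x) ->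
  ae_on D P -> ae_on D Q.
Proof.
move=> PQ [N [mN N0 hN]]; exists N; split=> // p /= hp; apply: hN => /= h.
by apply: hp => Dp; apply: PQ => //; exact: h.
Qed.

Lemma vol_int_ae D f g : mset3 D -> mfun3 D f -> mfun3 D g ->
  ae_on D (fun x => f x = g x) -> vol_int D f = vol_int D g.
Proof.
move=> mD mf mg fg; rewrite /vol_int /Rintegral; congr fine.
apply: ae_eq_integral => //.
- exact/measurable_EFinP.
- exact/measurable_EFinP.
- have [N [mN N0 hN]] := fg; exists N; split=> // p /= hp; apply: hN => /= h.
  by apply: hp => Dp; rewrite (h Dp).
Qed.

Lemma int3_ae D f g : mset3 D -> mfun3 D g -> int3 D f ->
  ae_on D (fun x => f x = g x) -> int3 D g.
Proof.
move=> mD mg intf fg; have mf := int3_mfun3 intf.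
apply/integrableP; split; first exact/measurable_EFinP.
have /integrableP[_] := intf; rewrite (@ae_eq_integral _ _ _ leb _
  (fun p => `|(f (vec3 p))%:E|)%E (fun p => `|(g (vec3 p))%:E|)%E) //.
- by apply: measurableT_comp => //; exact/measurable_EFinP.
- by apply: measurableT_comp => //; exact/measurable_EFinP.
- have [N [mN N0 hN]] := fg; exists N; split=> // p /= hp; apply: hN => /= h.
  by apply: hp => Dp; rewrite (h Dp).
Qed.

Lemma vol_int_eq0_ae D f : mset3 D -> int3 D f -> (forall x, D x -> 0 <= f x) ->
  vol_int D f = 0 -> ae_on D (fun x => f x = 0).
Proof.
move=> mD intf f0 I0.
have I : (\int[leb]_(p in @vec3 R @^-1` D) (f (vec3 p))%:E = 0)%E.
  by rewrite -(fineK (integrable_fin_num (mu := leb) mD intf)) -[fine _]/(vol_int D f) I0.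
have A : (\int[leb]_(p in @vec3 R @^-1` D) `|(f (vec3 p))%:E| = 0)%E.
  by rewrite -[RHS]I; apply: eq_integral => p /set_mem Dp; rewrite gee0_abs// lee_fin f0.
have mf := int3_mfun3 intf.
have := (ae_eq_integral_abs leb mD (iffRL (measurable_EFinP _ _) mf)).1 A.
move=> [N [mN N0 hN]]; exists N; split=> // p /= hp; apply: hN => /= h.
by apply: hp => Dp; have [] := h Dp.
Qed.

Lemma L2_int3_sqr D f : mset3 D -> L2 D f -> int3 D (fun x => f x ^+ 2).
Proof.
move=> mD [mf h]; apply/integrableP; split.
  by apply/measurable_EFinP; apply: measurable_funX.
rewrite (_ : (\int[_]_(p in _) _)%E = \int[leb]_(p in @vec3 R @^-1` D) (f (vec3 p) ^+ 2)%:E)%E//.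
by apply: eq_integral => p _; rewrite gee0_abs// lee_fin sqr_ge0.
Qed.

Lemma int3_sqr_L2 D f : mset3 D -> mfun3 D f -> int3 D (fun x => f x ^+ 2) -> L2 D f.
Proof.
move=> mD mf /integrableP[_]; split=> //.
rewrite (_ : (\int[_]_(p in _) _)%E = \int[leb]_(p in @vec3 R @^-1` D) `|(f (vec3 p) ^+ 2)%:E|)%E//.
by apply: eq_integral => p _; rewrite gee0_abs// lee_fin sqr_ge0.
Qed.

Lemma mfun3M D f g : mfun3 D f -> mfun3 D g -> mfun3 D (fun x => f x * g x).
Proof. by move=> hf hg; apply: measurable_funM. Qed.
Lemma mfun3D D f g : mfun3 D f -> mfun3 D g -> mfun3 D (fun x => f x + g x).
Proof. by move=> hf hg; apply: measurable_funD. Qed.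
Lemma mfun3Z D c f : mfun3 D f -> mfun3 D (fun x => c * f x).
Proof. by move=> hf; apply: mfun3M => //; apply: mfun3_continuous; exact: continuous_cst. Qed.

Lemma int3_le D f g : mset3 D -> mfun3 D f -> int3 D g ->
  (forall x, D x -> `|f x| <= g x) -> int3 D f.
Proof.
move=> mD mf ig h; apply: (le_integrable (mu := leb) mD _ _ ig); first exact/measurable_EFinP.
by move=> p Dp; rewrite lee_fin (le_trans (h _ Dp))// ler_norm.
Qed.

Lemma L2M_int3 D f g : mset3 D -> L2 D f -> L2 D g -> int3 D (fun x => f x * g x).
Proof.
move=> mD hf hg.
apply: (int3_le (g := fun x => f x ^+ 2 + g x ^+ 2)) => //.
- by apply: mfun3M; [case: hf|case: hg].
- by apply: int3D => //; exact: L2_int3_sqr.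
- move=> x _; rewrite ler_norml; apply/andP; split; nra.
Qed.

Lemma L2_int3 D f : mset3 D -> bounded_set D -> L2 D f -> int3 D f.
Proof.
move=> mD bD hf; apply: (int3_le (g := fun x => f x ^+ 2 + 1)) => //.
- by case: hf.
- apply: int3D => //; first exact: L2_int3_sqr.
  by apply: continuous_int3 => //; exact: continuous_cst.
- move=> x _; rewrite ler_norml; apply/andP; split; nra.
Qed.

Lemma L2D D f g : mset3 D -> L2 D f -> L2 D g -> L2 D (fun x => f x + g x).
Proof.
move=> mD hf hg; have [mf _] := hf; have [mg _] := hg.
apply: int3_sqr_L2 => //; first exact: mfun3D.
have := int3D mD (int3D mD (L2_int3_sqr mD hf) (L2_int3_sqr mD hg))
  (int3Z 2 mD (L2M_int3 mD hf hg)).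
by apply: eq_int3 => // x _; ring.
Qed.

Lemma L2Z D c f : mset3 D -> L2 D f -> L2 D (fun x => c * f x).
Proof.
move=> mD hf; have [mf _] := hf; apply: int3_sqr_L2 => //; first exact: mfun3Z.
have := int3Z (c ^+ 2) mD (L2_int3_sqr mD hf).
by apply: eq_int3 => // x _; ring.
Qed.

Lemma continuous_L2 D f : mset3 D -> bounded_set D -> continuous f -> L2 D f.
Proof.
move=> mD bD cf; apply: int3_sqr_L2 => //; first exact: mfun3_continuous.
apply: continuous_int3 => //; apply: (eq_continuous_fun (f := fun x => f x * f x)) => //.
exact: continuous_mul.
Qed.

Lemma open_leb_gt0 (O : set rV3) x : open O -> O x -> (0 < leb (@vec3 R @^-1` O))%E.
Proof.
move=> oO Ox; have /nbhs_ballP[e /= e0 eO] : nbhs x O by exact: open_nbhs_nbhs.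
pose I (c : R) := `](c - e), (c + e)[%classic : set R.
have mI c : measurable (I c : set (measurableTypeR R)) by exact: measurable_itv.
have I0 c : (0 < leb1 R (I c))%E.
  rewrite /I lebesgue_measure_itv /= lte_fin ltrD2l gtrN//.
  by rewrite -EFinD lte_fin; lra.
have sub : (I (x 0 0) `*` I (x 0 1)) `*` I (x 0 2) `<=` @vec3 R @^-1` O.
  move=> p [[/= h0 h1] h2]; apply: eO; apply/ball_rowP => // i.
  rewrite distrC ltr_distl; move: h0 h1 h2; rewrite /I /= !in_itv /=.
  by elim/ord3_ind: i; rewrite vec3E => h0 h1 h2.
move: (x 0 0) (x 0 1) (x 0 2) sub => a b c sub.
apply: (@lt_le_trans _ _ (leb ((I a `*` I b) `*` I c))); last first.
  apply: le_measure => //; rewrite inE; last exact: open_measurable3.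
  by apply: measurableX => //; apply: measurableX.
have E1 : (leb2 R) (I a `*` I b) = (leb1 R (I a) * leb1 R (I b))%E.
  by apply: product_measure1E.
have -> : leb (I a `*` I b `*` I c) = ((leb2 R) (I a `*` I b) * leb1 R (I c))%E.
  by apply: product_measure1E => //; exact: measurableX.
by rewrite E1 !mule_gt0.
Qed.

(** Where a continuous function is nonzero, it is so on a cube, of positive measure. *)
Lemma ae_open_eq0 (O : set rV3) g : open O -> continuous g ->
  ae_on O (fun x => g x = 0) -> forall x, O x -> g x = 0.
Proof.
move=> oO cg [N [mN N0 hN]] x Ox; apply/eqP; apply: contrapT => /negP gx.
have oS : open (O `&` (g @^-1` [set y | y != 0])).
  apply: openI => //; apply: open_comp => [y _|]; first exact: cg.
  have -> : [set y : R | y != 0] = ~` [set 0] by apply/seteqP; split=> y /= /eqP.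
  by apply: closed_openC; exact: closed_eq.
have := open_leb_gt0 oS (conj Ox gx); rewrite lt_neqAle eq_sym => /andP[/eqP + _]; apply.
apply: (measure_negligible (mu := leb)); first exact: open_measurable3.
exists N; split=> // p [/= Op gp]; apply: hN => /= h.
by move: gp; rewrite h// eqxx.
Qed.

End AlmostEverywhere.

(** * Splitting integrals over the cells *)

Section Mesh.
Variable R : realType.
Variable M : mesh R.
Variable Omega : set 'rV[R]_3.
Hypothesis M_tri : triangulation M Omega.
Hypothesis Omega_dom : bounded_domain Omega.
Notation rV3 := 'rV[R]_3.
Notation simplex := {set 'I_(nvert M)}.
Notation v := (@vert R M).
Notation opp K i := (K :\ i)%SET.
Implicit Types (K L e : simplex) (x y : rV3) (f g : rV3 -> R).

Lemma cell_tetrahedron K : K \in cells M -> tetrahedron K.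
Proof. by case: M_tri => h _ _ /h. Qed.

Lemma hull_cap K L : K \in cells M -> L \in cells M ->
  hull K `&` hull L = hull (K :&: L)%SET.
Proof. by case: M_tri => _ h _; exact: h. Qed.

Lemma cell_int_disjoint K L x : K \in cells M -> L \in cells M ->
  cell_int K x -> cell_int L x -> K = L.
Proof.
move=> KM LM Kx Lx; have tK := cell_tetrahedron KM; have tL := cell_tetrahedron LM.
have hx : hull (K :&: L)%SET x by rewrite -hull_cap//; split; exact: cell_int_hull.
have [_ h] := hull_sub_bary tK (subsetIl K L) hx.
apply/eqP; rewrite finset.eqEcard tL.1 tK.1 leqnn andbT; apply/fintype.subsetP => i iK.
apply: contraT => iL; have := (cell_intP _ tK).1 Kx i iK.
by rewrite h ?ltxx// inE iK.
Qed.

Lemma Omega_mset : mset3 Omega.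
Proof. by case: Omega_dom => oO _ _ _ _; exact: open_measurable3. Qed.

Lemma Omega_bounded : bounded_set Omega.
Proof. by case: Omega_dom. Qed.

(** Here cracks are excluded: the interior of the closure of Omega is Omega. *)
Lemma cell_int_Omega K : K \in cells M -> cell_int K `<=` Omega.
Proof.
move=> KM; case: Omega_dom => _ _ _ _ ->; case: M_tri => _ _ U.
apply: (@subset_trans _ (hull K)°); first by [].
by apply: interiorS; rewrite -U => x hx; exists K.
Qed.

(** The hulls cover Omega, and their boundaries lie in planes. *)
Lemma skeleton_null : ae_on Omega (fun x => exists2 K, K \in cells M & cell_int K x).
Proof.
have [N [mN N0 hN]] : (leb3 R).-negligible (\bigcup_(K in [set K | K \in cells M])
    (@vec3 R @^-1` (hull K `\` cell_int K))).
  have : forall s : seq simplex, (leb3 R).-negligible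
      (\big[setU/set0]_(K <- s | K \in cells M) (@vec3 R @^-1` (hull K `\` cell_int K))).
    elim=> [|K s IH]; first by rewrite big_nil; exact: negligible_set0.
    rewrite big_cons; case: ifP => // KM; apply: negligibleU => //.
    have tK := cell_tetrahedron KM.
    apply/negligibleP; last exact: hull_boundary_null.
    by apply: (@measurableD _ (R * R * R)%type); [exact: hull_mset|exact: cell_int_mset].
  move=> /(_ (index_enum simplex)); apply: negligibleS => p [K /= KM hK].
  rewrite big_mkcond -bigcup_seq; exists K; first exact: mem_index_enum.
  by rewrite KM.
exists N; split=> // p /= hp; apply: hN => /=.
apply: contrapT => h; apply: hp => Op.
have : closure Omega (vec3 p) by exact: subset_closure.
case: M_tri => _ _ <- [K /= KM hK]; exists K => //.
by apply: contrapT => nK; apply: h; exists K.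
Qed.

Lemma sum_cells_patch f x : (exists2 K, K \in cells M & cell_int K x) ->
  \sum_(K in cells M) (f \_ (cell_int K)) x = f x.
Proof.
move=> [K KM Kx]; rewrite (bigD1 K)//= patchE mem_set// big1 ?addr0// => L /andP[LM LK].
rewrite patchE memNset// => Lx; move/eqP: LK; apply.
exact: (cell_int_disjoint LM KM Lx Kx).
Qed.

Lemma int3_cells f : mfun3 Omega f -> (forall K, K \in cells M -> int3 (cell_int K) f) ->
  int3 Omega f.
Proof.
move=> mf h; have mO := Omega_mset.
apply: (@int3_ae _ _ (fun x => \sum_(K in cells M) (f \_ (cell_int K)) x)) => //.
- apply: int3_sum => // K KM; apply: int3_patch => //; last exact: h.
    exact: cell_int_mset.
  exact: cell_int_Omega.
- apply: ae_onS skeleton_null => x _; exact: sum_cells_patch.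
Qed.

Lemma vol_int_cells f : int3 Omega f ->
  vol_int Omega f = \sum_(K in cells M) vol_int (cell_int K) f.
Proof.
move=> hf; have mO := Omega_mset.
have hK K : K \in cells M -> int3 Omega (f \_ (cell_int K)).
  move=> KM; apply: int3_patch => //; [exact: cell_int_mset|exact: cell_int_Omega|].
  by apply: int3S hf => //; [exact: cell_int_mset|exact: cell_int_Omega].
rewrite -(vol_int_ae (f := fun x => \sum_(K in cells M) (f \_ (cell_int K)) x)) //.
- rewrite vol_int_sum//; apply: eq_bigr => K KM.
  by rewrite vol_int_patch//; exact: cell_int_Omega.
- by apply: int3_mfun3; apply: int3_sum.
- exact: int3_mfun3.
- apply: ae_onS skeleton_null => x _; exact: sum_cells_patch.
Qed.

Lemma vol_int_hull K f : tetrahedron K -> int3 (hull K) f ->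
  vol_int (hull K) f = vol_int (cell_int K) f.
Proof.
move=> tK hf; have mh := hull_mset tK; have mi := cell_int_mset K.
rewrite -(vol_int_patch _ (@cell_int_hull _ _ K)).
apply: vol_int_ae => //.
- exact: int3_mfun3.
- apply: int3_mfun3; apply: int3_patch => //; first exact: cell_int_hull.
  by apply: int3S hf => //; exact: cell_int_hull.
exists (@vec3 R @^-1` (hull K `\` cell_int K)); split.
- exact: (@measurableD _ (R * R * R)%type).
- exact: hull_boundary_null.
- move=> p /= hp; apply: contrapT => h; apply: hp => hK; rewrite patchE mem_set//.
  by apply: contrapT => nK; apply: h.
Qed.

(** A class of integrands that contains all finite element functions and is stable under
    products, whatever the values on the skeleton. *)
Definition cellwise_continuous f := mfun3 Omega f /\ forall K, K \in cells M ->
  exists2 g, continuous g & forall x, cell_int K x -> f x = g x.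

Lemma cwc_continuous f : continuous f -> cellwise_continuous f.
Proof. by move=> cf; split=> [|K _]; [exact: mfun3_continuous|exists f]. Qed.

Lemma cwcD f g : cellwise_continuous f -> cellwise_continuous g ->
  cellwise_continuous (fun x => f x + g x).
Proof.
move=> [mf hf] [mg hg]; split=> [|K KM]; first exact: mfun3D.
have [f1 cf1 e1] := hf K KM; have [g1 cg1 e2] := hg K KM.
exists (fun x => f1 x + g1 x); first exact: continuous_add.
by move=> x Kx; rewrite e1// e2.
Qed.

Lemma cwcM f g : cellwise_continuous f -> cellwise_continuous g ->
  cellwise_continuous (fun x => f x * g x).
Proof.
move=> [mf hf] [mg hg]; split=> [|K KM]; first exact: mfun3M.
have [f1 cf1 e1] := hf K KM; have [g1 cg1 e2] := hg K KM.
exists (fun x => f1 x * g1 x); first exact: continuous_mul.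
by move=> x Kx; rewrite e1// e2.
Qed.

Lemma cwc_cst c : cellwise_continuous (fun=> c).
Proof. exact: cwc_continuous (@continuous_cst _ _ c). Qed.

Lemma cwcZ c f : cellwise_continuous f -> cellwise_continuous (fun x => c * f x).
Proof. by move=> hf; apply: cwcM => //; exact: cwc_cst. Qed.

Lemma cwc_sum I (r : seq I) (F : I -> rV3 -> R) :
  (forall i, cellwise_continuous (F i)) ->
  cellwise_continuous (fun x => \sum_(i <- r) F i x).
Proof.
move=> h; elim: r => [|i r IH].
  by under eq_fun do rewrite big_nil; exact: cwc_cst.
by under eq_fun do rewrite big_cons; exact: cwcD.
Qed.

Lemma cell_int_bounded K : K \in cells M -> bounded_set (cell_int K).
Proof.
move=> KM; apply: (bounded_setS (@cell_int_hull _ _ K)).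
exact: hull_bounded (cell_tetrahedron KM).
Qed.

Lemma int3_cwcM f g : int3 Omega f -> cellwise_continuous g -> int3 Omega (fun x => f x * g x).
Proof.
move=> hf [mg hg]; apply: int3_cells; first by apply: mfun3M => //; exact: int3_mfun3.
move=> K KM; have [g1 cg1 e1] := hg K KM.
have mi := cell_int_mset K; have bK := cell_int_bounded KM.
have [B B0 hB] := continuous_bounded bK cg1.
apply: (eq_int3 (f := fun x => f x * g1 x)) => // [x Kx|]; first by rewrite e1.
apply: (int3M_bounded (M := B)) => //; last exact: mfun3_continuous.
by apply: int3S hf => //; [exact: Omega_mset|exact: cell_int_Omega].
Qed.

Lemma cwc_int3 f : cellwise_continuous f -> int3 Omega f.
Proof.
move=> hf; apply: (eq_int3 (f := fun x => 1 * f x)) => [|x _|]; first exact: Omega_mset.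
  by rewrite mul1r.
apply: int3_cwcM => //; apply: continuous_int3; [exact: Omega_mset|exact: Omega_bounded|].
exact: continuous_cst.
Qed.

Lemma cwc_L2 f : cellwise_continuous f -> L2 Omega f.
Proof.
move=> hf; apply: int3_sqr_L2; [exact: Omega_mset|by case: hf|].
by apply: cwc_int3; under eq_fun do rewrite expr2; exact: cwcM.
Qed.

Lemma mfun3_cells f : (forall K, K \in cells M -> mfun3 (cell_int K) f) ->
  (forall x, ~ (exists2 K, K \in cells M & cell_int K x) -> f x = 0) -> mfun3 Omega f.
Proof.
move=> h f0; apply: measurable_funTS.
have -> : (fun p : R * R * R => f (vec3 p)) =
    (fun p => \sum_(K in cells M) (f \_ (cell_int K)) (vec3 p)).
  apply/funext => p.
  have [hx|hx] := pselect (exists2 K, K \in cells M & cell_int K (vec3 p)).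
    by rewrite sum_cells_patch.
  rewrite f0// big1// => K KM; rewrite patchE memNset// => Kx.
  by apply: hx; exists K.
under eq_fun do rewrite big_mkcond.
apply: (@measurable_sum _ (R * R * R)%type) => K.
case KM: (K \in cells M); last exact: measurable_cst.
have -> : (fun p : R * R * R => (f \_ (cell_int K)) (vec3 p)) =
    ((fun p => f (vec3 p)) \_ (@vec3 R @^-1` (cell_int K))).
  exact: patch_vec3.
have mi : measurable (@vec3 R @^-1` (cell_int K)) := cell_int_mset K.
by rewrite -measurable_restrictT//; exact: (h K KM).
Qed.

End Mesh.

(** * Neighbouring cells and orientation of faces *)

Section Adjacency.
Variable R : realType.
Variable M : mesh R.
Variable Omega : set 'rV[R]_3.
Hypothesis M_tri : triangulation M Omega.
Notation rV3 := 'rV[R]_3.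
Notation simplex := {set 'I_(nvert M)}.
Notation v := (@vert R M).
Notation opp K i := (K :\ i)%SET.
Implicit Types (K L e : simplex) (x y : rV3) (f g : rV3 -> R).

Let cell_tet K : K \in cells M -> tetrahedron K := @cell_tetrahedron R M Omega M_tri K.

Lemma bary_face K e (c : 'I_(nvert M) -> R) k : tetrahedron K -> e \subset K -> k \in e ->
  \sum_(t in e) c t = 1 -> bary K k (\sum_(t in e) c t *: v t) = c k.
Proof.
move=> tK eK ke c1; pose f t := if t \in e then c t else 0.
have s (V : nmodType) (g z : 'I_(nvert M) -> V) :
    (forall t, t \in e -> z t = g t) -> (forall t, t \notin e -> z t = 0) ->
    \sum_(t in K) z t = \sum_(t in e) g t.
  move=> h1 h2; rewrite (big_setID e) /= [X in _ + X]big1 ?addr0; last first.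
    by move=> t; rewrite inE => /andP[/h2].
  apply: eq_big => [t|t]; rewrite inE; last by move=> /andP[_ /h1].
  by apply: andb_idl; move: t; apply/fintype.subsetP.
have -> : \sum_(t in e) c t *: v t = \sum_(t in K) f t *: v t.
  by symmetry; apply: s => t te; rewrite /f; [rewrite te|rewrite (negbTE te) scale0r].
rewrite bary_sum//; first by rewrite /f ke.
- exact: (fintype.subsetP eK).
- by rewrite -[RHS]c1; apply: s => t te; rewrite /f; [rewrite te|rewrite (negbTE te)].
Qed.

Definition centroid e : rV3 := \sum_(k in e) 3^-1 *: v k.

(** Otherwise the segment from the centroid of the common face to the vertex j would
    start inside both cells, whereas they only share that face. *)
Lemma neighbour_opposite K L i j : K \in cells M -> L \in cells M -> K != L ->
  i \in K -> j \in L -> opp K i = opp L j -> bary K i (v j) < 0.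
Proof.
move=> KM LM KL iK jL E; have tK := cell_tet KM; have tL := cell_tet LM.
have jK : j \notin K.
  have : j \notin opp K i by rewrite E !inE eqxx.
  rewrite !inE negb_and negbK => /orP[/eqP ji|//]; case/eqP: KL.
  by rewrite -(finset.setD1K iK) -(finset.setD1K jL) E ji.
have c3 : #|opp K i| = 3%N by have := cardsD1 i K; rewrite iK tK.1 => -[].
rewrite ltNge; apply/negP => b0.
pose e := opp K i; pose c := centroid e.
have s1 : \sum_(k in e) (3^-1 : R) = 1.
  by rewrite sumr_const c3 -[RHS](@mulVf R 3) ?pnatr_eq0// mulr_natr.
have hc : hull e c by exists (fun=> 3^-1); split=> // ?; rewrite invr_ge0.
have bc N k : tetrahedron N -> e \subset N -> k \in e -> bary N k c = 3^-1.
  by move=> tN eN ke; rewrite /c /centroid bary_face.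
have eK : e \subset K by exact: subD1set.
have eL : e \subset L by rewrite /e E; exact: subD1set.
(* A step t for which the coordinates of the moving point in K stay nonnegative. *)
pose t : R := \big[Num.min/1]_(k in e) (3^-1 / (1 + `|bary K k (v j)|)).
have t0 : 0 < t.
  rewrite /t; apply: (big_ind (fun z : R => 0 < z)) => [|a b a0 b0'|k _]; first by [].
    by rewrite lt_min a0.
  by rewrite divr_gt0// ?invr_gt0// ltr_pwDl.
have tk k : k \in e -> t <= 3^-1 / (1 + `|bary K k (v j)|).
  by move=> ke; rewrite /t (bigD1 k)//= ge_min lexx.
have t1 : t <= 1.
  rewrite /t; apply: (big_ind (fun z : R => z <= 1)) => [|a b a0 b0'|k _]; first by [].
    by rewrite ge_min a0.
  by rewrite ler_pdivrMr ?ltr_pwDl// mul1r; have := normr_ge0 (bary K k (v j)); lra.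
pose x := c + t *: (v j - c).
have bx N k : bary N k x = bary N k c + t * (bary N k (v j) - bary N k c).
  rewrite /x (baryE N k _ c) [c + _ - c]addrAC subrr add0r dotZr.
  by rewrite (baryE N k (v j) c) [_ + dot _ _ - _]addrAC subrr add0r.
have c0 N n : tetrahedron N -> n \in N -> e = opp N n -> bary N n c = 0.
  move=> tN nN eN; have eN' : e \subset N by rewrite eN; exact: subD1set.
  by have [_ h] := hull_sub_bary tN eN' hc; apply: h => //; rewrite eN !inE eqxx.
have xK : hull K x.
  apply/(hullP _ tK) => k kK; have [->|ki] := eqVneq k i.
    by rewrite bx c0// add0r subr0 mulr_ge0// ltW.
  have ke : k \in e by rewrite !inE ki.
  rewrite bx (bc K)//; have := tk k ke; rewrite ler_pdivlMr ?ltr_pwDl//.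
  have := ler_norm (- bary K k (v j)); rewrite normrN.
  move: (bary K k (v j)) => b hb ht; have : t * - b <= t * `|b| by rewrite ler_pM2l.
  have : t * 3^-1 >= 0 by rewrite mulr_ge0// ?invr_ge0// ltW.
  lra.
have xL : hull L x.
  apply/(hullP _ tL) => k kL; have [->|kj] := eqVneq k j.
    by rewrite bx c0// bary_vert// eqxx add0r subr0 mulr1 ltW.
  have ke : k \in e by rewrite /e E !inE kj.
  by rewrite bx (bc L)// bary_vert// (negbTE kj) sub0r mulrN subr_ge0 ler_piMl ?invr_ge0.
have : hull (K :&: L)%SET x by rewrite -(hull_cap M_tri).
move=> /(hull_sub_bary tL (subsetIr K L))[_ /(_ j jL)].
rewrite !inE (negbTE jK) => /(_ isT); rewrite bx c0// bary_vert// eqxx add0r subr0 mulr1.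
by move=> t00; rewrite t00 ltxx in t0.
Qed.

Lemma onormal_neighbour K L i j : K \in cells M -> L \in cells M -> K != L ->
  i \in K -> j \in L -> opp K i = opp L j -> onormal L j = - onormal K i.
Proof.
move=> KM LM KL iK jL E; have := neighbour_opposite KM LM KL iK jL E.
have hK := height_neq0 (cell_tet KM) iK; have hL := height_neq0 (cell_tet LM) jL.
rewrite /bary {1 2}E -/(height L j) /onormal E => hlt.
rewrite -scaleNr; congr (_ *: _); move: hlt hK hL.
move: (height K i) (height L j) => a b hlt a0 b0.
have : Num.sg (b / a) = -1 by rewrite ltr0_sg.
rewrite sgrM sgrV; case: (sgrP a) a0 => // _ _; rewrite ?mulr1 ?mulrN1 ?opprK => h; by lra.
Qed.

(** The sum has a single term, for the vertex of K opposite to e. *)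
Definition fnormal K e : rV3 := \sum_(i in K :\: e) onormal K i.

Lemma fnormal_opp K i : i \in K -> fnormal K (opp K i) = onormal K i.
Proof.
move=> iK; rewrite /fnormal (_ : K :\: opp K i = [set i])%SET ?big_set1//.
by apply/setP => k; rewrite !inE; case: eqP => [->|_]; rewrite ?iK//= andNb.
Qed.

Lemma facet_opp K e : #|K| = 4%N -> #|e| = 3%N -> e \subset K ->
  exists2 i, i \in K & e = opp K i.
Proof.
move=> cK ce eK; have : #|K :\: e| = 1%N.
  by have := cardsID e K; rewrite (finset.setIidPr eK) ce cK => -[].
move=> /eqP/cards1P[i hi]; have : i \in (K :\: e) by rewrite hi !inE.
rewrite inE => /andP[ie iK]; exists i => //.
apply/setP => k; have := congr1 (fun s : {set _} => k \in s) hi; rewrite !inE => <-.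
by case: (boolP (k \in e)) => ke; rewrite /= ?andNb// (fintype.subsetP eK).
Qed.

Lemma opp_card K i : #|K| = 4%N -> i \in K -> #|opp K i| = 3%N.
Proof. by move=> cK iK; have := cardsD1 i K; rewrite iK cK => -[]. Qed.

Lemma sum_facets (V : nmodType) K (G : simplex -> rV3 -> V) : #|K| = 4%N ->
  \sum_(i in K) G (opp K i) (onormal K i)
  = \sum_(e : simplex | (#|e| == 3%N) && (e \subset K)) G e (fnormal K e).
Proof.
move=> cK; transitivity (\sum_(i in K) G (opp K i) (fnormal K (opp K i))).
  by apply: eq_bigr => i iK; rewrite fnormal_opp.
have inj : {in K &, injective (fun i => opp K i)}.
  move=> i j iK jK /setP/(_ i); rewrite !inE eqxx iK andbT /= => /esym/negbT.
  by rewrite andbT negbK => /eqP.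
rewrite -(big_imset (fun e => G e (fnormal K e)) inj) /=; apply: eq_bigl => e.
apply/imsetP/andP => [[i iK ->]|[/eqP ce eK]].
  by rewrite opp_card//; split=> //; exact: subD1set.
by have [i iK ->] := facet_opp cK ce eK; exists i.
Qed.

Lemma sum_faces (V : nmodType) (G : simplex -> simplex -> rV3 -> V) :
  \sum_(K in cells M) \sum_(i in K) G K (opp K i) (onormal K i)
  = \sum_(e : simplex | #|e| == 3%N) \sum_(K in adj e) G K e (fnormal K e).
Proof.
transitivity (\sum_(K in cells M)
    \sum_(e : simplex | (#|e| == 3%N) && (e \subset K)) G K e (fnormal K e)).
  by apply: eq_bigr => K KM; rewrite (sum_facets (G K))//; case: (cell_tet KM).
rewrite (exchange_big_dep (fun e : simplex => #|e| == 3%N)) /=; last first.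
  by move=> K e _ /andP[].
by apply: eq_bigr => e ce; apply: eq_bigl => K; rewrite inE ce.
Qed.

Lemma fnormal_neighbour K L e : #|e| = 3%N -> K \in adj e -> L \in adj e -> K != L ->
  fnormal L e = - fnormal K e.
Proof.
move=> ce; rewrite !inE => /andP[KM eK] /andP[LM eL] KL.
have [i iK eKi] := facet_opp (cell_tet KM).1 ce eK.
have [j jL eLj] := facet_opp (cell_tet LM).1 ce eL.
have -> : fnormal L e = onormal L j by rewrite eLj fnormal_opp.
have -> : fnormal K e = onormal K i by rewrite eKi fnormal_opp.
by apply: (onormal_neighbour KM LM KL iK jL); rewrite -eKi.
Qed.

Lemma onormal_neq0 K i : tetrahedron K -> i \in K -> onormal K i != 0.
Proof.
move=> tK iK; have h0 := height_neq0 tK iK; rewrite /onormal.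
rewrite scaler_eq0 oppr_eq0 sgr_eq0 (negbTE h0) /=; apply: contra_neq h0 => N0.
by rewrite /height N0 -(scale0r 0) dotZl mul0r.
Qed.

Lemma fnormal_neq0 K e : #|e| = 3%N -> K \in adj e -> fnormal K e != 0.
Proof.
move=> ce; rewrite inE => /andP[KM eK]; have tK := cell_tet KM.
by have [i iK ->] := facet_opp tK.1 ce eK; rewrite fnormal_opp// onormal_neq0.
Qed.

(** The outward normals of three cells around a face would be pairwise opposite. *)
Lemma adj_card e : #|e| = 3%N -> (#|adj e| <= 2)%N.
Proof.
move=> ce; rewrite leqNgt; apply/negP; rewrite cardE.
have := enum_uniq (adj e); have := mem_enum (adj e).
case: (enum (adj e)) => [|K [|L [|N s]]] //= h; rewrite !inE !negb_or.
move=> /andP[/and3P[KL KN _] /andP[/andP[LN _] _]] _.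
have [hK hL hN] : [/\ K \in adj e, L \in adj e & N \in adj e].
  by rewrite -!h !inE !eqxx ?orbT.
have := fnormal_neighbour ce hL hN LN; rewrite (fnormal_neighbour ce hK hL KL).
rewrite (fnormal_neighbour ce hK hN KN) opprK => /esym E.
have := fnormal_neq0 ce hK; have : fnormal K e *+ 2 = 0 by rewrite mulr2n {1}E addNr.
by move=> /eqP; rewrite -scaler_nat scaler_eq0 pnatr_eq0 /= => ->.
Qed.

(** Membership of the relative interior of e. *)
Definition face_point e x := exists c : 'I_(nvert M) -> R,
  [/\ forall k, 0 <= c k, forall k, k \in e -> 0 < c k, \sum_(k in e) c k = 1
    & x = \sum_(k in e) c k *: v k].

Lemma face_point_hull e x : face_point e x -> hull e x.
Proof. by move=> [c [c0 _ c1 ->]]; exists c. Qed.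

(** In every cell around it, the point has positive coordinates exactly at the vertices
    of e. *)
Lemma face_point_sub K L e e' x : K \in adj e -> L \in cells M -> e' \subset L ->
  face_point e x -> hull e' x -> e \subset e'.
Proof.
rewrite inE => /andP[KM eK] LM eL xe xe'; have tK := cell_tet KM; have tL := cell_tet LM.
have [xL z] := hull_sub_bary tL eL xe'.
have [xK zK] := hull_sub_bary tK eK (face_point_hull xe).
have xKL : hull (K :&: L)%SET x by rewrite -(hull_cap M_tri).
have [c [c0 cp c1 xE]] := xe.
have bx N k : tetrahedron N -> e \subset N -> k \in e -> bary N k x = c k.
  by move=> tN eN ke; rewrite xE bary_face.
have eL' : e \subset L.
  apply/fintype.subsetP => k ke; apply: contraT => kL.
  have [_ h] := hull_sub_bary tK (subsetIl K L) xKL.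
  have := cp k ke; rewrite -(bx K k tK eK ke) h ?ltxx//; first exact: (fintype.subsetP eK).
  by rewrite inE (negbTE kL) andbF.
apply/fintype.subsetP => k ke; apply: contraT => ke'.
have := cp k ke; rewrite -(bx L k tL eL' ke) z ?ltxx//.
exact: (fintype.subsetP eL').
Qed.

End Adjacency.

(** * Divergence theorem on a cell, with traces *)

Section CellGreen.
Variable R : realType.
Variable M : mesh R.
Notation rV3 := 'rV[R]_3.
Notation simplex := {set 'I_(nvert M)}.
Notation v := (@vert R M).
Notation opp K i := (K :\ i)%SET.
Notation tri := (@ref_triangle R).
Implicit Types (K L e : simplex) (x y : rV3) (f g q : rV3 -> R) (u : rV3 -> rV3).

Lemma face_param_combination e t : #|e| = 3%N -> exists c : 'I_(nvert M) -> R,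
  [/\ forall (Q : R -> Prop), Q t.1 -> Q t.2 -> Q (1 - t.1 - t.2) -> forall a, Q (c a),
      \sum_(a in e) c a = 1 & face_param e t = \sum_(a in e) c a *: v a].
Proof.
move=> ce; have [i [j [k [ee u m]]]] := enum_labels3 ce.
have [e0 e1 e2] := vertex_enum3 ee; rewrite /face_param e0 e1 e2.
have s (V : nmodType) (F : 'I_(nvert M) -> V) : \sum_(a in e) F a = F i + F j + F k.
  transitivity (\sum_(a <- [:: i; j; k]) F a); first by rewrite [RHS]big_uniq//; apply: eq_bigl.
  by rewrite !big_cons big_nil addr0 !addrA.
move: u; rewrite /= !inE !negb_or !andbT => /andP[/andP[ij ik] jk].
pose c a := if a == i then 1 - t.1 - t.2 else if a == j then t.1 else t.2.
have ci : c i = 1 - t.1 - t.2 by rewrite /c eqxx.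
have cj : c j = t.1 by rewrite /c eqxx eq_sym (negbTE ij).
have ck : c k = t.2 by rewrite /c !(eq_sym k) (negbTE ik) (negbTE jk).
exists c; rewrite !s ci cj ck; split.
- by move=> Q q1 q2 q3 a; rewrite /c; do 2 (case: ifP => _ //).
- by ring.
- by apply: row3P; rewrite !mxE; ring.
Qed.

Lemma hull_face_param e t : #|e| = 3%N -> tri t -> hull e (face_param e t).
Proof.
move=> ce [t1 t2 t3]; have [c [cP c1 ->]] := face_param_combination t ce.
by exists c; split=> //; apply: (cP (fun z => 0 <= z)) => //; lra.
Qed.

Definition fint e f := (leb2 R).-integrable tri (fun t => (f (face_param e t))%:E).

Lemma fint_continuous e f : continuous f -> fint e f.
Proof. exact: face_integrable. Qed.

Lemma eq_face_avg e f g : #|e| = 3%N -> (forall x, hull e x -> f x = g x) ->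
  face_avg e f = face_avg e g.
Proof.
move=> ce h; apply: eq_Rintegral => t /set_mem ht; apply: h; exact: hull_face_param.
Qed.

Lemma face_avgD e f g : fint e f -> fint e g ->
  face_avg e (fun x => f x + g x) = face_avg e f + face_avg e g.
Proof. by move=> hf hg; apply: RintegralD => //; exact: measurable_ref_triangle. Qed.

Lemma face_avgZ e c f : fint e f -> face_avg e (fun x => c * f x) = c * face_avg e f.
Proof. by move=> hf; apply: RintegralZl => //; exact: measurable_ref_triangle. Qed.

Lemma face_avg0 e : face_avg e (fun=> 0) = 0.
Proof. by rewrite /face_avg /tri_int Rintegral_cst ?mul0r//; exact: measurable_ref_triangle. Qed.

Lemma fintD e f g : fint e f -> fint e g -> fint e (fun x => f x + g x).
Proof.
move=> hf hg; have mt : measurable (tri : set (R * R)) by exact: measurable_ref_triangle.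
have := integrableD (mu := leb2 R) mt hf hg.
by apply: eq_integrable => //; exact: measurable_ref_triangle.
Qed.

Lemma fint_sum e I (r : seq I) (P : pred I) (F : I -> rV3 -> R) :
  (forall i, P i -> fint e (F i)) -> fint e (fun x => \sum_(i <- r | P i) F i x).
Proof.
move=> hF; elim: r => [|i r IH].
  by under eq_fun do rewrite big_nil; apply: fint_continuous; exact: continuous_cst.
under eq_fun do rewrite big_cons; case: (boolP (P i)) => // Pi.
by apply: fintD => //; exact: hF.
Qed.

Lemma face_avg_sum e I (r : seq I) (P : pred I) (F : I -> rV3 -> R) :
  (forall i, P i -> fint e (F i)) ->
  face_avg e (fun x => \sum_(i <- r | P i) F i x) = \sum_(i <- r | P i) face_avg e (F i).
Proof.
move=> hF; elim: r => [|i r IH].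
  by rewrite big_nil -[RHS](face_avg0 e); congr face_avg; apply/funext => x; rewrite big_nil.
rewrite big_cons; case: ifP => Pi; last first.
  by rewrite -IH; congr face_avg; apply/funext => x; rewrite big_cons Pi.
rewrite -IH -face_avgD; [|exact: hF|exact: fint_sum].
by congr face_avg; apply/funext => x; rewrite big_cons Pi.
Qed.

Lemma continuous_row (P : 'I_3 -> rV3 -> R) : (forall i, continuous (P i)) ->
  continuous (fun x : rV3 => \row_i P i x : rV3).
Proof.
move=> cP x A /nbhs_ballP[e /= e0 he].
have h i : \forall y \near x, `|P i x - P i y| < e.
  by have /cvgrPdist_lt/(_ e e0) := cP i x.
have : \forall y \near x, forall i, `|P i x - P i y| < e.
  by apply: (@filter_forall rV3 'I_3 (fun i y => `|P i x - P i y| < e) (nbhs x)).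
apply: filterS => y hy; apply: he; apply/(ball_rowP _ _ e0) => i; rewrite !mxE; exact: hy.
Qed.

Lemma continuous_dot (P : 'I_3 -> rV3 -> R) n : (forall i, continuous (P i)) ->
  continuous (fun x : rV3 => dot (\row_i P i x) n).
Proof.
move=> cP; rewrite /dot; apply: continuous_sum => i _.
apply: (@eq_continuous_fun _ _ (fun x => P i x * n 0 i)) => [x|]; first by rewrite mxE.
by apply: continuous_mul => //; exact: continuous_cst.
Qed.

Lemma pd_cell K f g i x : cell_int K x -> (forall y, cell_int K y -> f y = g y) ->
  pd i f x = pd i g x.
Proof.
move=> Kx fg; apply: near_eq_derive.
have : nbhs x (cell_int K) by exact: open_nbhs_nbhs (conj (@open_interior _ _) Kx).
by apply: filterS.
Qed.

Definition dvg u x := \sum_(i < 3) pd i (fun y => u y 0 i) x.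

Lemma cell_green_aux K (P : 'I_3 -> rV3 -> R) q : tetrahedron K ->
  (forall i, C1 (P i)) -> C1 q ->
  vol_int (cell_int K) (fun x => \sum_i (P i x * pd i q x + q x * pd i (P i) x))
  = \sum_(i in K) face_avg (opp K i) (fun x => dot (\row_j P j x) (onormal K i) * q x).
Proof.
move=> tK C1P C1q; have mh := hull_mset tK; have bh := hull_bounded tK.
have C1Pq i : C1 (fun x => P i x * q x) by exact: C1M.
have pdPq i x : pd i (fun y => P i y * q y) x = P i x * pd i q x + q x * pd i (P i) x.
  by apply: pdM; [case: (C1P i)|case: C1q].
have ci i : int3 (hull K) (pd i (fun y => P i y * q y)).
  by apply: continuous_int3 => //; case: (C1Pq i).
transitivity (vol_int (hull K) (fun x => \sum_(i <- index_enum 'I_3) pd i (fun y => P i y * q y) x)).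
  rewrite vol_int_hull//; last by apply: int3_sum.
  by apply: eq_vol_int => x _; apply: eq_bigr => i _; rewrite pdPq.
rewrite vol_int_sum//.
under eq_bigr => i _ do rewrite (int_hull_derive _ tK (C1Pq i)).
rewrite exchange_big /=; apply: eq_bigr => i iK.
have cPq j : continuous (fun x => P j x * q x) by exact: C1_continuous.
transitivity (\sum_j face_avg (opp K i) (fun x => onormal K i 0 j * (P j x * q x))).
  apply: eq_bigr => j _; rewrite face_avgZ ?dot_delta//; exact: fint_continuous.
rewrite -face_avg_sum; last first.
  by move=> j _; apply: fint_continuous; apply: continuous_mul => //; exact: continuous_cst.
congr face_avg; apply/funext => x; rewrite /dot mulr_suml; apply: eq_bigr => j _.
by rewrite !mxE; ring.
Qed.

(** The divergence theorem for the product of smooth extensions of g and u, which on the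
    faces are the traces. *)
Lemma cell_green K (P : 'I_3 -> rV3 -> R) u q g : tetrahedron K ->
  (forall i, C1 (P i)) -> C1 q ->
  (forall x, cell_int K x -> u x = \row_j P j x) ->
  (forall x, cell_int K x -> g x = q x) ->
  vol_int (cell_int K) (fun x => dot (u x) (grad g x) + dvg u x * g x)
  = \sum_(i in K) face_avg (opp K i) (fun x => dot (trace K u x) (onormal K i) * trace K (g : _ -> R^o) x).
Proof.
move=> tK C1P C1q uP gq; have [cK _] := tK.
transitivity (vol_int (cell_int K) (fun x => \sum_i (P i x * pd i q x + q x * pd i (P i) x))).
  apply: eq_vol_int => x Kx; rewrite /dot /dvg mulr_suml -big_split; apply: eq_bigr => i _ /=.
  rewrite uP// !mxE (pd_cell i Kx gq) (@pd_cell K (fun y => u y 0 i) (P i) i x Kx) ?gq 1?[q x * _]mulrC//.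
  by move=> y Ky; rewrite uP// mxE.
rewrite cell_green_aux//; apply: eq_bigr => i iK; apply: eq_face_avg; first exact: opp_card.
move=> x hx; have [hK _] := hull_sub_bary tK (subD1set K i) hx.
rewrite (trace_eq tK hK uP); last by apply: continuous_row => j; exact: C1_continuous.
by rewrite (@trace_eq _ _ (R^o : normedModType R) K g q x tK hK gq)//; exact: C1_continuous.
Qed.

End CellGreen.

(** * Test functions supported in a cell *)

Section Cutoff.
Variable R : realType.
Notation rV3 := 'rV[R]_3.
Notation leb := (leb3 R).
Implicit Types (D : set rV3) (f g q : rV3 -> R).

Lemma vol_int_dct D (F : nat -> rV3 -> R) f g : mset3 D -> int3 D g ->
  (forall n, mfun3 D (F n)) -> mfun3 D f ->
  (forall n x, D x -> `|F n x| <= g x) -> ae_on D (fun x => F ^~ x @ \oo --> f x) ->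
  vol_int D (F n) @[n --> \oo] --> vol_int D f.
Proof.
move=> mD ig mF mf hg hF.
have mEF n : measurable_fun (@vec3 R @^-1` D) (fun p => (F n (vec3 p))%:E).
  by apply/measurable_EFinP; exact: mF.
have mEf : measurable_fun (@vec3 R @^-1` D) (fun p => (f (vec3 p))%:E).
  by apply/measurable_EFinP; exact: mf.
have cvp : {ae leb, forall p, (@vec3 R @^-1` D) p ->
    (fun n => (F n (vec3 p))%:E) @ \oo --> (f (vec3 p))%:E}.
  move: hF => [N [mN N0 hN]]; exists N; split=> // p /= hp; apply: hN => /= h; apply: hp => Dp.
  by apply: cvg_EFin; [near=> n|exact: h].
have dom : {ae leb, forall p n, (@vec3 R @^-1` D) p ->
    (`|(F n (vec3 p))%:E| <= (g (vec3 p))%:E)%E}.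
  by apply: aeW => p n Dp; rewrite lee_fin; exact: hg.
have [If _ cv] := @dominated_convergence _ _ R leb (@vec3 R @^-1` D) mD _ _ _ mEF mEf cvp ig dom.
apply: fine_cvg; rewrite fineK; first exact: cv.
exact: integrable_fin_num.
Unshelve. all: by end_near. Qed.

(** A uniform remainder bound treats the kink of a truncated square like any other
    point. *)
Lemma is_derive_quadratic (f g : R -> R) C t :
  (forall h, `|f (t + h) - f t - g t * h| <= C * h ^+ 2) -> is_derive t 1 f (g t).
Proof.
move=> H.
have cv : (h^-1 *: ((f \o shift t) (h *: (1 : R)) - f t)) @[h --> 0^'] --> g t.
  apply/cvgrPdist_lt => e e0.
  near=> h; have h0 : h != 0 by near: h; exact: nbhs_dnbhs_neq.
  have hC : `|h| * (`|C| + 1) < e.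
    rewrite -ltr_pdivlMr ?ltr_wpDl//; near: h; apply: dnbhs0_lt.
    by rewrite divr_gt0// ltr_wpDl.
  have -> : g t - h^-1 *: ((f \o shift t) (h *: (1 : R)) - f t) =
      - h^-1 * (f (t + h) - f t - g t * h).
    rewrite /= /shift /= [h *: _]mulr1 [h + t]addrC /GRing.scale /=.
    by field.
  rewrite normrM normrN normfV; apply: le_lt_trans hC.
  rewrite ler_pdivrMl ?normr_gt0//; apply: le_trans (H h) _.
  have -> : `|h| * (`|h| * (`|C| + 1)) = (`|C| + 1) * h ^+ 2.
    by rewrite -[in RHS]real_normK ?num_real//; ring.
  rewrite ler_wpM2r ?sqr_ge0//; have := ler_norm C; lra.
by apply: DeriveDef; [apply: cvgP cv|apply: cvg_lim cv].
Unshelve. all: by end_near. Qed.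

Definition pos2 (t : R) : R := Num.max t 0 ^+ 2.

Lemma pos2_derive (t : R) : is_derive t 1 pos2 (2 * Num.max t 0).
Proof.
apply: (@is_derive_quadratic pos2 (fun t => 2 * Num.max t 0) 1 t) => h.
rewrite /pos2 mul1r ler_norml; case: (leP t 0); case: (leP (t + h) 0) => *; nra.
Qed.

Lemma pos2_derive1 : pos2^`()%classic = (fun t => 2 * Num.max t 0).
Proof. by apply/funext => t; rewrite derive1E; have [_ ->] := pos2_derive t. Qed.

Lemma C1_pos2 f : C1 f -> C1 (fun x => pos2 (f x)).
Proof.
apply: C1_comp => [t|]; first by have [] := pos2_derive t.
rewrite pos2_derive1; apply: continuous_mul; first exact: continuous_cst.
by move=> t; apply: continuous_max; [exact: cvg_id|exact: cvg_cst].
Qed.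

Lemma pd_pos2 f i x : C1 f -> pd i (fun y => pos2 (f y)) x = 2 * Num.max (f x) 0 * pd i f x.
Proof.
move=> [df _]; rewrite pd_comp ?pos2_derive1//; by have [] := pos2_derive (f x).
Qed.

Lemma pos2_le0 (t : R) : t <= 0 -> pos2 t = 0.
Proof. by move=> t0; rewrite /pos2 max_r// expr0n. Qed.

(** A C1 step from 0 to 1, as a composition of truncated squares. *)
Definition step (t : R) : R := 1 - pos2 (1 - pos2 t).

Lemma step_le0 t : t <= 0 -> step t = 0.
Proof. by move=> t0; rewrite /step (pos2_le0 t0) subr0 /pos2 max_l ?expr1n ?subrr// ler01. Qed.

Lemma step_ge1 t : 1 <= t -> step t = 1.
Proof.
move=> t1; rewrite /step [pos2 (1 - _)]pos2_le0 ?subr0// subr_le0 /pos2 max_l ?(le_trans ler01)//.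
by rewrite exprn_ege1.
Qed.

Lemma step_norm t : `|step t| <= 1.
Proof.
have p0 s : 0 <= pos2 s by rewrite sqr_ge0.
have : pos2 (1 - pos2 t) <= 1.
  have := p0 t; move: (pos2 t) => a a0; rewrite /pos2; case: (leP (1 - a) 0) => ?; nra.
have := p0 (1 - pos2 t); rewrite /step; move: (pos2 _) => a *.
by rewrite ler_norml; apply/andP; split; lra.
Qed.

Lemma C1_step f : C1 f -> C1 (fun x => step (f x)).
Proof.
move=> f1; apply: C1B; first exact: C1_cst.
by apply: C1_pos2; apply: C1B; [exact: C1_cst|exact: C1_pos2].
Qed.

Variable M : mesh R.
Implicit Types K : {set 'I_(nvert M)}.

(** Vanishes near the boundary of K, and tends to q inside K as n grows. *)
Definition cutoff K (n : nat) q x := q x * \prod_(i in K) step (n%:R * bary K i x - 1).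

Lemma cutoff_C1 K n q : C1 q -> C1 (cutoff K n q).
Proof.
move=> q1; apply: C1M => //; apply: C1_prod => i _; apply: C1_step.
by apply: C1B; [apply: C1Z; exact: bary_C1|exact: C1_cst].
Qed.

Lemma cutoff_test K n q : tetrahedron K -> (0 < n)%N -> C1 q -> test (cell_int K) (cutoff K n q).
Proof.
move=> tK n0 q1; have n0R : 0 < n%:R :> R by rewrite ltr0n.
pose C := \bigcap_(i in [set i | i \in K]) (bary K i @^-1` [set t | n%:R^-1 <= t]).
have cC : closed C.
  apply: closed_bigI => i iK; apply: closed_comp => [x _|]; first exact: bary_continuous.
  exact: closed_ge.
have CK : C `<=` cell_int K.
  move=> x Cx; apply/(cell_intP _ tK) => i iK; apply: lt_le_trans (Cx i iK).
  by rewrite invr_gt0.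
have sC : closure [set x | cutoff K n q x != 0] `<=` C.
  rewrite [X in _ `<=` X](closure_id C).1//; apply: closure_subset => x /= h i /= iK.
  rewrite leNgt; apply: contra h => h; rewrite /cutoff (bigD1 i)//= step_le0 ?mul0r ?mulr0//.
  by rewrite subr_le0 mulrC -ler_pdivlMr// mul1r ltW.
split; first exact: cutoff_C1.
- apply: bounded_closed_compact; last exact: closed_closure.
  apply: (@bounded_setS _ _ (hull K)); last exact: hull_bounded.
  by move=> x /sC/CK; exact: cell_int_hull.
- by move=> x /sC/CK.
Qed.

Lemma cutoff_le K n q x : `|cutoff K n q x| <= `|q x|.
Proof.
rewrite /cutoff normrM -[leRHS]mulr1 ler_wpM2l// normr_prod.
have : 0 <= \prod_(i in K) `|step (n%:R * bary K i x - 1)| <= 1.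
  apply: (big_ind (fun z : R => 0 <= z <= 1)); first by rewrite ler01 lexx.
  - move=> a b /andP[a0 a1] /andP[b0 b1]; rewrite mulr_ge0//=.
    by rewrite -[leRHS]mul1r ler_pM.
  - by move=> i _; rewrite normr_ge0 step_norm.
by case/andP.
Qed.

Lemma cutoff_cvg K q x : tetrahedron K -> cell_int K x ->
  (fun n => cutoff K n.+1 q x) @ \oo --> q x.
Proof.
move=> tK /(cell_intP _ tK) Kx.
suff H : \forall n \near \oo, forall i, i \in K -> 2 <= n.+1%:R * bary K i x.
  apply: (@cvg_trans _ ((fun=> q x) @ \oo)); last exact: cvg_cst.
  apply: near_eq_cvg; apply: filterS H => n hn.
  rewrite /cutoff big1 ?mulr1// => i iK; apply: step_ge1.
  by have := hn i iK; lra.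
have P i : i \in K -> \forall n \near \oo, 2 <= n.+1%:R * bary K i x.
  move=> iK; have b0 := Kx i iK.
  exists (Num.truncn (2 / bary K i x)) => // n /= hn.
  rewrite -ler_pdivrMr//; apply: le_trans (ltW (truncnS_gt _)) _.
  by rewrite ler_nat ltnS.
have : \forall n \near \oo, forall i, (i \in K) ==> (2 <= n.+1%:R * bary K i x).
  apply: (@filter_forall nat 'I_(nvert M) (fun i n => (i \in K) ==> (2 <= n.+1%:R * bary K i x)) \oo) => i.
  case iK: (i \in K); last by near=> n.
  by apply: filterS (P i iK) => n.
by apply: filterS => n h i iK; have := h i; rewrite iK.
Unshelve. all: by end_near. Qed.

(** Dominated convergence along the cutoffs of q. *)
Lemma cutoff_dense K g : tetrahedron K -> int3 (cell_int K) g ->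
  (forall phi, test (cell_int K) phi -> vol_int (cell_int K) (fun x => g x * phi x) = 0) ->
  forall q, C1 q -> vol_int (cell_int K) (fun x => g x * q x) = 0.
Proof.
move=> tK ig h q q1; have mK := cell_int_mset K.
have bK : bounded_set (cell_int K) by apply: bounded_setS (hull_bounded tK); exact: cell_int_hull.
have [B B0 hB] := continuous_bounded bK (C1_continuous q1).
have mg := int3_mfun3 ig.
have : vol_int (cell_int K) (fun x => g x * cutoff K n.+1 q x) @[n --> \oo]
    --> vol_int (cell_int K) (fun x => g x * q x).
  apply: (@vol_int_dct _ _ _ (fun x => `|g x * B|)) => //.
  - have := int3Z B mK ig; rewrite /int3 => /integrable_abse.
    by apply: eq_integrable => // p _; rewrite /= mulrC.
  - move=> n; apply: mfun3M => //; apply: mfun3_continuous.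
    by apply: C1_continuous; exact: cutoff_C1.
  - by apply: mfun3M => //; apply: mfun3_continuous; exact: C1_continuous.
  - move=> n x Kx; rewrite normrM [leRHS]normrM ler_wpM2l// (ger0_norm B0).
    by apply: le_trans (cutoff_le _ _ _ _) (hB _ Kx).
  - by apply: ae_onW => x Kx; apply: cvgM; [exact: cvg_cst|exact: cutoff_cvg].
rewrite (_ : (fun n => _) = (fun=> 0)); last first.
  by apply/funext => n; rewrite h//; exact: cutoff_test.
by move=> /cvg_lim <-//; rewrite lim_cst.
Qed.

End Cutoff.

(** * Weak and classical divergences *)

Section PiecewisePolynomials.
Variable R : realType.
Variable M : mesh R.
Variable Omega : set 'rV[R]_3.
Hypothesis M_tri : triangulation M Omega.
Hypothesis Omega_dom : bounded_domain Omega.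
Notation rV3 := 'rV[R]_3.
Notation simplex := {set 'I_(nvert M)}.
Notation v := (@vert R M).
Notation opp K i := (K :\ i)%SET.
Implicit Types (K L e : simplex) (x y : rV3) (f g q phi : rV3 -> R) (u : rV3 -> rV3).

Let cell_tet K : K \in cells M -> tetrahedron K := @cell_tetrahedron R M Omega M_tri K.
Let mO : mset3 Omega := Omega_mset Omega_dom.

Definition pw_polyv k u := forall K, K \in cells M -> exists2 P : 'I_3 -> mpoly.mpoly 3 R,
  forall i, deg_le k (P i) & forall x, cell_int K x -> u x = mpoly_evalv P x.

(** The value 0 on the skeleton makes classical piecewise derivatives measurable. *)
Definition on_cells f x := \sum_(K in cells M) (f \_ (cell_int K)) x.

Lemma on_cellsE K f x : K \in cells M -> cell_int K x -> on_cells f x = f x.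
Proof. by move=> KM Kx; apply: (sum_cells_patch M_tri); exists K. Qed.

Lemma on_cells_cwc f : (forall K, K \in cells M ->
    exists2 g, continuous g & forall x, cell_int K x -> f x = g x) ->
  cellwise_continuous M Omega (on_cells f).
Proof.
move=> h; split=> [|K KM]; last first.
  by have [g cg fg] := h K KM; exists g => // x Kx; rewrite (on_cellsE _ KM Kx) fg.
apply: (mfun3_cells M_tri) => [K KM|x hx]; last first.
  rewrite /on_cells big1// => K KM; rewrite patchE memNset// => Kx.
  by apply: hx; exists K.
have [g cg fg] := h K KM; have := @mfun3_continuous _ (cell_int K) g cg.
apply: eq_measurable_fun => p /set_mem Kp /=.
by rewrite (on_cellsE _ KM Kp) fg.
Qed.

Lemma pw_poly_cwc k f : mfun3 Omega f -> pw_poly M k f -> cellwise_continuous M Omega f.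
Proof.
move=> mf h; split=> // K /h[P _ fP]; exists (mpoly_eval P) => //.
exact: C1_continuous (mpoly_eval_C1 P).
Qed.

Lemma mpoly_evalvE (P : 'I_3 -> mpoly.mpoly 3 R) x i : mpoly_evalv P x 0 i = mpoly_eval (P i) x.
Proof. by rewrite mxE. Qed.

Lemma pw_polyv_cwc k u i : L2v Omega u -> pw_polyv k u ->
  cellwise_continuous M Omega (fun x => u x 0 i).
Proof.
move=> hu h; apply: (@pw_poly_cwc k); first by case: (hu i).
by move=> K /h[P dP uP]; exists (P i) => // x Kx; rewrite uP// mpoly_evalvE.
Qed.

Definition pw_div u := on_cells (dvg u).

Lemma dvg_cell K (P : 'I_3 -> mpoly.mpoly 3 R) u x : cell_int K x ->
  (forall y, cell_int K y -> u y = mpoly_evalv P y) ->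
  dvg u x = mpoly_eval (\sum_i mpoly.mderiv i (P i)) x.
Proof.
move=> Kx uP; have e0 : mpoly_eval (0 : mpoly.mpoly 3 R) x = 0.
  by rewrite -(scale0r (0 : mpoly.mpoly 3 R)) mpoly_evalZ mul0r.
rewrite [RHS](big_morph (fun Q => mpoly_eval Q x) (fun P Q => mpoly_evalD P Q x) e0).
apply: eq_bigr => i _; rewrite -pd_mpoly_eval; apply: (pd_cell _ Kx) => y Ky.
by rewrite uP// mpoly_evalvE.
Qed.

Lemma pw_poly_div k u : pw_polyv k.+1 u -> pw_poly M k (pw_div u).
Proof.
move=> h K KM; have [P dP uP] := h K KM.
exists (\sum_i mpoly.mderiv i (P i)); first by apply: deg_le_sum => i; exact: deg_le_deriv.
by move=> x Kx; rewrite /pw_div (on_cellsE _ KM Kx) (dvg_cell Kx uP).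
Qed.

Lemma pw_div_cwc k u : pw_polyv k u -> cellwise_continuous M Omega (pw_div u).
Proof.
move=> h; apply: on_cells_cwc => K KM; have [P dP uP] := h K KM.
exists (mpoly_eval (\sum_i mpoly.mderiv i (P i))); first exact: C1_continuous (mpoly_eval_C1 _).
by move=> x Kx; rewrite (dvg_cell Kx uP).
Qed.

Lemma ipv_grad_cwc k u phi : L2v Omega u -> pw_polyv k u -> C1 phi ->
  cellwise_continuous M Omega (fun x => dot (u x) (grad phi x)).
Proof.
move=> hu hp [_ phi1]; apply: cwc_sum => i; apply: cwcM; first exact: pw_polyv_cwc hp.
by apply: cwc_continuous; apply: eq_continuous_fun (phi1 i) => x; rewrite mxE.
Qed.

Lemma cell_green_poly k K u phi : K \in cells M -> pw_polyv k u -> C1 phi ->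
  vol_int (cell_int K) (fun x => dot (u x) (grad phi x) + dvg u x * phi x)
  = \sum_(i in K) face_avg (opp K i) (fun x => dot (trace K u x) (onormal K i) * phi x).
Proof.
move=> KM h phi1; have [P dP uP] := h K KM; have tK := cell_tet KM.
rewrite (cell_green (P := fun i => mpoly_eval (P i)) (q := phi) tK)//.
- apply: eq_bigr => i iK; apply: eq_face_avg; first by apply: opp_card => //; case: tK.
  move=> x hx; have [hK _] := hull_sub_bary tK (subD1set K i) hx.
  by rewrite (@trace_eq _ _ (R^o : normedModType R) K phi phi x tK hK)//; exact: C1_continuous.
- by move=> i; exact: mpoly_eval_C1.
Qed.

(** The jump of the normal component on an interior face, the normal trace on a boundary
    face. *)
Definition fjump e u x := \sum_(K in adj e) dot (trace K u x) (fnormal K e).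

Lemma trace_poly k K e u n : K \in adj e -> pw_polyv k u ->
  exists2 G, continuous G & forall x, hull e x -> dot (trace K u x) n = G x.
Proof.
rewrite inE => /andP[KM eK] h; have [P dP uP] := h K KM; have tK := cell_tet KM.
have cP i : continuous (mpoly_eval (P i)) by exact: C1_continuous (mpoly_eval_C1 _).
exists (fun x => dot (mpoly_evalv P x) n); first exact: continuous_dot.
move=> x hx; have [hK _] := hull_sub_bary tK eK hx.
by rewrite (trace_eq tK hK uP)//; exact: continuous_row.
Qed.

Lemma eq_fint e f g : #|e| = 3%N -> (forall x, hull e x -> f x = g x) -> fint e f -> fint e g.
Proof.
move=> ce h; apply: eq_integrable; first exact: measurable_ref_triangle.
by move=> t /set_mem ht; rewrite h//; exact: hull_face_param.
Qed.

Lemma fjump_continuous k e u : pw_polyv k u ->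
  exists2 G, continuous G & forall x, hull e x -> fjump e u x = G x.
Proof.
move=> h.
have H K : exists G : rV3 -> R, continuous G /\ (K \in adj e -> forall x, hull e x ->
    dot (trace K u x) (fnormal K e) = G x).
  case: (boolP (K \in adj e)) => Ke; last by exists (fun=> 0); split=> //; exact: continuous_cst.
  by have [G cG hG] := trace_poly (fnormal K e) Ke h; exists G.
have [G hG] := choice H.
exists (fun x => \sum_(K in adj e) G K x).
  by apply: continuous_sum => K _; case: (hG K).
by move=> x hx; apply: eq_bigr => K Ke; apply: (hG K).2.
Qed.

(** Sum of the formulas on the cells, sorted by faces. *)
Lemma global_green k u phi : L2v Omega u -> pw_polyv k u -> C1 phi ->
  vol_int Omega (fun x => dot (u x) (grad phi x) + pw_div u x * phi x)
  = \sum_(e : simplex | #|e| == 3%N) face_avg e (fun x => fjump e u x * phi x).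
Proof.
move=> hu h phi1; have cphi := C1_continuous phi1.
rewrite (vol_int_cells M_tri Omega_dom); last first.
  apply: (cwc_int3 M_tri Omega_dom); apply: cwcD; first exact: ipv_grad_cwc h phi1.
  by apply: cwcM; [exact: pw_div_cwc h|exact: cwc_continuous].
transitivity (\sum_(K in cells M) \sum_(i in K)
    face_avg (opp K i) (fun x => dot (trace K u x) (onormal K i) * phi x)).
  apply: eq_bigr => K KM; rewrite -(cell_green_poly KM h phi1); apply: eq_vol_int => x Kx.
  by rewrite /pw_div (on_cellsE _ KM Kx).
rewrite (sum_faces M_tri (fun K e n => face_avg e (fun x => dot (trace K u x) n * phi x))).
apply: eq_bigr => e /eqP ce; rewrite -face_avg_sum; last first.
  move=> K Ke; have [G cG hG] := trace_poly (fnormal K e) Ke h.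
  apply: (@eq_fint e (fun x => G x * phi x)) => // [x hx|]; first by rewrite hG.
  by apply: fint_continuous; exact: continuous_mul.
by congr face_avg; apply/funext => x; rewrite mulr_suml.
Qed.

Lemma test_off D phi x : test D phi -> ~ D x -> phi x = 0 /\ forall i, pd i phi x = 0.
Proof.
move=> [_ _ sD] Dx; have nx : (~` closure [set x | phi x != 0]) x by move=> /sD.
have oC : open (~` closure [set x | phi x != 0]) by exact/closed_openC/closed_closure.
have E y : (~` closure [set x | phi x != 0]) y -> phi y = 0.
  by move=> hy; apply: contrapT => /eqP p0; apply: hy; exact: subset_closure.
split=> [|i]; first exact: E.
rewrite -(pd_cst 0 i x); apply: near_eq_derive.
have : nbhs x (~` closure [set x | phi x != 0]) by exact: open_nbhs_nbhs.
by apply: filterS => y /E.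
Qed.

Lemma testS D D' phi : D `<=` D' -> test D phi -> test D' phi.
Proof. by move=> DD [h1 h2 h3]; split=> //; exact: subset_trans DD. Qed.

Lemma vol_int_supp D C f : C `<=` D -> (forall x, D x -> ~ C x -> f x = 0) ->
  vol_int D f = vol_int C f.
Proof.
move=> CD h; rewrite -(vol_int_patch f CD); apply: eq_vol_int => x Dx; rewrite patchE.
by have [Cx|Cx] := pselect (C x); [rewrite mem_set|rewrite memNset// h].
Qed.

Lemma cell_green_test k K u phi : K \in cells M -> pw_polyv k u -> test (cell_int K) phi ->
  vol_int (cell_int K) (fun x => dot (u x) (grad phi x) + dvg u x * phi x) = 0.
Proof.
move=> KM h tphi; have [phi1 _ _] := tphi; have tK := cell_tet KM.
rewrite (cell_green_poly KM h phi1) big1// => i iK.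
rewrite -[RHS](face_avg0 (opp K i)); apply: eq_face_avg; first by apply: opp_card => //; case: tK.
move=> x hx; have [_ z] := hull_sub_bary tK (subD1set K i) hx.
have nK : ~ cell_int K x.
  by move=> /(cell_intP _ tK)/(_ i iK); rewrite z ?ltxx// !inE eqxx.
by have [-> _] := test_off tphi nK; rewrite mulr0.
Qed.

(** On test functions supported in K the weak divergence and the classical one satisfy
    the same formula. *)
Lemma weak_div_cell k K u d q : K \in cells M -> L2v Omega u -> pw_polyv k u ->
  weak_div Omega u d -> C1 q ->
  vol_int (cell_int K) (fun x => d x * q x) = vol_int (cell_int K) (fun x => pw_div u x * q x).
Proof.
move=> KM hu h [hd dw] q1; have tK := cell_tet KM; have mK := cell_int_mset K.
have KO := cell_int_Omega M_tri Omega_dom KM.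
have bO := Omega_bounded Omega_dom.
have id : int3 Omega d by exact: L2_int3.
have ip : int3 Omega (pw_div u) by apply: (cwc_int3 M_tri Omega_dom); exact: pw_div_cwc h.
have cq : cellwise_continuous M Omega q by apply: cwc_continuous; exact: C1_continuous.
have idq : int3 (cell_int K) (fun x => d x * q x).
  by apply: int3S KO _ => //; exact: (int3_cwcM M_tri Omega_dom).
have ipq : int3 (cell_int K) (fun x => pw_div u x * q x).
  by apply: int3S KO _ => //; exact: (int3_cwcM M_tri Omega_dom).
apply/eqP; rewrite -subr_eq0 -vol_intB//; apply/eqP.
rewrite -[RHS](@cutoff_dense _ _ K (fun x => d x - pw_div u x) tK _ _ q q1).
- by apply: eq_vol_int => x _; rewrite mulrBl.
- by apply: int3S KO _ => //; exact: int3B.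
move=> phi tphi; have [phi1 _ _] := tphi.
have cphi : cellwise_continuous M Omega phi by apply: cwc_continuous; exact: C1_continuous.
have tO := testS KO tphi.
have E1 : vol_int (cell_int K) (fun x => d x * phi x) = ips Omega d phi.
  by symmetry; apply: vol_int_supp => // x _ /(test_off tphi)[-> _]; rewrite mulr0.
have E2 : vol_int (cell_int K) (fun x => dot (u x) (grad phi x)) = ipv Omega u (grad phi).
  symmetry; apply: vol_int_supp => // x _ /(test_off tphi)[_ z].
  by rewrite /dotf /dot big1// => i _; rewrite mxE z mulr0.
have idp : int3 (cell_int K) (fun x => d x * phi x).
  by apply: int3S KO _ => //; exact: (int3_cwcM M_tri Omega_dom).
have ipp : int3 (cell_int K) (fun x => pw_div u x * phi x).
  by apply: int3S KO _ => //; exact: (int3_cwcM M_tri Omega_dom).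
have igp : int3 (cell_int K) (fun x => dot (u x) (grad phi x)).
  by apply: int3S KO _ => //; apply: (cwc_int3 M_tri Omega_dom); exact: ipv_grad_cwc h phi1.
have := cell_green_test KM h tphi.
have -> : vol_int (cell_int K) (fun x => dot (u x) (grad phi x) + dvg u x * phi x)
   = vol_int (cell_int K) (fun x => dot (u x) (grad phi x) + pw_div u x * phi x).
  by apply: eq_vol_int => x Kx; rewrite /pw_div (on_cellsE _ KM Kx).
rewrite vol_intD// E2 dw// -E1 => h0.
transitivity (vol_int (cell_int K) (fun x => d x * phi x)
   - vol_int (cell_int K) (fun x => pw_div u x * phi x)).
  by rewrite -vol_intB//; apply: eq_vol_int => x _; rewrite mulrBl.
lra.
Qed.

Lemma weak_div_wdiv u : Hdiv Omega u -> weak_div Omega u (wdiv Omega u).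
Proof. by move=> [_ [d hd]]; exact: (xgetPex (fun=> 0) (ex_intro _ d hd)). Qed.

Lemma vol_int_weak_div k u d q : L2v Omega u -> pw_polyv k u -> weak_div Omega u d ->
  C1 q -> ips Omega d q = ips Omega (pw_div u) q.
Proof.
move=> hu h wd q1; have bO := Omega_bounded Omega_dom.
have cq : cellwise_continuous M Omega q by apply: cwc_continuous; exact: C1_continuous.
have id : int3 Omega d by case: wd => hd _; exact: L2_int3.
have ip : int3 Omega (pw_div u) by apply: (cwc_int3 M_tri Omega_dom); exact: pw_div_cwc h.
rewrite /ips !(vol_int_cells M_tri Omega_dom); try exact: (int3_cwcM M_tri Omega_dom).
by apply: eq_bigr => K KM; exact: weak_div_cell h wd q1.
Qed.

Lemma H0div_green k u phi : H0div Omega u -> pw_polyv k u -> C1 phi ->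
  vol_int Omega (fun x => dot (u x) (grad phi x) + pw_div u x * phi x) = 0.
Proof.
move=> [hd g0] h phi1; have [hu _] := hd.
have cphi : cellwise_continuous M Omega phi by apply: cwc_continuous; exact: C1_continuous.
rewrite vol_intD//.
- rewrite -[RHS](g0 phi phi1) (vol_int_weak_div hu h (weak_div_wdiv hd) phi1).
  by [].
- by apply: (cwc_int3 M_tri Omega_dom); exact: ipv_grad_cwc h phi1.
- by apply: (cwc_int3 M_tri Omega_dom); apply: cwcM => //; exact: pw_div_cwc h.
Qed.

(** Conversely, a piecewise polynomial field whose fluxes cancel has no singular
    divergence on the faces. *)
Lemma weak_div_green k u : L2v Omega u -> pw_polyv k u ->
  (forall e, #|e| = 3%N -> forall x, hull e x -> fjump e u x = 0) ->
  weak_div Omega u (pw_div u) /\ H0div Omega u.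
Proof.
move=> hu h j0.
have G phi : C1 phi -> ipv Omega u (grad phi) + ips Omega (pw_div u) phi = 0.
  move=> phi1; have := global_green hu h phi1; rewrite vol_intD//.
  - rewrite [RHS]big1 => [-> //|e /eqP ce].
    by rewrite -[RHS](face_avg0 e); apply: eq_face_avg => // x hx; rewrite j0// mul0r.
  - by apply: (cwc_int3 M_tri Omega_dom); exact: ipv_grad_cwc h phi1.
  - apply: (cwc_int3 M_tri Omega_dom); apply: cwcM; first exact: pw_div_cwc h.
    by apply: cwc_continuous; exact: C1_continuous.
have wd : weak_div Omega u (pw_div u).
  split; first by apply: (cwc_L2 M_tri Omega_dom); exact: pw_div_cwc h.
  by move=> phi [phi1 _ _]; apply/eqP; rewrite -addr_eq0 G.
have hd : Hdiv Omega u by split=> //; exists (pw_div u).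
split=> //; split=> // phi phi1.
by rewrite (vol_int_weak_div hu h (weak_div_wdiv hd) phi1) G.
Qed.

End PiecewisePolynomials.

(** * Cancellation of normal fluxes *)

Section Bubble.
Variable R : realType.
Notation rV3 := 'rV[R]_3.
Implicit Types (x y : rV3).

Definition paraboloid x0 (r : R) x := r ^+ 2 - \sum_(i < 3) (x 0 i - x0 0 i) ^+ 2.

(** A function of class C2 supported in a ball: its gradient is an admissible test field
    for the curl. *)
Definition bubble x0 r x := paraboloid x0 r x * pos2 (paraboloid x0 r x).

Lemma C1_shift x0 i : C1 (fun x : rV3 => x 0 i - x0 0 i).
Proof. by apply: C1B; [exact: C1_coord|exact: C1_cst]. Qed.

Lemma pd_shift x0 i j x : pd j (fun x : rV3 => x 0 i - x0 0 i) x = (j == i)%:R.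
Proof.
rewrite pdB; first by rewrite pd_coord pd_cst subr0.
- by case: (C1_coord R i).
- by case: (@C1_cst R (x0 0 i)).
Qed.

Lemma paraboloid_C1 x0 r : C1 (paraboloid x0 r).
Proof.
apply: C1B; first exact: C1_cst.
by apply: C1_sum => i _; apply: C1X; exact: C1_shift.
Qed.

Lemma pd_paraboloid x0 r j x : pd j (paraboloid x0 r) x = - 2 * (x 0 j - x0 0 j).
Proof.
have C1s i : C1 (fun x : rV3 => (x 0 i - x0 0 i) ^+ 2) by apply: C1X; exact: C1_shift.
rewrite pdB; last 2 first.
- by case: (@C1_cst R (r ^+ 2)).
- by case: (@C1_sum R _ (index_enum 'I_3) xpredT (fun i x => (x 0 i - x0 0 i) ^+ 2) (fun i _ => C1s i)).
rewrite pd_cst pd_sum// (bigD1 j)//= big1 ?addr0 => [|i ij]; last first.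
  have -> : (fun y : rV3 => (y 0 i - x0 0 i) ^+ 2) = (fun y => (y 0 i - x0 0 i) * (y 0 i - x0 0 i)).
    by apply/funext => y; rewrite expr2.
  have [d _] := C1_shift x0 i.
  by rewrite pdM// pd_shift eq_sym (negbTE ij) mulr0 addr0.
have -> : (fun y : rV3 => (y 0 j - x0 0 j) ^+ 2) = (fun y => (y 0 j - x0 0 j) * (y 0 j - x0 0 j)).
  by apply/funext => y; rewrite expr2.
have [d _] := C1_shift x0 j.
by rewrite pdM// pd_shift eqxx /=; ring.
Qed.

Lemma bubble_C1 x0 r : C1 (bubble x0 r).
Proof. by apply: C1M; [|apply: C1_pos2]; exact: paraboloid_C1. Qed.

Lemma pd_bubble x0 r j x :
  pd j (bubble x0 r) x = - 6 * (pos2 (paraboloid x0 r x) * (x 0 j - x0 0 j)).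
Proof.
have p1 := paraboloid_C1 x0 r; have [d _] := p1; have [d2 _] := C1_pos2 p1.
rewrite pdM// pd_pos2// pd_paraboloid /pos2.
by case: (leP (paraboloid x0 r x) 0) => _; ring.
Qed.

Lemma C1_grad_bubble x0 r j : C1 (fun x => grad (bubble x0 r) x 0 j).
Proof.
have -> : (fun x => grad (bubble x0 r) x 0 j) =
    (fun x => - 6 * (pos2 (paraboloid x0 r x) * (x 0 j - x0 0 j))).
  by apply/funext => x; rewrite mxE pd_bubble.
by apply: C1Z; apply: C1M; [apply: C1_pos2; exact: paraboloid_C1|exact: C1_shift].
Qed.

(** The Hessian is symmetric. *)
Lemma curl_grad_bubble x0 r x : curl (grad (bubble x0 r)) x = 0.
Proof.
have H i j : i != j -> pd i (fun y => grad (bubble x0 r) y 0 j) x =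
    24 * Num.max (paraboloid x0 r x) 0 * (x 0 i - x0 0 i) * (x 0 j - x0 0 j).
  move=> ij.
  have -> : (fun x => grad (bubble x0 r) x 0 j) =
      (fun x => - 6 * (pos2 (paraboloid x0 r x) * (x 0 j - x0 0 j))).
    by apply/funext => y; rewrite mxE pd_bubble.
  have p1 := paraboloid_C1 x0 r; have q1 := C1_pos2 p1; have s1 := C1_shift x0 j.
  rewrite pdZ; last by case: (C1M q1 s1).
  rewrite pdM; [|by case: q1|by case: s1].
  rewrite pd_shift (negbTE ij) mulr0 add0r pd_pos2// pd_paraboloid.
  by move: (Num.max _ _) => a; ring.
apply: row3P; rewrite !mxE H; try by []; rewrite H; try by [].
- by ring.
- by ring.
- by ring.
Qed.

Lemma bubble_ge0 x0 r x : 0 <= bubble x0 r x.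
Proof.
rewrite /bubble /pos2; case: (leP (paraboloid x0 r x) 0) => h.
  by rewrite expr0n mulr0.
by rewrite mulr_ge0 ?sqr_ge0// ltW.
Qed.

Lemma bubble_gt0 x0 r : 0 < r -> 0 < bubble x0 r x0.
Proof.
move=> r0; rewrite /bubble; have -> : paraboloid x0 r x0 = r ^+ 2 :> R.
  by rewrite /paraboloid big1 ?subr0// => i _; rewrite subrr expr0n.
have r2 : 0 < r ^+ 2 by rewrite exprn_gt0.
by rewrite mulr_gt0// /pos2 max_l ?exprn_gt0// ltW.
Qed.

Lemma bubble_supp x0 r x : 0 < r -> bubble x0 r x != 0 -> ball x0 r x.
Proof.
move=> r0 h; apply/ball_rowP => // i; rewrite distrC ltNge; apply: contra h => h.
rewrite /bubble pos2_le0 ?mulr0// subr_le0 (bigD1 i)//=.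
apply: le_trans (_ : (x 0 i - x0 0 i) ^+ 2 <= _); last first.
  by rewrite lerDl sumr_ge0// => j _; exact: sqr_ge0.
by rewrite -[leRHS]real_normK ?num_real// ler_sqr ?nnegrE// ltW.
Qed.

End Bubble.

Section NormalContinuity.
Variable R : realType.
Variable M : mesh R.
Variable Omega : set 'rV[R]_3.
Hypothesis M_tri : triangulation M Omega.
Hypothesis Omega_dom : bounded_domain Omega.
Notation rV3 := 'rV[R]_3.
Notation simplex := {set 'I_(nvert M)}.
Notation v := (@vert R M).
Notation opp K i := (K :\ i)%SET.
Notation tri := (@ref_triangle R).
Implicit Types (K L e : simplex) (x y : rV3) (f g q phi : rV3 -> R) (u : rV3 -> rV3).

Let cell_tet K : K \in cells M -> tetrahedron K := @cell_tetrahedron R M Omega M_tri K.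

Lemma face_param_cont e t : {for t, continuous (@face_param R M e)}.
Proof.
apply: cvgD; first apply: cvgD; first exact: cvg_cst.
- by apply: cvgZr_tmp; exact: cvg_fst.
- by apply: cvgZr_tmp; exact: cvg_snd.
Qed.

(** The integrand is bounded below by a positive constant on a square around t0. *)
Lemma face_avg_gt0 e f t0 : continuous f -> (forall t, tri t -> 0 <= f (face_param e t)) ->
  0 < t0.1 -> 0 < t0.2 -> t0.1 + t0.2 < 1 -> 0 < f (face_param e t0) -> 0 < face_avg e f.
Proof.
move=> cf f0 a0 b0 ab1 h0; set c := f (face_param e t0) / 2.
have c0 : 0 < c by rewrite divr_gt0.
have : \forall t \near t0, c < f (face_param e t).
  have cv : (f (face_param e t)) @[t --> t0] --> f (face_param e t0).
    by apply: (@continuous_comp _ _ _ (@face_param R M e) f t0); [exact: face_param_cont|exact: cf].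
  by apply: (cvgr_gt _ cv); rewrite /c ltr_pdivrMr// mulr_natr mulr2n ltrDl.
move=> /nbhs_ballP[r /= r0 hr].
(* The square of half side d around t0 lies in the triangle. *)
pose d := Num.min r (Num.min t0.1 (Num.min t0.2 ((1 - t0.1 - t0.2) / 2))).
have d0 : 0 < d by rewrite !lt_min r0 a0 b0 divr_gt0//; lra.
have [dr da db dc] : [/\ d <= r, d <= t0.1, d <= t0.2 & d <= (1 - t0.1 - t0.2) / 2].
  by split; rewrite !ge_min lexx ?orbT.
pose I (z : R) := `](z - d), (z + d)[%classic : set R.
have I0 z : (0 < leb1 R (I z))%E.
  rewrite /I lebesgue_measure_itv /= lte_fin ltrD2l gtrN//.
  by rewrite -EFinD lte_fin; lra.
have mI z : measurable (I z : set (measurableTypeR R)) by exact: measurable_itv.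
pose S := I t0.1 `*` I t0.2.
have mS : measurable (S : set (R * R)) by apply: measurableX; exact: mI.
have ST : S `<=` tri.
  by move=> t [/=]; rewrite /I /= !in_itv /= => /andP[h1 h2] /andP[h3 h4]; split; lra.
have fS t : S t -> c <= f (face_param e t).
  move=> [/=]; rewrite /I /= !in_itv /= => /andP[h1 h2] /andP[h3 h4]; apply: ltW; apply: hr.
  by split; rewrite /= /ball /= distrC ltr_norml; apply/andP; split; lra.
have mt : measurable (tri : set (R * R)) by exact: measurable_ref_triangle.
have it := fint_continuous e cf.
have mf : measurable_fun tri (fun t : R * R => (f (face_param e t))%:E).
  exact: (measurable_int _ it).
have LS : (0 < leb2 R S)%E.
  have -> : leb2 R S = (leb1 R (I t0.1) * leb1 R (I t0.2))%E by apply: product_measure1E.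
  by apply: mule_gt0.
apply: fine_gt0; apply/andP; split; last first.
  by rewrite ltey_eq (integrable_fin_num _ it).
apply: (@lt_le_trans _ _ (\int[leb2 R]_(t in S) c%:E)%E).
  by rewrite integral_cst//; apply: mule_gt0.
apply: (@le_trans _ _ (\int[leb2 R]_(t in S) (f (face_param e t))%:E)%E).
  apply: ge0_le_integral => //.
  - by move=> t _; rewrite lee_fin ltW.
  - exact: measurable_funS mf.
by apply: ge0_subset_integral => // t ht; rewrite lee_fin f0.
Qed.

Lemma face_point_paramP e x : #|e| = 3%N -> face_point e x ->
  exists t : R * R, [/\ 0 < t.1, 0 < t.2, t.1 + t.2 < 1 & x = face_param e t].
Proof.
move=> ce [c [c0 cp]]; have [i [j [k [ee u m]]]] := enum_labels3 ce.
have s (V : nmodType) (F : 'I_(nvert M) -> V) : \sum_(a in e) F a = F i + F j + F k.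
  transitivity (\sum_(a <- [:: i; j; k]) F a); first by rewrite [RHS]big_uniq//; apply: eq_bigl.
  by rewrite !big_cons big_nil addr0 !addrA.
have [e0 e1 e2] := vertex_enum3 ee; rewrite !s => c1 ->.
have [ci cj ck] : [/\ 0 < c i, 0 < c j & 0 < c k] by split; apply: cp; rewrite m !inE eqxx ?orbT.
exists (c j, c k); rewrite /face_param e0 e1 e2 /=; split=> //; first by lra.
have -> : c i = 1 - c j - c k by rewrite -c1; ring.
by apply: row3P; rewrite !mxE; ring.
Qed.

Lemma face_closed e L : L \in adj e -> closed (hull e).
Proof.
rewrite inE => /andP[LM eL]; have tL := cell_tet LM.
have -> : hull e = hull L `&`
    \bigcap_(i in [set i | (i \in L) && (i \notin e)]) (bary L i @^-1` [set 0]).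
  apply/seteqP; split=> x.
    by move=> /(hull_sub_bary tL eL)[h z]; split=> // i /andP[iL ie]; exact: z.
  by move=> [h z]; apply: (bary_eq0_hull tL eL h) => i iL ie; apply: z; rewrite /= iL.
apply: closedI; first exact: hull_closed.
apply: closed_bigI => i iL; apply: closed_comp => [x _|]; first exact: bary_continuous.
exact: closed_eq.
Qed.

(** The segment from a point of the face to the centroid enters the relative interior at
    once. *)
Lemma face_point_dense e (G : rV3 -> R) x : #|e| = 3%N -> continuous G -> hull e x ->
  (forall y, face_point e y -> G y = 0) -> G x = 0.
Proof.
move=> ce cG [a [a0 a1 ax]] h; apply: contrapT => /eqP G0.
pose c : rV3 := \sum_(k in e) 3^-1 *: v k.
have cv : (fun s : R => x + s *: (c - x)) @ 0 --> x.
  rewrite -[X in _ --> X](addr0 x) -(scale0r (c - x)).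
  by apply: cvgD; [exact: cvg_cst|exact: scalel_continuous].
have : \forall s \near (0 : R), G (x + s *: (c - x)) != 0.
  suff nG : nbhs x [set y | G y != 0] by exact: (cv _ nG).
  apply: open_nbhs_nbhs; split => //.
  have -> : [set y | G y != 0] = G @^-1` (~` [set 0]).
    by apply/funext => y; apply/propext; split=> /eqP.
  by apply: open_comp => [y _|]; [exact: cG|exact/closed_openC/closed_eq].
move=> /nbhs_ballP[r /= r0 hr]; pose s := Num.min 2^-1 (r / 2).
have [s0 s1 s2] : [/\ 0 < s, s <= 2^-1 & s <= r / 2].
  by rewrite /s !ge_min !lexx ?orbT lt_min invr_gt0 ltr0n divr_gt0.
have := hr s; rewrite /ball /= sub0r normrN gtr0_norm// => /(_ ltac:(lra)) /eqP; apply.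
apply: h; exists (fun k => (1 - s) * a k + s * 3^-1); split.
- by move=> k; have := a0 k; nra.
- by move=> k _; have := a0 k; nra.
- by rewrite big_split /= -!mulr_sumr a1 sumr_const ce -[_ *+ 3]mulr_natr mulVf ?pnatr_eq0//; ring.
- transitivity ((1 - s) *: x + s *: c).
    by rewrite scalerBl scale1r scalerBr [X in _ + X]addrC addrA.
  rewrite /c ax !scaler_sumr -big_split; apply: eq_bigr => k _ /=.
  by rewrite !scalerA scalerDl.
Qed.

(** A bubble centred at an interior point of a face and supported away from the other
    faces isolates the sum of the normal traces there. *)
Lemma fjump_eq0 k u : L2v Omega u -> pw_polyv M k u ->
  (forall x0 r, 0 < r -> vol_int Omega
     (fun x => dot (u x) (grad (bubble x0 r) x) + pw_div M u x * bubble x0 r x) = 0) ->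
  forall e, #|e| = 3%N -> forall x, hull e x -> fjump e u x = 0.
Proof.
move=> hu h hb e ce; have [G cG hG] := fjump_continuous M_tri e h.
suff S y : face_point e y -> G y = 0.
  by move=> x hx; rewrite hG//; exact: (face_point_dense ce cG).
move=> ye; apply: contrapT => /eqP G0; have hy := face_point_hull ye.
have [a0|[K Ke]] := set_0Vmem (adj e).
  by move: G0; rewrite -hG// /fjump a0 big_set0 eqxx.
have sG0 : 0 < Num.sg (G y) * G y by rewrite -normrEsg normr_gt0.
have near1 : \forall z \near y, 0 < Num.sg (G y) * G z.
  have cs : continuous (fun z : rV3 => Num.sg (G y) * G z : R).
    by apply: continuous_mul; [exact: continuous_cst|exact: cG].
  have cv := cs y.
  exact: (cvgr_gt _ cv).
have near2 : \forall z \near y, forall e' : simplex,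
    [&& #|e'| == 3%N, e' != e & adj e' != finset.set0] -> ~ hull e' z.
  apply: (@filter_forall rV3 simplex (fun e' z =>
     [&& #|e'| == 3%N, e' != e & adj e' != finset.set0] -> ~ hull e' z) (nbhs y)) => e'.
  case: (boolP [&& _, _ & _]); last by move=> _; near=> z.
  move=> /and3P[/eqP ce' ee' /set0Pn[L Le']].
  have : nbhs y (~` hull e').
    apply: open_nbhs_nbhs; split; first by apply: closed_openC; exact: face_closed Le'.
    move=> he'; move: Le'; rewrite inE => /andP[LM eL].
    have := face_point_sub M_tri Ke LM eL ye he' => es; case/eqP: ee'.
    by apply/esym/eqP; rewrite finset.eqEcard es ce ce'.
  by apply: filterS => z.
have [r /= r0 hr] := (nbhs_ballP y _).1 (filterI near1 near2).
have := global_green M_tri Omega_dom hu h (bubble_C1 y r); rewrite hb//.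
rewrite (bigD1 e) ?ce//= [X in _ + X]big1 ?addr0 => [|e' /andP[/eqP ce' ee']]; last first.
  rewrite -[RHS](face_avg0 e'); apply: eq_face_avg => // x hx.
  have [a0|n0] := eqVneq (adj e') finset.set0; first by rewrite /fjump a0 big_set0 mul0r.
  have [->|/(bubble_supp r0)/hr[_ /(_ e')]] := eqVneq (bubble y r x) 0; first by rewrite mulr0.
  by rewrite ce' ee' n0 => /(_ isT).
have -> : face_avg e (fun x => fjump e u x * bubble y r x) = face_avg e (fun x => G x * bubble y r x).
  by apply: eq_face_avg => // x hx; rewrite hG.
have cb : continuous (bubble y r) by exact: C1_continuous (bubble_C1 y r).
move=> E; have [t [t1 t2 t3 yt]] := face_point_paramP ce ye.
have : 0 < face_avg e (fun x => Num.sg (G y) * (G x * bubble y r x)).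
  apply: (@face_avg_gt0 _ _ t) => //.
  - by apply: continuous_mul; [exact: continuous_cst|exact: continuous_mul].
  - move=> t' _; move: (face_param e t') => x; rewrite mulrA.
    have [->|/(bubble_supp r0)/hr[hx _]] := eqVneq (bubble y r x) 0; first by rewrite mulr0.
    by rewrite mulr_ge0 ?bubble_ge0// ltW.
  - by rewrite -yt mulrA mulr_gt0// bubble_gt0.
rewrite face_avgZ -?E ?mulr0 ?ltxx//.
by apply: fint_continuous; exact: continuous_mul.
Unshelve. all: by end_near. Qed.

End NormalContinuity.

(** * The transport form *)

Section DiscreteTransport.
Variable R : realType.
Variable M : mesh R.
Variable Omega : set 'rV[R]_3.
Hypothesis M_tri : triangulation M Omega.
Notation rV3 := 'rV[R]_3.
Notation simplex := {set 'I_(nvert M)}.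
Notation v := (@vert R M).
Notation opp K i := (K :\ i)%SET.
Notation tr K g := (trace K (g : rV3 -> R^o)).
Implicit Types (K L e : simplex) (x y : rV3) (f g q phi : rV3 -> R) (u : rV3 -> rV3).

Let cell_tet K : K \in cells M -> tetrahedron K := @cell_tetrahedron R M Omega M_tri K.

Definition pw_C1 g := forall K, K \in cells M ->
  exists2 q, C1 q & forall x, cell_int K x -> g x = q x.

Lemma pw_poly_C1 k g : pw_poly M k g -> pw_C1 g.
Proof. by move=> h K /h[P _ gP]; exists (mpoly_eval P) => //; exact: mpoly_eval_C1. Qed.

Lemma int_face_sides e : e \in int_faces M ->
  [/\ #|e| = 3%N, side e 0 \in adj e, side e 1 \in adj e, side e 0 != side e 1
    & forall (V : nmodType) (F : simplex -> V),
        \sum_(K in adj e) F K = F (side e 0) + F (side e 1)].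
Proof.
rewrite inE => /andP[/eqP ce /eqP c2]; rewrite /side.
have := cardE (adj e); rewrite c2; have := enum_uniq (adj e); have := mem_enum (adj e).
case E : (enum (adj e)) => [|K [|L [|? ?]]] //= h /andP[]; rewrite inE => KL _ _.
have hK : K \in adj e by rewrite -h !inE eqxx.
have hL : L \in adj e by rewrite -h !inE eqxx orbT.
split=> //.
move=> V F; rewrite -big_enum /= E; by rewrite !big_cons big_nil addr0.
Qed.

Lemma dot_gt0 (x : rV3) : x != 0 -> 0 < dot x x.
Proof.
move=> x0; have h0 : 0 <= dot x x by apply: sumr_ge0 => i _; rewrite -expr2 sqr_ge0.
rewrite lt_neqAle h0 andbT eq_sym; apply: contra_neq x0 => h.
have z i : x 0 i = 0.
  have /eqP : x 0 i * x 0 i = 0.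
    by apply: (psumr_eq0P _ h) => // j _; rewrite -expr2 sqr_ge0.
  by rewrite mulf_eq0 orbb => /eqP.
by apply: row3P; rewrite z mxE.
Qed.

(** The area factor of a face integral turns the unit normal into the normal that occurs
    in Green's formula. *)
Lemma unit_normalE e : e \in int_faces M ->
  enorm (face_normal e) *: unit_normal e = fnormal (side e 0) e.
Proof.
move=> /int_face_sides[ce K1 _ _ _]; have := K1; rewrite inE => /andP[KM eK].
have tK := cell_tet KM; have [i iK E] := facet_opp tK.1 ce eK.
have N0 : face_normal e != 0.
  have := onormal_neq0 tK iK; rewrite /onormal -E; apply: contra_neq => ->.
  by rewrite scaler0.
have n0 : enorm (face_normal e) != 0 by rewrite /enorm gt_eqF// sqrtr_gt0 dot_gt0.
rewrite /unit_normal scalerA mulrC divfK//.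
have -> : fnormal (side e 0) e = onormal (side e 0) i.
  by rewrite -(fnormal_opp iK) -E.
rewrite /onormal -E; congr (- Num.sg _ *: _).
rewrite /height -E (_ : side e 0 :\: e = [set i])%SET; first by rewrite /vertex enum_set1.
by rewrite {2}E; apply/setP => j; rewrite !inE; case: eqP => [->|_]; rewrite ?iK//= andNb.
Qed.

Lemma trace_scalar g e K : K \in adj e -> pw_C1 g ->
  exists2 G, continuous G & forall x, hull e x -> tr K g x = G x.
Proof.
rewrite inE => /andP[KM eK] h; have [q q1 gq] := h K KM; have tK := cell_tet KM.
exists q; first exact: C1_continuous.
move=> x hx; have [hK _] := hull_sub_bary tK eK hx.
by rewrite (@trace_eq _ _ (R^o : normedModType R) K g q x tK hK gq)//; exact: C1_continuous.
Qed.

(** The normal component is continuous across interior faces and vanishes on the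
    boundary. *)
Definition balanced u := forall e, #|e| = 3%N -> forall x, hull e x -> fjump e u x = 0.

(** On an interior face the two opposite fluxes combine into v . [[g]]; on a boundary
    face the flux vanishes. *)
Lemma green_pw k u g : pw_polyv M k u -> balanced u -> pw_C1 g ->
  \sum_(K in cells M) vol_int (cell_int K) (fun x => dot (u x) (grad g x) + dvg u x * g x)
  = \sum_(e in int_faces M) face_int e (fun x => dot (on_face e u x) (jump e g x)).
Proof.
move=> hu bu hg.
transitivity (\sum_(K in cells M) \sum_(i in K)
    face_avg (opp K i) (fun x => dot (trace K u x) (onormal K i) * tr K g x)).
  apply: eq_bigr => K KM; have [P dP uP] := hu K KM; have [q q1 gq] := hg K KM.
  apply: (cell_green (P := fun i => mpoly_eval (P i)) (q := q) (cell_tet KM)) => //.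
  by move=> i; exact: mpoly_eval_C1.
rewrite (sum_faces M_tri (fun K e n => face_avg e (fun x => dot (trace K u x) n * tr K g x))).
rewrite (bigID (fun e => #|adj e| == 2%N)) /= [X in _ + X]big1 ?addr0; last first.
  move=> e /andP[/eqP ce c2]; have := adj_card M_tri ce; rewrite leq_eqVlt (negbTE c2) /= ltnS.
  rewrite leq_eqVlt => /orP[/cards1P[K E]|]; last first.
    by rewrite ltnS leqn0 cards_eq0 => /eqP ->; rewrite big_set0.
  rewrite E big_set1 -[RHS](face_avg0 e); apply: eq_face_avg => // x hx.
  by have := bu e ce x hx; rewrite /fjump E big_set1 => ->; rewrite mul0r.
apply: eq_big => [e|e /andP[ec cc]]; first by rewrite inE.
have eI : e \in int_faces M by rewrite inE ec cc.
have [ce K1 K2 K12 S] := int_face_sides eI; rewrite S.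
have [U0 cU0 hU0] := trace_poly M_tri (unit_normal e) K1 hu.
have [G1 cG1 hG1] := trace_scalar K1 hg; have [G2 cG2 hG2] := trace_scalar K2 hg.
set c := enorm (face_normal e).
have h1 x : hull e x -> dot (trace (side e 0) u x) (fnormal (side e 0) e) = c * U0 x.
  by move=> hx; rewrite -unit_normalE// dotZr hU0.
have h2 x : hull e x -> dot (trace (side e 1) u x) (fnormal (side e 1) e) = - (c * U0 x).
  move=> hx; have := bu e ce x hx; rewrite /fjump S h1// => /eqP.
  by rewrite addrC addr_eq0 => /eqP.
have c1 : continuous (fun x => c * U0 x * G1 x : R).
  by apply: continuous_mul => //; apply: continuous_mul => //; exact: continuous_cst.
have c3 : continuous (fun x => - (c * U0 x) * G2 x : R).
  apply: (@eq_continuous_fun _ _ (fun x => - c * U0 x * G2 x)) => [x|]; first by rewrite mulNr.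
  by apply: continuous_mul => //; apply: continuous_mul => //; exact: continuous_cst.
have c4 : continuous (fun x => U0 x * (G1 x + - 1 * G2 x) : R).
  apply: continuous_mul => //; apply: continuous_add => //.
  by apply: continuous_mul => //; exact: continuous_cst.
rewrite (@eq_face_avg _ _ e _ (fun x => c * U0 x * G1 x)) => // [|x hx]; last first.
  by rewrite h1// hG1.
rewrite [X in _ + X](@eq_face_avg _ _ e _ (fun x => - (c * U0 x) * G2 x)) => // [|x hx]; last first.
  by rewrite h2// hG2.
rewrite -face_avgD; [|exact: fint_continuous|exact: fint_continuous].
rewrite /face_int -/c -[X in _ = _ * X]/(face_avg e (fun x => dot (on_face e u x) (jump e g x))).
rewrite [X in _ = _ * X](@eq_face_avg _ _ e _ (fun x => U0 x * (G1 x + - 1 * G2 x))) => // [|x hx]; last first.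
  rewrite /jump /on_face hG1// hG2//; move: (unit_normal e) hU0 => n hn.
  by rewrite dotDr scalerN -scaleNr !dotZr hn//; ring.
rewrite -face_avgZ; last exact: fint_continuous.
by congr face_avg; apply/funext => x; ring.
Qed.

Definition divfree u := forall K, K \in cells M -> forall x, cell_int K x -> dvg u x = 0.

Lemma eq_face_int e f g : #|e| = 3%N -> (forall x, hull e x -> f x = g x) ->
  face_int e f = face_int e g.
Proof. by move=> ce h; congr (_ * _); exact: (eq_face_avg ce h). Qed.

Lemma face_int0 e : face_int e (fun=> 0) = 0.
Proof. by rewrite /face_int -[X in _ * X]/(face_avg e (fun=> 0)) face_avg0 mulr0. Qed.

Lemma green_divfree k u g : pw_polyv M k u -> balanced u -> divfree u -> pw_C1 g ->
  \sum_(K in cells M) vol_int (cell_int K) (fun x => dot (u x) (grad g x))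
  = \sum_(e in int_faces M) face_int e (fun x => dot (on_face e u x) (jump e g x)).
Proof.
move=> hu bu du hg; rewrite -(green_pw hu bu hg); apply: eq_bigr => K KM.
by apply: eq_vol_int => x Kx; rewrite (du K KM x Kx) mul0r addr0.
Qed.

Lemma trace_cst e K g c x : K \in adj e -> hull e x ->
  (forall L, L \in cells M -> forall y, cell_int L y -> g y = c) -> tr K g x = c.
Proof.
rewrite inE => /andP[KM eK] hx h; have tK := cell_tet KM.
have [hK _] := hull_sub_bary tK eK hx.
rewrite (@trace_eq _ _ (R^o : normedModType R) K g (fun=> c) x tK hK)//; first exact: h.
exact: (@continuous_cst R rV3 c x).
Qed.

Lemma jump_cst e g c x : e \in int_faces M -> hull e x ->
  (forall L, L \in cells M -> forall y, cell_int L y -> g y = c) -> jump e g x = 0.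
Proof.
move=> /int_face_sides[_ K1 K2 _ _] hx h.
by rewrite /jump (trace_cst K1 hx h) (trace_cst K2 hx h) scalerN subrr.
Qed.

Lemma dot0r x : dot x 0 = 0.
Proof. by rewrite -(scale0r (0 : rV3)) dotZr mul0r. Qed.

Lemma bh_cst f g u c : (forall L, L \in cells M -> forall y, cell_int L y -> f y = c) ->
  bh M f g u = 0.
Proof.
move=> h; rewrite /bh [X in - X]big1 => [|K KM]; last first.
  apply: vol_int_eq0 => x Kx; rewrite /dot big1 ?mul0r// => i _.
  by rewrite mxE (@pd_cell _ _ K f (fun=> c) i x Kx (h K KM)) pd_cst mulr0.
rewrite big1 ?oppr0 ?addr0// => e ei; have [ce _ _ _ _] := int_face_sides ei.
rewrite -[RHS](face_int0 e); apply: eq_face_int => // x hx.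
by rewrite (jump_cst ei hx h) dot0r mul0r.
Qed.

(** Green's formula for f: the average of the constant 1 is 1. *)
Lemma bh_one k u f g : pw_polyv M k u -> balanced u -> divfree u -> pw_C1 f ->
  (forall L, L \in cells M -> forall y, cell_int L y -> g y = 1) -> bh M f g u = 0.
Proof.
move=> hu bu du hf h; apply/eqP; rewrite /bh addrC subr_eq0; apply/eqP.
transitivity (\sum_(e in int_faces M) face_int e (fun x => dot (on_face e u x) (jump e f x))).
  apply: eq_bigr => e ei; have [ce K1 K2 _ _] := int_face_sides ei.
  apply: eq_face_int => // x hx; rewrite /avg (trace_cst K1 hx h) (trace_cst K2 hx h).
  by rewrite (_ : (1 + 1) / 2 = 1) ?mulr1//; field.
rewrite -(green_divfree hu bu du hf); apply: eq_bigr => K KM.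
by apply: eq_vol_int => x Kx; rewrite (h K KM x Kx) mulr1.
Qed.

(** Green's formula for f^2/2, whose gradient is f grad f and whose jump is the jump of
    f times its average. *)
Lemma bh_diag k u f : pw_polyv M k u -> balanced u -> divfree u -> pw_C1 f -> bh M f f u = 0.
Proof.
move=> hu bu du hf; apply/eqP; rewrite /bh addrC subr_eq0; apply/eqP.
pose g x := 2^-1 * (f x * f x).
have hg : pw_C1 g.
  move=> K KM; have [q q1 fq] := hf K KM; exists (fun x => 2^-1 * (q x * q x)).
    by apply: C1Z; exact: C1M.
  by move=> x Kx; rewrite /g fq.
transitivity (\sum_(e in int_faces M) face_int e (fun x => dot (on_face e u x) (jump e g x))).
  apply: eq_bigr => e ei; have [ce K1 K2 _ _] := int_face_sides ei.
  apply: eq_face_int => // x hx.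
  have T K : K \in adj e -> tr K g x = 2^-1 * (tr K f x * tr K f x).
    rewrite inE => /andP[KM eK]; have tK := cell_tet KM; have [q q1 fq] := hf K KM.
    have [hK _] := hull_sub_bary tK eK hx.
    pose q' y : R := 2^-1 * (q y * q y); have q2 : C1 q' by apply: C1Z; exact: C1M.
    rewrite (@trace_eq _ _ (R^o : normedModType R) K f q x tK hK fq); last exact: C1_continuous.
    rewrite (@trace_eq _ _ (R^o : normedModType R) K g q' x tK hK) => [//|y Ky|].
      by rewrite /g fq.
    exact: C1_continuous.
  rewrite /jump /avg (T _ K1) (T _ K2); move: (unit_normal e) => n; rewrite !dotDr !scalerN -!scaleNr !dotZr.
  rewrite /GRing.scale /=; move: (tr _ f x) (tr _ f x) (dot _ _) => a b d; by field.
rewrite -(green_divfree hu bu du hg); apply: eq_bigr => K KM.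
apply: eq_vol_int => x Kx; have [q q1 fq] := hf K KM.
rewrite /dot mulr_suml; apply: eq_bigr => i _; rewrite !mxE.
have [dq _] := q1; have [dqq _] := C1M q1 q1.
rewrite (@pd_cell _ _ K g (fun x => 2^-1 * (q x * q x)) i x Kx); last by move=> y Ky; rewrite /g fq.
by rewrite (pd_cell i Kx fq) pdZ// pdM// fq//; field.
Qed.

End DiscreteTransport.

(** * Weak and classical curls *)

Section PiecewiseCurl.
Variable R : realType.
Variable M : mesh R.
Variable Omega : set 'rV[R]_3.
Hypothesis M_tri : triangulation M Omega.
Hypothesis Omega_dom : bounded_domain Omega.
Notation rV3 := 'rV[R]_3.
Notation mpoly3 := (mpoly.mpoly 3 R).
Implicit Types (K L e : {set 'I_(nvert M)}) (x y : rV3) (f g q phi : rV3 -> R)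
  (u A c E psi : rV3 -> rV3) (P : 'I_3 -> mpoly3).

Let cell_tet K : K \in cells M -> tetrahedron K := @cell_tetrahedron R M Omega M_tri K.
Let mO : mset3 Omega := Omega_mset Omega_dom.
Let bO : bounded_set Omega := Omega_bounded Omega_dom.

Lemma ord3E : (0 + 1 = 1 :> 'I_3) * (0 + 2 = 2 :> 'I_3) * (1 + 1 = 2 :> 'I_3)
  * (1 + 2 = 0 :> 'I_3) * (2 + 1 = 0 :> 'I_3) * (2 + 2 = 1 :> 'I_3).
Proof. by do !split; apply/val_inj. Qed.

Lemma dot_cross_delta i x y : dot (cross y (delta_mx 0 i)) x
  = y 0 (i + 2) * x 0 (i + 1) - y 0 (i + 1) * x 0 (i + 2).
Proof.
rewrite dotE !crossE !mxE; move: (x 0 : 'I_3 -> R) (y 0 : 'I_3 -> R) => a b.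
by elim/ord3_ind: i; rewrite !ord3E /=; ring.
Qed.

Definition mcurl P (i : 'I_3) : mpoly3 :=
  mpoly.mderiv (i + 1) (P (i + 2)) - mpoly.mderiv (i + 2) (P (i + 1)).

Lemma curl_cell K P E x i : cell_int K x ->
  (forall y, cell_int K y -> E y = mpoly_evalv P y) ->
  curl E x 0 i = mpoly_eval (mcurl P i) x.
Proof.
move=> Kx EP; have H a b : pd a (fun y => E y 0 b) x = mpoly_eval (mpoly.mderiv a (P b)) x.
  rewrite -pd_mpoly_eval; apply: (pd_cell _ Kx) => y Ky.
  by rewrite EP// mpoly_evalvE.
by rewrite mxE !H -mpoly_evalB.
Qed.

Definition pw_curl E : rV3 -> rV3 := fun x => \row_i on_cells M (fun y => curl E y 0 i) x.

Lemma pw_curlE K E x : K \in cells M -> cell_int K x -> pw_curl E x = curl E x.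
Proof. by move=> KM Kx; apply/rowP => i; rewrite mxE (on_cellsE M_tri _ KM Kx). Qed.

Lemma pw_polyv_curl k E : pw_polyv M k.+1 E -> pw_polyv M k (pw_curl E).
Proof.
move=> h K KM; have [P dP EP] := h K KM; exists (mcurl P).
  by move=> i; apply: deg_leD; [|apply: deg_leN]; exact: deg_le_deriv.
by move=> x Kx; rewrite (pw_curlE _ KM Kx); apply/rowP => i; rewrite (curl_cell _ Kx EP) mxE.
Qed.

Lemma pw_curl_cwc k E i : pw_polyv M k E -> cellwise_continuous M Omega (fun x => pw_curl E x 0 i).
Proof.
move=> h; have -> : (fun x => pw_curl E x 0 i) = on_cells M (fun y => curl E y 0 i).
  by apply/funext => x; rewrite mxE.
apply: (on_cells_cwc M_tri) => K KM; have [P dP EP] := h K KM.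
exists (mpoly_eval (mcurl P i)); first exact: C1_continuous (mpoly_eval_C1 _).
by move=> x Kx; rewrite (curl_cell _ Kx EP).
Qed.

Lemma pw_curl_L2v k E : pw_polyv M k E -> L2v Omega (pw_curl E).
Proof. by move=> h i; apply: (cwc_L2 M_tri Omega_dom); exact: pw_curl_cwc h. Qed.

Lemma divfree_curl k E : pw_polyv M k E -> divfree M (pw_curl E).
Proof.
move=> h K KM x Kx; have [P dP EP] := h K KM.
have C y : cell_int K y -> pw_curl E y = mpoly_evalv (mcurl P) y.
  by move=> Ky; rewrite (pw_curlE _ KM Ky); apply/rowP => i; rewrite (curl_cell _ Ky EP) mxE.
rewrite (dvg_cell Kx C) sum3 /mcurl !mpoly.mderivB.
rewrite !ord3E (mpoly.mderiv_comm 1 0) (mpoly.mderiv_comm 2 0) (mpoly.mderiv_comm 2 1).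
by rewrite mpoly_evalD mpoly_evalD !mpoly_evalB; ring.
Qed.

Lemma int3_cell_mul K d q : K \in cells M -> int3 Omega d -> C1 q ->
  int3 (cell_int K) (fun x => d x * q x).
Proof.
move=> KM id q1; have KO := cell_int_Omega M_tri Omega_dom KM; have mK := cell_int_mset K.
apply: int3S KO _ => //; apply: (int3_cwcM M_tri Omega_dom) => //.
by apply: cwc_continuous; exact: C1_continuous.
Qed.

(** First-order weak operators are only known on test functions; this extends equalities
    between them to all C1 weights on a cell. *)
Lemma cell_eq_of_test K (d d' : rV3 -> R) : K \in cells M -> int3 Omega d -> int3 Omega d' ->
  (forall phi, test (cell_int K) phi -> ips Omega d phi = ips Omega d' phi) ->
  forall q, C1 q -> vol_int (cell_int K) (fun x => d x * q x) = vol_int (cell_int K) (fun x => d' x * q x).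
Proof.
move=> KM id id' h q q1; have tK := cell_tet KM; have mK := cell_int_mset K.
have KO := cell_int_Omega M_tri Omega_dom KM.
apply/eqP; rewrite -subr_eq0 -vol_intB//; try exact: int3_cell_mul; apply/eqP.
rewrite -[RHS](@cutoff_dense _ _ K (fun x => d x - d' x) tK _ _ q q1).
- by apply: eq_vol_int => x _; rewrite mulrBl.
- by apply: int3S KO _ => //; exact: int3B.
move=> phi tphi; have [phi1 _ _] := tphi.
have E1 d0 : vol_int (cell_int K) (fun x => d0 x * phi x) = ips Omega d0 phi.
  by symmetry; apply: vol_int_supp => // x _ /(test_off tphi)[-> _]; rewrite mulr0.
transitivity (vol_int (cell_int K) (fun x => d x * phi x)
   - vol_int (cell_int K) (fun x => d' x * phi x)).
  rewrite -vol_intB//; try exact: int3_cell_mul.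
  by apply: eq_vol_int => x _; rewrite mulrBl.
by rewrite !E1 h// subrr.
Qed.

(** The test field phi e_i isolates the component i of a weak curl. *)
Definition vtest i phi : rV3 -> rV3 := fun x => phi x *: delta_mx 0 i.

Lemma vtest_C1 i phi : C1 phi -> C1v (vtest i phi).
Proof.
move=> phi1 j; have -> : (fun x => vtest i phi x 0 j) = (fun x => (j == i)%:R * phi x).
  by apply/funext => x; rewrite /vtest !mxE /= mulrC.
exact: C1Z.
Qed.

Lemma vtest_test D i phi : test D phi -> testv D (vtest i phi).
Proof.
move=> tphi j; have [phi1 cphi sphi] := tphi.
have sub : closure [set x | vtest i phi x 0 j != 0] `<=` closure [set x | phi x != 0].
  apply: closure_subset => x /=; rewrite /vtest !mxE; apply: contra_neq => ->.
  by rewrite mul0r.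
split; first exact: vtest_C1.
- by apply: subclosed_compact cphi _ => //; exact: closed_closure.
- exact: subset_trans sub sphi.
Qed.

Lemma dot_vtest c i phi x : dot (c x) (vtest i phi x) = c x 0 i * phi x.
Proof. by rewrite /vtest dotZr dotC dot_delta mulrC. Qed.

Lemma pd_vtest a b i phi x : C1 phi ->
  pd a (fun y => vtest i phi y 0 b) x = (b == i)%:R * pd a phi x.
Proof.
move=> [dphi _]; rewrite -pdZ//; congr pd; apply/funext => y.
by rewrite /vtest !mxE /= mulrC.
Qed.

(** Testing the curl of a field E with phi e_i amounts to testing the divergence of E x
    e_i with phi. *)
Lemma dot_cross_grad i phi x (y : rV3) : C1 phi ->
  dot (cross y (delta_mx 0 i)) (grad phi x) = - dot y (curl (vtest i phi) x).
Proof.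
move=> phi1; rewrite dot_cross_delta dotE !mxE !pd_vtest//.
rewrite !ord3E; move: (y 0 : 'I_3 -> R) => b.
elim/ord3_ind: i; rewrite !ord3E /=; move: (pd 0 phi x) (pd 1 phi x) (pd 2 phi x) => d0 d1 d2; ring.
Qed.

Definition mcross P (i j : 'I_3) : mpoly3 :=
  ((j + 2 == i)%:R : R) *: P (j + 1) - ((j + 1 == i)%:R : R) *: P (j + 2).

Lemma cross_cell K P E i x : (forall y, cell_int K y -> E y = mpoly_evalv P y) ->
  cell_int K x -> cross (E x) (delta_mx 0 i) = mpoly_evalv (mcross P i) x.
Proof.
move=> EP Kx; apply/rowP => j; rewrite !mxE mpoly_evalB !mpoly_evalZ EP// !mxE /=.
by congr (_ - _); rewrite mulrC.
Qed.

Lemma pw_polyv_cross k E i : pw_polyv M k E ->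
  pw_polyv M k (fun x => cross (E x) (delta_mx 0 i)).
Proof.
move=> h K KM; have [P dP EP] := h K KM; exists (mcross P i); last first.
  by move=> x; exact: cross_cell.
by move=> j; apply: deg_leD; [|apply: deg_leN]; exact: deg_leZ.
Qed.

Lemma dvg_cross K P E i x : (forall y, cell_int K y -> E y = mpoly_evalv P y) ->
  cell_int K x -> dvg (fun y => cross (E y) (delta_mx 0 i)) x = curl E x 0 i.
Proof.
move=> EP Kx; rewrite (dvg_cell Kx (fun y Ky => cross_cell i EP Ky)) (curl_cell _ Kx EP).
congr mpoly_eval; rewrite sum3 /mcross /mcurl !mpoly.mderivB !mpoly.mderivZ !ord3E.
elim/ord3_ind: i; rewrite !ord3E /= ?scale0r ?scale1r;
  do ?[rewrite (_ : (_ == _) = true) //| rewrite (_ : (_ == _) = false)//];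
  by rewrite ?scale0r ?scale1r ?subr0 ?sub0r ?add0r ?addr0 // addrC.
Qed.

Lemma curl_continuous psi i : C1v psi -> continuous (fun x => curl psi x 0 i).
Proof.
move=> h; have [_ c1] := h (i + 2); have [_ c2] := h (i + 1).
apply: (@eq_continuous_fun _ _ (fun x => pd (i + 1) (fun y => psi y 0 (i + 2)) x
  + - 1 * pd (i + 2) (fun y => psi y 0 (i + 1)) x)) => [x|].
  by rewrite mxE mulN1r.
apply: continuous_add; first exact: c1.
by apply: continuous_mul; [exact: continuous_cst|exact: c2].
Qed.

Lemma ipv_curl_cwc k E psi : L2v Omega E -> pw_polyv M k E -> C1v psi ->
  cellwise_continuous M Omega (fun x => dot (E x) (curl psi x)).
Proof.
move=> hE h h1; apply: cwc_sum => i; apply: cwcM; first exact: pw_polyv_cwc h.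
by apply: cwc_continuous; exact: curl_continuous.
Qed.

Lemma weak_curl_cell k K E c i q : K \in cells M -> L2v Omega E -> pw_polyv M k E ->
  weak_curl Omega E c -> C1 q ->
  vol_int (cell_int K) (fun x => c x 0 i * q x)
  = vol_int (cell_int K) (fun x => pw_curl E x 0 i * q x).
Proof.
move=> KM hE h [hc cw]; have KO := cell_int_Omega M_tri Omega_dom KM; have mK := cell_int_mset K.
have ic : int3 Omega (fun x => c x 0 i) by apply: L2_int3 => //; exact: hc.
have ip : int3 Omega (fun x => pw_curl E x 0 i).
  by apply: (cwc_int3 M_tri Omega_dom); exact: pw_curl_cwc h.
apply: cell_eq_of_test => // phi tphi; have [phi1 _ _] := tphi.
have := cw _ (vtest_test i (testS KO tphi)).
have -> : ipv Omega c (vtest i phi) = ips Omega (fun x => c x 0 i) phi.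
  by apply: eq_vol_int => x _; exact: dot_vtest.
move=> <-.
have off x : Omega x -> ~ cell_int K x -> dot (E x) (curl (vtest i phi) x) = 0.
  move=> _ /(test_off tphi)[_ z]; have := dot_cross_grad i x (E x) phi1.
  rewrite (_ : grad phi x = 0) ?dot0r => [/esym/eqP|]; last first.
    by apply/rowP => j; rewrite !mxE z.
  by rewrite oppr_eq0 => /eqP.
have off' x : Omega x -> ~ cell_int K x -> pw_curl E x 0 i * phi x = 0.
  by move=> _ /(test_off tphi)[-> _]; rewrite mulr0.
rewrite /ipv /ips (vol_int_supp KO off) (vol_int_supp KO off').
have [P dP EP] := h K KM.
have i1 : int3 (cell_int K) (fun x => dot (E x) (curl (vtest i phi) x)).
  apply: int3S KO _ => //; apply: (cwc_int3 M_tri Omega_dom).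
  by apply: ipv_curl_cwc hE h _; exact: vtest_C1.
have i2 : int3 (cell_int K) (fun x => pw_curl E x 0 i * phi x) by exact: int3_cell_mul.
apply/esym/eqP; rewrite -subr_eq0 -vol_intB//; apply/eqP.
rewrite -[RHS](cell_green_test M_tri KM (pw_polyv_cross i h) tphi); apply: eq_vol_int => x Kx.
by rewrite dot_cross_grad// (dvg_cross i EP Kx) (pw_curlE _ KM Kx) addrC.
Qed.

Lemma weak_curl_wcurl E : Hcurl Omega E -> weak_curl Omega E (wcurl Omega E).
Proof. by move=> [_ [c hc]]; exact: (xgetPex (fun=> 0) (ex_intro _ c hc)). Qed.

Lemma ipv_sum D u c : mset3 D -> (forall i, int3 D (fun x => u x 0 i * c x 0 i)) ->
  ipv D u c = \sum_(i < 3) vol_int D (fun x => u x 0 i * c x 0 i).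
Proof. by move=> mD h; rewrite -vol_int_sum//; exact: eq_vol_int. Qed.

(** The form in which equality of weak curls is used: against all fields that are smooth
    on the cells. *)
Definition same_moments c c' := forall K, K \in cells M -> forall i q, C1 q ->
  vol_int (cell_int K) (fun x => c x 0 i * q x) = vol_int (cell_int K) (fun x => c' x 0 i * q x).

Definition pw_C1v u := forall K, K \in cells M ->
  exists2 q : 'I_3 -> rV3 -> R, forall i, C1 (q i) & forall x, cell_int K x -> u x = \row_i q i x.

Lemma same_moments_ipv c c' u : L2v Omega c -> L2v Omega c' -> L2v Omega u ->
  same_moments c c' -> pw_C1v u -> ipv Omega c u = ipv Omega c' u.
Proof.
move=> hc hc' hu h hp.
have i1 i : int3 Omega (fun x => c x 0 i * u x 0 i) by exact: L2M_int3 mO (hc i) (hu i).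
have i2 i : int3 Omega (fun x => c' x 0 i * u x 0 i) by exact: L2M_int3 mO (hc' i) (hu i).
rewrite !ipv_sum//; apply: eq_bigr => i _; rewrite !(vol_int_cells M_tri Omega_dom)//.
apply: eq_bigr => K KM; have [q q1 uq] := hp K KM.
transitivity (vol_int (cell_int K) (fun x => c x 0 i * q i x)).
  by apply: eq_vol_int => x Kx; rewrite uq// mxE.
by rewrite (h K KM i (q i))//; apply: eq_vol_int => x Kx; rewrite uq// mxE.
Qed.

Lemma pw_polyv_C1v k u : pw_polyv M k u -> pw_C1v u.
Proof.
move=> h K KM; have [P dP uP] := h K KM; exists (fun i => mpoly_eval (P i)) => //.
by move=> i; exact: mpoly_eval_C1.
Qed.

Lemma C1v_pw psi : C1v psi -> pw_C1v psi.
Proof.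
by move=> h K KM; exists (fun i x => psi x 0 i) => // x _; apply/rowP => i; rewrite mxE.
Qed.

Lemma C1v_L2v psi : C1v psi -> L2v Omega psi.
Proof. by move=> h i; apply: continuous_L2 => //; exact: C1_continuous (h i). Qed.

Lemma same_moments_curl k E c : L2v Omega E -> pw_polyv M k E -> weak_curl Omega E c ->
  same_moments c (pw_curl E).
Proof. by move=> hE h hc K KM i q q1; exact: weak_curl_cell KM hE h hc q1. Qed.

Lemma same_moments_weak A c c' : weak_curl Omega A c -> weak_curl Omega A c' ->
  same_moments c c'.
Proof.
move=> [hc wc] [hc' wc'] K KM i q q1; have KO := cell_int_Omega M_tri Omega_dom KM.
apply: (@cell_eq_of_test K (fun x => c x 0 i) (fun x => c' x 0 i)) => //.
- by apply: L2_int3 => //; exact: hc.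
- by apply: L2_int3 => //; exact: hc'.
move=> phi /(testS KO)/(vtest_test i) t; have := wc _ t; rewrite wc' //.
have E0 c0 : ipv Omega c0 (vtest i phi) = ips Omega (fun x => c0 x 0 i) phi.
  by apply: eq_vol_int => x _; exact: dot_vtest.
by rewrite !E0.
Qed.

Lemma H0curl_green k E psi : H0curl Omega E -> pw_polyv M k E -> C1v psi ->
  ipv Omega (pw_curl E) psi = ipv Omega E (curl psi).
Proof.
move=> [hc g0] h psi1; have [hE _] := hc; have wc := weak_curl_wcurl hc.
have := g0 psi psi1; rewrite (@same_moments_ipv _ (pw_curl E)).
- by move=> /eqP; rewrite subr_eq0 => /eqP.
- by case: wc.
- exact: pw_curl_L2v h.
- exact: C1v_L2v.
- exact: same_moments_curl h wc.
- exact: C1v_pw.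
Qed.

(** A gradient is an admissible test field and its curl vanishes, so the curl of an
    H0(curl) field is orthogonal to the gradients of bubbles. *)
Lemma curl_conforming k E : H0curl Omega E -> pw_polyv M k.+1 E ->
  [/\ balanced M (pw_curl E), H0div Omega (pw_curl E)
    & weak_div Omega (pw_curl E) (fun=> 0)].
Proof.
move=> hE h; have hp := pw_polyv_curl h; have hL := pw_curl_L2v h; have dC := divfree_curl h.
have D0 : pw_div M (pw_curl E) = fun=> 0.
  apply/funext => x; rewrite /pw_div /on_cells big1// => K KM; rewrite patchE.
  by case: ifPn => // /set_mem Kx; exact: dC KM x Kx.
have b : balanced M (pw_curl E).
  move=> e ce x hx; apply: (fjump_eq0 M_tri Omega_dom hL hp) => // x0 r r0.
  have b1 : C1v (grad (bubble x0 r)) by move=> j; exact: C1_grad_bubble.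
  have := H0curl_green hE h b1.
  rewrite [RHS](vol_int_eq0) => [h0|y _]; last by rewrite /dotf curl_grad_bubble dot0r.
  rewrite -[RHS]h0; apply: eq_vol_int => y _.
  by rewrite D0 mul0r addr0.
by have := weak_div_green M_tri Omega_dom hL hp b; rewrite D0 => -[].
Qed.

End PiecewiseCurl.

(** * Landau's kernel *)

Section LandauKernel.
Variable R : realType.
Notation rV3 := 'rV[R]_3.
Notation leb := (leb3 R).
Implicit Types (x y h : rV3) (f g c : rV3 -> R) (k : rV3 -> rV3 -> R) (D : set rV3).

(** For such kernels, Fubini's theorem and differentiation under the integral sign are
    statements on finite sums. *)
Definition separable k := exists (I : finType) (p q : I -> rV3 -> R),
  [/\ forall i, C1 (p i), forall i, C1 (q i) & forall x y, k x y = \sum_i p i x * q i y].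

Lemma separable_fst f : C1 f -> separable (fun x _ => f x).
Proof.
move=> f1; exists unit, (fun _ => f), (fun _ _ => 1); split=> // [_|x y]; first exact: C1_cst.
by rewrite (big_pred1 tt) ?mulr1// => -[].
Qed.

Lemma separable_snd f : C1 f -> separable (fun _ y => f y).
Proof.
move=> f1; exists unit, (fun _ _ => 1), (fun _ => f); split=> // [_|x y]; first exact: C1_cst.
by rewrite (big_pred1 tt) ?mul1r// => -[].
Qed.

Lemma separableD k k' : separable k -> separable k' -> separable (fun x y => k x y + k' x y).
Proof.
move=> [I [p [q [p1 q1 kE]]]] [J [p' [q' [p1' q1' kE']]]].
exists (I + J)%type, (fun s => match s with inl i => p i | inr j => p' j end),
  (fun s => match s with inl i => q i | inr j => q' j end).
split; [by case|by case|move=> x y].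
by rewrite big_sumType /= kE kE'.
Qed.

Lemma separableM k k' : separable k -> separable k' -> separable (fun x y => k x y * k' x y).
Proof.
move=> [I [p [q [p1 q1 kE]]]] [J [p' [q' [p1' q1' kE']]]].
exists (I * J)%type, (fun s x => p s.1 x * p' s.2 x), (fun s y => q s.1 y * q' s.2 y).
split=> [s|s|x y]; try exact: C1M.
rewrite kE kE' mulr_suml -(pair_bigA _ (fun i j => p i x * p' j x * (q i y * q' j y))) /=.
by apply: eq_bigr => i _; rewrite mulr_sumr; apply: eq_bigr => j _; ring.
Qed.

Lemma separableX k n : separable k -> separable (fun x y => k x y ^+ n).
Proof.
move=> sk; elim: n => [|n IH]; first exact: (@separable_fst (fun=> 1) (@C1_cst R 1)).
have -> : (fun x y => k x y ^+ n.+1) = (fun x y => k x y * k x y ^+ n).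
  by apply/funext => x; apply/funext => y; rewrite exprS.
exact: separableM.
Qed.

Lemma separable_sum (k : 'I_3 -> rV3 -> rV3 -> R) : (forall i, separable (k i)) ->
  separable (fun x y => \sum_(i < 3) k i x y).
Proof.
move=> sk; have -> : (fun x y => \sum_(i < 3) k i x y) = (fun x y => k 0 x y + k 1 x y + k 2 x y).
  by apply/funext => x; apply/funext => y; rewrite sum3.
by apply: separableD => //; exact: separableD.
Qed.

(** Landau's kernel up to normalisation: as n grows it concentrates near the diagonal. *)
Definition landau (r : R) n x y := paraboloid y r x ^+ n.

Lemma landau_sym r n x y : landau r n x y = landau r n y x.
Proof.
by congr (_ ^+ _); congr (_ - _); apply: eq_bigr => i _; rewrite -sqrrN opprB.
Qed.

Lemma landau_separable r n : separable (landau r n).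
Proof.
apply: separableX; rewrite /paraboloid.
apply: (@separableD (fun _ _ => r ^+ 2) (fun x y => - \sum_(i < 3) (x 0 i - y 0 i) ^+ 2)).
  exact: (separable_fst (@C1_cst R (r ^+ 2))).
have -> : (fun x y => - \sum_(i < 3) (x 0 i - y 0 i) ^+ 2) =
    (fun x y : rV3 => - 1 * \sum_(i < 3) (x 0 i + - 1 * y 0 i) ^+ 2).
  by apply/funext => x; apply/funext => y; rewrite mulN1r; congr (- _); apply: eq_bigr => i _; rewrite mulN1r.
apply: (@separableM (fun _ _ => - 1)); first exact: (separable_fst (@C1_cst R (-1))).
apply: separable_sum => i; apply: separableX.
apply: (@separableD (fun x _ => x 0 i) (fun _ y => - 1 * y 0 i)).
  exact: (separable_fst (@C1_coord R i)).
by apply: (@separable_snd (fun y => - 1 * y 0 i)); apply: C1Z; exact: C1_coord.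
Qed.

Lemma landau_C1 r n y : C1 (fun x => landau r n x y).
Proof. by apply: C1X; exact: paraboloid_C1. Qed.

Lemma pd_landau r n i x y :
  pd i (fun z => landau r n z y) x = - pd i (landau r n x) y.
Proof.
have -> : landau r n x = (fun z => landau r n z x) by apply/funext => z; rewrite landau_sym.
elim: n => [|n IH].
  have -> (w : rV3) : (fun z => landau r 0 z w) = fun=> 1.
    by apply/funext => z; rewrite /landau expr0.
  by rewrite !pd_cst oppr0.
have E (w : rV3) : (fun z => landau r n.+1 z w) = (fun z => paraboloid w r z * landau r n z w).
  by apply/funext => z; rewrite /landau exprS.
rewrite !E.
have D (w z : rV3) : differentiable (paraboloid w r) z by case: (paraboloid_C1 w r).
have D' (w z : rV3) : differentiable (fun t => landau r n t w) z by case: (landau_C1 r n w).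
rewrite !pdM// !pd_paraboloid IH (landau_sym r n x y).
have := landau_sym r 1 x y; rewrite /landau !expr1 => ->; ring.
Qed.

Lemma vol_int_reflect x D g : mset3 D -> int3 D g ->
  vol_int [set y | D (x - y)] (fun y => g (x - y)) = vol_int D g.
Proof.
move=> mD ig; pose a : R * R * R := (-1, 0, 0); pose b : R * R * R := (0, -1, 0).
pose d : R * R * R := (0, 0, -1); pose T := affine3 (xyz x) a b d.
have d1 : det3 a b d = -1 by rewrite /det3 /=; ring.
have cT : changes_volume T 1.
  rewrite -[X in changes_volume _ X]invr1 -[X in X^-1](normr1 R) -(normrN 1) -d1.
  by apply: changes_volume_affine; rewrite d1 oppr_eq0 oner_eq0.
have TE p : vec3 (T p) = x - vec3 p.
  by apply: row3P; rewrite !mxE /T /affine3 /=; ring.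
rewrite /vol_int; have := Rintegral_rescales cT mD ig; rewrite mul1r => <-.
have -> : T @^-1` (@vec3 R @^-1` D) = @vec3 R @^-1` [set y | D (x - y)].
  by apply/seteqP; split=> p; rewrite /preimage /= TE.
by apply: eq_Rintegral => p _ /=; rewrite TE.
Qed.

Lemma mset_reflect x D : open D -> mset3 [set y | D (x - y)].
Proof.
move=> oD; apply: open_measurable3; apply: open_comp oD => y _.
move: y; apply: (@eq_continuous_fun _ _ (fun t : rV3 => \row_i (x 0 i - t 0 i) : rV3)) => [y|].
  by apply/rowP => i; rewrite !mxE.
apply: continuous_row => i; apply: C1_continuous.
by apply: C1B; [exact: C1_cst|exact: C1_coord].
Qed.

Lemma paraboloid_le r d h : 0 <= d -> d <= `|h| -> paraboloid 0 r h <= r ^+ 2 - d ^+ 2.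
Proof.
move=> d0 dh; rewrite lerD2l lerN2.
have [i hi] : exists i, d <= `|h 0 i|.
  apply: contrapT => H; have : `|h| < d.
    have [d00|dp] := eqVneq d 0; last first.
      have := @ball_rowP R 0 h d (_ : 0 < d); rewrite lt_neqAle eq_sym dp d0.
      move=> /(_ isT) [_ B]; have : ball 0 d h.
        apply: B => i; rewrite mxE sub0r normrN ltNge; apply/negP => hi; apply: H.
        by exists i.
      by rewrite -ball_normE /= sub0r normrN.
    by exfalso; apply: H; exists 0; rewrite d00.
  by rewrite ltNge dh.
rewrite (bigD1 i)//= mxE subr0; apply: le_trans (_ : h 0 i ^+ 2 <= _); last first.
  by rewrite lerDl sumr_ge0// => j _; exact: sqr_ge0.
by rewrite -[leRHS]real_normK ?num_real// ler_sqr ?nnegrE.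
Qed.

Lemma paraboloid_ge r d h : `|h| <= d -> r ^+ 2 - 3 * d ^+ 2 <= paraboloid 0 r h.
Proof.
move=> hd; rewrite lerD2l lerN2 sum3.
have H i : (h 0 i - (0 : rV3) 0 i) ^+ 2 <= d ^+ 2.
  have hi := le_trans (le_coord_norm h i) hd.
  rewrite mxE subr0 -[leLHS]real_normK ?num_real// ler_sqr ?nnegrE//.
  exact: le_trans hi.
by have := H 0; have := H 1; have := H 2; lra.
Qed.

Variable rad : R.
Hypothesis rad_gt0 : 0 < rad.

Let B0 : set rV3 := ball 0 (2 * rad).
Let r := 4 * rad.

(** The sup norm of x - y is less than 2 rad, so the Euclidean norm is less than r = 4
    rad. *)
Lemma landau_ge0 n x y : B0 (x - y) -> 0 <= landau r n x y.
Proof.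
rewrite /B0 -ball_normE /= sub0r normrN => h; apply: exprn_ge0.
have -> : paraboloid y r x = paraboloid 0 r (x - y).
  by congr (_ - _); apply: eq_bigr => i _; rewrite !mxE subr0.
by apply: le_trans (paraboloid_ge r (ltW h)); rewrite /r; nra.
Qed.

Definition landau_mass n := vol_int B0 (fun h => landau r n h 0).

Lemma mset_B0 : mset3 B0.
Proof. by apply: open_measurable3; exact: ball_open. Qed.

Lemma bounded_B0 : bounded_set B0.
Proof.
apply: (@bounded_set_le _ _ (2 * rad)) => x; rewrite /B0 -ball_normE /= sub0r normrN.
exact: ltW.
Qed.

Lemma int3_landau n y D : mset3 D -> bounded_set D -> int3 D (fun x => landau r n x y).
Proof. by move=> mD bD; apply: continuous_int3 => //; exact: C1_continuous (landau_C1 r n y). Qed.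

Lemma vol_int_le D f g : mset3 D -> int3 D f -> int3 D g -> (forall x, D x -> f x <= g x) ->
  vol_int D f <= vol_int D g.
Proof.
move=> mD hf hg h; rewrite -subr_ge0 -vol_intB//; apply: vol_int_ge0 => x Dx.
by rewrite subr_ge0 h.
Qed.

Lemma vol_int_subset D D' f : mset3 D -> mset3 D' -> D' `<=` D -> int3 D f ->
  (forall x, D x -> 0 <= f x) -> vol_int D' f <= vol_int D f.
Proof.
move=> mD mD' DD hf f0; rewrite -(vol_int_patch f DD); apply: vol_int_le => //.
  by apply: int3_patch => //; exact: int3S hf.
by move=> x Dx; rewrite patchE; case: ifP => // _; exact: f0.
Qed.

(** A lower bound that decays more slowly than the values (r^2 - d^2)^n of the kernel at
    distance d. *)
Lemma landau_mass_ge d n : 0 < d -> d <= rad ->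
  (r ^+ 2 - 3 * (d / 2) ^+ 2) ^+ n * vol_int (ball 0 (d / 2)) (fun=> 1) <= landau_mass n.
Proof.
move=> d0 dr; have m1 : mset3 (ball (0 : rV3) (d / 2)) by apply: open_measurable3; exact: ball_open.
have sub : ball (0 : rV3) (d / 2) `<=` B0 by apply: le_ball; lra.
have b1 : bounded_set (ball (0 : rV3) (d / 2)) := bounded_setS sub bounded_B0.
have i1 : int3 (ball (0 : rV3) (d / 2)) (fun=> 1).
  by apply: continuous_int3 => //; exact: continuous_cst.
rewrite -vol_intZ// /landau_mass.
apply: le_trans (_ : vol_int (ball 0 (d / 2)) (fun h => landau r n h 0) <= _); last first.
  apply: vol_int_subset => //; first exact: mset_B0.
    by apply: int3_landau; [exact: mset_B0|exact: bounded_B0].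
  by move=> h Bh; apply: landau_ge0; rewrite subr0.
apply: vol_int_le => //; [exact: int3Z|exact: int3_landau|].
move=> h; rewrite -ball_normE /= sub0r normrN mulr1 => hd.
rewrite /landau lerXn2r ?nnegrE//.
- by rewrite /r; nra.
- by apply: le_trans (paraboloid_ge r (ltW hd)); rewrite /r; nra.
- exact: paraboloid_ge (ltW hd).
Qed.

Lemma ball_vol_gt0 d : 0 < d -> 0 < vol_int (ball (0 : rV3) d) (fun=> 1).
Proof.
move=> d0; have m1 : mset3 (ball (0 : rV3) d) by apply: open_measurable3; exact: ball_open.
have b1 : bounded_set (ball (0 : rV3) d).
  by apply: (@bounded_set_le _ _ d) => x; rewrite -ball_normE /= sub0r normrN => /ltW.
rewrite /vol_int Rintegral_cst// mul1r; apply: fine_gt0; apply/andP; split.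
  by apply: (@open_leb_gt0 _ _ 0); [exact: ball_open|exact: ballxx].
exact: bounded_lebesgue.
Qed.

Lemma landau_mass_gt0 n : 0 < landau_mass n.
Proof.
apply: lt_le_trans (landau_mass_ge n rad_gt0 (lexx _)).
rewrite mulr_gt0 ?ball_vol_gt0 ?divr_gt0// exprn_gt0//.
have r2 : 0 < rad ^+ 2 by rewrite exprn_gt0.
have -> : r ^+ 2 - 3 * (rad / 2) ^+ 2 = (61 / 4) * rad ^+ 2 by rewrite /r; field.
by rewrite mulr_gt0// divr_gt0.
Qed.

Lemma landau_mass_reflect n x :
  vol_int [set y | B0 (x - y)] (fun y => landau r n x y) = landau_mass n.
Proof.
rewrite /landau_mass -(vol_int_reflect x mset_B0); last first.
  by apply: int3_landau; [exact: mset_B0|exact: bounded_B0].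
apply: eq_vol_int => y _; congr (_ ^+ _); congr (_ - _).
by apply: eq_bigr => i _; rewrite !mxE subr0.
Qed.

End LandauKernel.

(** * Symmetry of the curl *)

Lemma quotient_bound (R : realType) (a V vb Pn Qn e m : R) : 0 < vb -> 0 < Qn -> 0 <= e ->
  Qn * vb <= m -> (a * V / vb) * (Pn / Qn) < e -> a * Pn * V <= e * m.
Proof.
move=> vb0 Q0 e0 mg /ltW h; apply: le_trans (_ : e * (Qn * vb) <= _); last by rewrite ler_wpM2l.
have := h; rewrite -(@ler_pM2r _ (Qn * vb)) ?mulr_gt0//; apply: le_trans.
by rewrite le_eqVlt; apply/orP; left; apply/eqP; field; rewrite !gt_eqF.
Qed.

Section Smoothing.
Variable R : realType.
Notation rV3 := 'rV[R]_3.
Variables (Omega : set rV3) (rad : R).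
Hypothesis openO : open Omega.
Hypothesis rad_gt0 : 0 < rad.
Hypothesis O_rad : forall x, Omega x -> `|x| < rad.
Implicit Types (x y h : rV3) (f g c : rV3 -> R) (a b u psi : rV3 -> rV3).
Notation kernel := (landau (4 * rad)).
Notation mass := (landau_mass rad).

Let mO : mset3 Omega := open_measurable3 openO.
Let bO : bounded_set Omega.
Proof. by apply: (@bounded_set_le _ _ rad) => x /O_rad/ltW. Qed.

Let B0 (x : rV3) := [set y | ball (0 : rV3) (2 * rad) (x - y)].

Lemma Omega_sub_ball x : Omega x -> Omega `<=` B0 x.
Proof.
move=> Ox y Oy; rewrite /B0 /= -ball_normE /= sub0r normrN.
apply: le_lt_trans (ler_normB _ _) _; have := O_rad Ox; have := O_rad Oy; lra.
Qed.

Let mB x : mset3 (B0 x).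
Proof. by apply: mset_reflect; exact: ball_open. Qed.

Let bB x : bounded_set (B0 x).
Proof.
apply: (@bounded_set_le _ _ (`|x| + 2 * rad)) => y; rewrite /B0 /= -ball_normE /= sub0r normrN => h.
rewrite -[y](subKr x) (le_trans (ler_normB _ _))// lerD2l ltW//.
Qed.

Let kernel_ge0 n x y : B0 x y -> 0 <= kernel n x y.
Proof. exact: landau_ge0. Qed.

Let kernel_swap_C1 n x : C1 (kernel n x).
Proof.
have -> : kernel n x = (fun y => kernel n y x) by apply/funext => y; rewrite landau_sym.
exact: landau_C1.
Qed.

Lemma int3_C1M D f g : mset3 D -> bounded_set D -> C1 f -> int3 D g -> int3 D (fun x => f x * g x).
Proof.
move=> mD bD f1 ig; have [B B0' hB] := continuous_bounded bD (C1_continuous f1).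
apply: (eq_int3 (f := fun x => g x * f x)) => // [x _|]; first by rewrite mulrC.
apply: (int3M_bounded (M := B)) => //; apply: mfun3_continuous; exact: C1_continuous.
Qed.

Definition smooth n c x := (mass n)^-1 * vol_int Omega (fun y => kernel n x y * c y).

Lemma kernel_mass n x : vol_int (B0 x) (kernel n x) = mass n.
Proof. exact: landau_mass_reflect. Qed.

Lemma smooth_le n c B x : int3 Omega c -> 0 <= B -> (forall y, Omega y -> `|c y| <= B) ->
  Omega x -> `|smooth n c x| <= B.
Proof.
move=> ic B_ge0 cB Ox; have m0 := landau_mass_gt0 rad_gt0 n.
rewrite /smooth normrM normfV (gtr0_norm m0) ler_pdivrMl//.
have ik : int3 (B0 x) (kernel n x) by apply: continuous_int3 => //; exact: C1_continuous.
have sO := Omega_sub_ball Ox; have ikO : int3 Omega (kernel n x) by exact: int3S ik.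
have le1 : vol_int Omega (kernel n x) <= mass n.
  by rewrite -(kernel_mass n x); apply: vol_int_subset => // y; exact: kernel_ge0.
apply: le_trans (_ : B * vol_int Omega (kernel n x) <= _); last by rewrite [leRHS]mulrC ler_wpM2l.
have ikc : int3 Omega (fun y => kernel n x y * c y) by exact: int3_C1M.
rewrite ler_norml; apply/andP; split.
  rewrite -mulNr -vol_intZ//; apply: vol_int_le => //; first exact: int3Z.
  move=> y Oy; rewrite [leLHS]mulrC -subr_ge0 -mulrBr mulr_ge0// ?kernel_ge0//; first exact: sO.
  by have := cB y Oy; rewrite ler_norml => /andP[]; lra.
rewrite -vol_intZ//; apply: vol_int_le => //; first exact: int3Z.
move=> y Oy; rewrite [leRHS]mulrC -subr_ge0 -mulrBr mulr_ge0// ?kernel_ge0//; first exact: sO.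
by have := cB y Oy; rewrite ler_norml => /andP[]; lra.
Qed.

(** At distance at least d from x the kernel is at most (r^2 - d^2)^n, while its mass is
    at least a multiple of (r^2 - 3 d^2 / 4)^n: only the values of c near x matter. *)
Lemma smooth_cvg c B x : int3 Omega c -> 0 <= B -> (forall y, Omega y -> `|c y| <= B) ->
  Omega x -> {for x, continuous c} -> (fun n => smooth n c x) @ \oo --> c x.
Proof.
move=> ic B_ge0 cB Ox cc; apply/cvgrPdist_le => e e0.
have e20 : 0 < e / 2 by rewrite divr_gt0.
have near1 : \forall y \near x, `|c x - c y| < e / 2 by move/cvgrPdist_lt: cc; apply.
have near2 : \forall y \near x, Omega y by exact: open_nbhs_nbhs.
have [d1 /= d10 hd1] := (nbhs_ballP x _).1 (filterI near1 near2).
pose d := Num.min d1 rad.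
have d0 : 0 < d by rewrite lt_min d10.
have [dd dr] : d <= d1 /\ d <= rad by rewrite !ge_min !lexx orbT.
have hd y : `|x - y| < d -> `|c x - c y| < e / 2 /\ Omega y.
  by move=> h; apply: hd1; rewrite -ball_normE /=; exact: lt_le_trans dd.
set r := 4 * rad; pose P := r ^+ 2 - d ^+ 2; pose Q := r ^+ 2 - 3 * (d / 2) ^+ 2.
have r2 : d ^+ 2 <= rad ^+ 2 by rewrite ler_sqr ?nnegrE// ltW.
have d2 : 0 < d ^+ 2 by rewrite exprn_gt0.
have P0 : 0 < P by rewrite /P /r exprMn; lra.
have PQ : P < Q by rewrite /P /Q (_ : (d / 2) ^+ 2 = d ^+ 2 / 4); [lra|field].
have Q0 : 0 < Q by exact: lt_trans PQ.
pose vb := vol_int (ball (0 : rV3) (d / 2)) (fun=> 1).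
have vb0 : 0 < vb by apply: ball_vol_gt0; rewrite divr_gt0.
pose V := vol_int (B0 x) (fun=> 1).
have V0 : 0 <= V by apply: vol_int_ge0.
have cv : (fun n => (2 * B * V / vb) * (P / Q) ^+ n) @ \oo --> (2 * B * V / vb) * 0.
  apply: cvgM; first exact: cvg_cst.
  by apply: cvg_expr; rewrite ger0_norm ?ltr_pdivrMr ?mul1r// divr_ge0// ltW.
rewrite mulr0 in cv.
near=> n.
have near3 : (2 * B * V / vb) * (P / Q) ^+ n < e / 2.
  by near: n; exact: (cvgr_lt _ cv).
have m0 := landau_mass_gt0 rad_gt0 n.
have ik : int3 (B0 x) (kernel n x) by apply: continuous_int3 => //; exact: C1_continuous.
have sO := Omega_sub_ball Ox.
(* Extended by 0, c is integrated over the ball of x, on which the kernel has its full mass. *)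
pose ct y := (c \_ Omega) y - c x.
have ict : int3 (B0 x) ct.
  apply: int3B => //; first exact: int3_patch.
  by apply: continuous_int3 => //; exact: continuous_cst.
have ikc : int3 (B0 x) (fun y => kernel n x y * ct y) by exact: int3_C1M.
have E : smooth n c x - c x = (mass n)^-1 * vol_int (B0 x) (fun y => kernel n x y * ct y).
  have -> : vol_int (B0 x) (fun y => kernel n x y * ct y) =
      vol_int (B0 x) (fun y => kernel n x y * (c \_ Omega) y) - c x * vol_int (B0 x) (kernel n x).
    rewrite -vol_intZ// -vol_intB//.
    - by apply: eq_vol_int => y _; rewrite /ct; ring.
    - by apply: int3_C1M => //; exact: int3_patch.
    - exact: int3Z.
  rewrite kernel_mass mulrBr mulrCA mulVf ?gt_eqF// mulr1; congr (_ * _ - _).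
  symmetry; rewrite (@vol_int_supp _ _ Omega)//.
    by apply: eq_vol_int => y Oy; rewrite patchE mem_set.
  by move=> y _ nO; rewrite patchE memNset// mulr0.
pose bd y := (e / 2) * kernel n x y + 2 * B * P ^+ n.
have ibd : int3 (B0 x) bd.
  apply: int3D => //; first exact: int3Z.
  by apply: continuous_int3 => //; exact: continuous_cst.
have hbd y : B0 x y -> `|kernel n x y * ct y| <= bd y.
  move=> By; have k0 := kernel_ge0 n By; rewrite normrM (ger0_norm k0) /bd.
  have Pn : 0 <= 2 * B * P ^+ n by rewrite !mulr_ge0// exprn_ge0// ltW.
  have [hy|hy] := ltP `|x - y| d.
    have [h1 Oy] := hd y hy; rewrite /ct patchE mem_set// distrC.
    have : kernel n x y * `|c x - c y| <= e / 2 * kernel n x y.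
      by rewrite [leRHS]mulrC ler_wpM2l// ltW.
    lra.
  have kP : kernel n x y <= P ^+ n.
    rewrite /landau.
    have -> : paraboloid y r x = paraboloid 0 r (x - y).
      by congr (_ - _); apply: eq_bigr => i _; rewrite !mxE subr0.
    rewrite lerXn2r ?nnegrE//; last exact: paraboloid_le (ltW d0) hy.
      have := By; rewrite /B0 /= -ball_normE /= sub0r normrN => /ltW/(paraboloid_ge r).
      by apply: le_trans; rewrite /r !exprMn; lra.
    exact: ltW.
  have ctB : `|ct y| <= 2 * B.
    apply: le_trans (ler_normB _ _) _; have := cB x Ox.
    rewrite patchE; case: ifPn => [/set_mem/cB|_]; first by lra.
    by rewrite normr0; lra.
  have : kernel n x y * `|ct y| <= P ^+ n * (2 * B) by apply: ler_pM.
  have : 0 <= e / 2 * kernel n x y by rewrite mulr_ge0// ltW.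
  lra.
rewrite distrC E normrM normfV (gtr0_norm m0) ler_pdivrMl//.
have L : `|vol_int (B0 x) (fun y => kernel n x y * ct y)| <= vol_int (B0 x) bd.
  rewrite ler_norml; apply/andP; split.
    rewrite -mulN1r -vol_intZ//; apply: vol_int_le => //; first exact: int3Z.
    by move=> y /hbd; rewrite mulN1r ler_norml => /andP[].
  by apply: vol_int_le => // y /hbd; rewrite ler_norml => /andP[].
apply: le_trans L _.
have -> : vol_int (B0 x) bd = e / 2 * mass n + 2 * B * P ^+ n * V.
  rewrite vol_intD//; last first.
  - by apply: continuous_int3 => //; exact: continuous_cst.
  - exact: int3Z.
  rewrite vol_intZ// kernel_mass; congr (_ + _).
  rewrite -vol_intZ//; first by apply: eq_vol_int => y _; rewrite mulr1.
  by apply: continuous_int3 => //; exact: continuous_cst.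
have mg : Q ^+ n * vb <= mass n by exact: landau_mass_ge.
have Qn : 0 < Q ^+ n by rewrite exprn_gt0.
have : 2 * B * P ^+ n * V <= e / 2 * mass n.
  apply: (@quotient_bound _ (2 * B) V vb (P ^+ n) (Q ^+ n)) mg _; [exact: vb0|exact: Qn|exact: ltW|].
  by rewrite -expr_div_n; exact: near3.
lra.
Unshelve. all: by end_near. Qed.

Lemma smooth_expansion n : exists (I : finType) (p q : I -> rV3 -> R),
  [/\ forall i, C1 (p i), forall i, C1 (q i),
      forall x y, kernel n x y = \sum_i p i x * q i y
    & forall c, int3 Omega c -> forall x,
        vol_int Omega (fun y => kernel n x y * c y)
        = \sum_i p i x * vol_int Omega (fun y => q i y * c y)].
Proof.
have [I [p [q [p1 q1 kE]]]] := landau_separable (4 * rad) n.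
exists I, p, q; split=> // c ic x.
transitivity (vol_int Omega (fun y => \sum_(i <- index_enum I) p i x * (q i y * c y))).
  apply: eq_vol_int => y _; rewrite kE mulr_suml.
  by apply: eq_bigr => i _; rewrite mulrA.
rewrite vol_int_sum//; last by move=> i _; apply: int3Z => //; exact: int3_C1M.
by apply: eq_bigr => i _; rewrite vol_intZ//; exact: int3_C1M.
Qed.

Lemma smooth_C1 n c : int3 Omega c -> C1 (smooth n c).
Proof.
move=> ic; have [I [p [q [p1 q1 kE E]]]] := smooth_expansion n.
apply: C1Z; rewrite (_ : (fun x => _) = fun x => \sum_i p i x * vol_int Omega (fun y => q i y * c y)).
  by apply: C1_sum => i _; apply: C1M => //; exact: C1_cst.
by apply/funext => x; exact: E.
Qed.

(** The kernel depends on x - y: derivatives pass under the integral with a sign. *)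
Lemma pd_smooth n c j x : int3 Omega c ->
  pd j (smooth n c) x = - (mass n)^-1 * vol_int Omega (fun y => pd j (kernel n x) y * c y).
Proof.
move=> ic; have [I [p [q [p1 q1 kE E]]]] := smooth_expansion n.
have -> : smooth n c = fun x => (mass n)^-1 * \sum_i p i x * vol_int Omega (fun y => q i y * c y).
  by apply/funext => z; rewrite /smooth E.
have C1i i : C1 (fun x => p i x * vol_int Omega (fun y => q i y * c y)).
  by apply: C1M => //; exact: C1_cst.
rewrite pdZ; last by case: (@C1_sum R _ (index_enum I) xpredT _ (fun i _ => C1i i)).
rewrite mulNr -mulrN; congr (_ * _); rewrite pd_sum//.
transitivity (\sum_i pd j (p i) x * vol_int Omega (fun y => q i y * c y)).
  apply: eq_bigr => i _; rewrite pdM; [|by case: (p1 i)|by case: (@C1_cst R (vol_int Omega (fun y => q i y * c y)))].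
  by rewrite pd_cst mulr0 add0r mulrC.
have kx y : pd j (fun z => kernel n z y) x = \sum_i pd j (p i) x * q i y.
  rewrite (_ : (fun z => kernel n z y) = fun z => \sum_i q i y * p i z); last first.
    by apply/funext => z; rewrite kE; apply: eq_bigr => i _; rewrite mulrC.
  rewrite pd_sum; last by move=> i _; exact: C1Z.
  by apply: eq_bigr => i _; have [dp _] := p1 i; rewrite (pdZ _ _ (dp x)) mulrC.
transitivity (vol_int Omega (fun y => \sum_(i <- index_enum I) pd j (p i) x * (q i y * c y))).
  rewrite vol_int_sum//; last by move=> i _; apply: int3Z => //; exact: int3_C1M.
  by apply: eq_bigr => i _; rewrite vol_intZ//; exact: int3_C1M.
rewrite -mulN1r -vol_intZ//.
  apply: eq_vol_int => y _; rewrite mulN1r -mulNr -pd_landau kx mulr_suml.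
  by apply: eq_bigr => i _; rewrite mulrA.
apply: (eq_int3 (f := fun y => - \sum_(i <- index_enum I) pd j (p i) x * (q i y * c y))) => //.
  move=> y _; rewrite -[pd j _ y]opprK -pd_landau kx mulNr mulr_suml; congr (- _).
  by apply: eq_bigr => i _; rewrite mulrA.
apply: (eq_int3 (f := fun y => - 1 * \sum_(i <- index_enum I) pd j (p i) x * (q i y * c y))) => //.
  by move=> y _; rewrite mulN1r.
apply: int3Z => //; apply: int3_sum => // i _; apply: int3Z => //; exact: int3_C1M.
Qed.

Lemma smooth_adjoint n f g : int3 Omega f -> int3 Omega g ->
  ips Omega f (smooth n g) = ips Omega (smooth n f) g.
Proof.
move=> hf hg; have [I [p [q [p1 q1 kE E]]]] := smooth_expansion n.
have ih t (h : rV3 -> R) : C1 t -> int3 Omega h -> int3 Omega (fun x => t x * h x) by exact: int3_C1M.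
transitivity ((mass n)^-1 * \sum_i vol_int Omega (fun x => p i x * f x) * vol_int Omega (fun y => q i y * g y)).
  transitivity (vol_int Omega (fun x => (mass n)^-1 *
      \sum_(i <- index_enum I) vol_int Omega (fun y => q i y * g y) * (p i x * f x))).
    apply: eq_vol_int => x _; rewrite /smooth E// mulrCA mulr_sumr; congr (_ * _).
    by apply: eq_bigr => i _; ring.
  rewrite vol_intZ//; last by apply: int3_sum => // i _; apply: int3Z => //; exact: ih.
  rewrite vol_int_sum//; last by move=> i _; apply: int3Z => //; exact: ih.
  by congr (_ * _); apply: eq_bigr => i _; rewrite vol_intZ 1?mulrC//; exact: ih.
transitivity (vol_int Omega (fun y => (mass n)^-1 *
    \sum_(i <- index_enum I) vol_int Omega (fun x => p i x * f x) * (q i y * g y))).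
  rewrite vol_intZ//; last by apply: int3_sum => // i _; apply: int3Z => //; exact: ih.
  rewrite vol_int_sum//; last by move=> i _; apply: int3Z => //; exact: ih.
  by congr (_ * _); apply: eq_bigr => i _; rewrite vol_intZ//; exact: ih.
apply: eq_vol_int => y _; rewrite /smooth -mulrA; congr (_ * _).
have -> : vol_int Omega (fun x => kernel n y x * f x) = \sum_i q i y * vol_int Omega (fun x => p i x * f x).
  transitivity (vol_int Omega (fun x => \sum_(i <- index_enum I) q i y * (p i x * f x))).
    apply: eq_vol_int => x _; rewrite landau_sym kE mulr_suml.
    by apply: eq_bigr => i _; ring.
  rewrite vol_int_sum//; last by move=> i _; apply: int3Z => //; exact: ih.
  by apply: eq_bigr => i _; rewrite vol_intZ//; exact: ih.
by rewrite mulr_suml; apply: eq_bigr => i _; ring.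
Qed.

Definition smoothv n u : rV3 -> rV3 := fun x => \row_i smooth n (fun y => u y 0 i) x.

Lemma int3_L2v u i : L2v Omega u -> int3 Omega (fun x => u x 0 i).
Proof. by move=> hu; apply: L2_int3 => //; exact: hu. Qed.

Lemma smoothv_C1 n u : L2v Omega u -> C1v (smoothv n u).
Proof.
move=> hu i; rewrite (_ : (fun x => _) = smooth n (fun y => u y 0 i)).
  by apply: smooth_C1; exact: int3_L2v.
by apply/funext => x; rewrite mxE.
Qed.

(** For fixed x the kernel times e_i is an admissible test field in y. *)
Lemma curl_smoothv n b (c : rV3 -> rV3) : L2v Omega b ->
  (forall psi, C1v psi -> ipv Omega b (curl psi) = ipv Omega c psi) ->
  curl (smoothv n b) = smoothv n c.
Proof.
move=> hb h; apply/funext => x; apply/rowP => i; rewrite !mxE.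
have S j : (fun y => smoothv n b y 0 j) = smooth n (fun y => b y 0 j).
  by apply/funext => y; rewrite mxE.
have ib j := int3_L2v j hb.
have idk j l : int3 Omega (fun y => pd j (kernel n x) y * b y 0 l).
  apply: (eq_int3 (f := fun y => b y 0 l * pd j (kernel n x) y)) => // [y _|]; first by rewrite mulrC.
  have [_ ck] := kernel_swap_C1 n x.
  have [B B0' hB] := continuous_bounded bO (ck j).
  by apply: (int3M_bounded (M := B)) => //; exact: mfun3_continuous.
rewrite !S !pd_smooth// -mulrBr -vol_intB// mulNr -mulrN.
rewrite /smooth; congr (_ * _).
transitivity (ipv Omega b (curl (vtest i (kernel n x)))).
  rewrite -mulN1r -vol_intZ//; last exact: int3B.
  apply: eq_vol_int => y _; rewrite /dotf -[RHS]opprK -(dot_cross_grad _ _ _ (kernel_swap_C1 n x)).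
  rewrite dot_cross_delta !mxE; move: (pd _ _ y) (pd _ _ y) (b y 0 _) (b y 0 _) => d1 d2 e1 e2.
  by ring.
rewrite h; last exact: vtest_C1.
by apply: eq_vol_int => y _; rewrite /dotf dot_vtest mulrC.
Qed.

Definition approximable c := [/\ int3 Omega c, exists2 B, 0 <= B & forall x, Omega x -> `|c x| <= B
  & ae_on Omega (fun x => {for x, continuous c})].

Lemma approximable_L2 c : approximable c -> L2 Omega c.
Proof.
move=> [ic [B B_ge0 cB] _]; apply: int3_sqr_L2 => //; first exact: int3_mfun3.
apply: (eq_int3 (f := fun x => c x * c x)) => //.
by apply: (int3M_bounded (M := B)) => //; exact: int3_mfun3.
Qed.

Lemma ips_smooth_cvg f c : L2 Omega f -> approximable c ->
  (fun n => ips Omega f (smooth n c)) @ \oo --> ips Omega f c.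
Proof.
move=> hf [ic [B B_ge0 cB] cc]; have jf : int3 Omega f by exact: L2_int3.
have mf : mfun3 Omega f by case: hf.
apply: (@vol_int_dct _ _ _ _ (fun x => `|f x * B|)) => //.
- have := int3Z B mO jf; rewrite /int3 => /integrable_abse.
  by apply: eq_integrable => // p _; rewrite /= mulrC.
- move=> n; apply: mfun3M => //; apply: mfun3_continuous; apply: C1_continuous.
  exact: smooth_C1.
- by apply: mfun3M => //; exact: int3_mfun3.
- move=> n x Ox; rewrite normrM [leRHS]normrM ler_wpM2l// (ger0_norm B_ge0).
  exact: smooth_le.
- apply: ae_onS cc => x Ox cx; apply: cvgM; first exact: cvg_cst.
  exact: (smooth_cvg ic B_ge0 cB Ox cx).
Qed.

(** When b is replaced by its convolution, a C1 field whose curl is the convolution of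
    cb, this is the hypothesis on a. Convolution is self-adjoint, and bounded
    convergence removes it on both sides. *)
Lemma curl_symmetric a b ca cb : L2v Omega a -> L2v Omega b ->
  (forall psi, C1v psi -> ipv Omega a (curl psi) = ipv Omega ca psi) ->
  (forall psi, C1v psi -> ipv Omega b (curl psi) = ipv Omega cb psi) ->
  (forall i, approximable (fun x => ca x 0 i)) -> (forall i, approximable (fun x => cb x 0 i)) ->
  ipv Omega a cb = ipv Omega ca b.
Proof.
move=> ha hb hca hcb aca acb.
have L2c c : C1 c -> L2 Omega c by move=> c1; apply: continuous_L2 => //; exact: C1_continuous.
have ic i : int3 Omega (fun x => ca x 0 i) by case: (aca i).
have ic' i : int3 Omega (fun x => cb x 0 i) by case: (acb i).
have L2a i := approximable_L2 (aca i); have L2b i := approximable_L2 (acb i).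
have sw f g : ips Omega f g = ips Omega g f by apply: eq_vol_int => x _; rewrite mulrC.
have E n : \sum_(i < 3) ips Omega (fun x => a x 0 i) (smooth n (fun x => cb x 0 i))
    = \sum_(i < 3) ips Omega (fun x => b x 0 i) (smooth n (fun x => ca x 0 i)).
  transitivity (ipv Omega a (smoothv n cb)).
    rewrite (ipv_sum mO) => [|i]; last by apply: (L2M_int3 mO (ha i)); exact: (L2c _ (smoothv_C1 n (L2b : L2v Omega cb) i)).
    by apply: eq_bigr => i _; apply: eq_vol_int => x _; rewrite mxE.
  rewrite -(curl_smoothv n hb hcb) hca; last exact: smoothv_C1.
  rewrite (ipv_sum mO) => [|i]; last by apply: (L2M_int3 mO (L2a i)); exact: (L2c _ (smoothv_C1 n hb i)).
  apply: eq_bigr => i _; rewrite sw -smooth_adjoint//; last exact: int3_L2v.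
  by apply: eq_vol_int => x _; rewrite mxE.
have c1 : (fun n => \sum_(i < 3) ips Omega (fun x => a x 0 i) (smooth n (fun x => cb x 0 i))) @ \oo
    --> \sum_(i < 3) ips Omega (fun x => a x 0 i) (fun x => cb x 0 i).
  rewrite sum3; under eq_fun do rewrite sum3.
  by apply: cvgD; [apply: cvgD|]; apply: ips_smooth_cvg => //; exact: ha.
have c2 : (fun n => \sum_(i < 3) ips Omega (fun x => b x 0 i) (smooth n (fun x => ca x 0 i))) @ \oo
    --> \sum_(i < 3) ips Omega (fun x => b x 0 i) (fun x => ca x 0 i).
  rewrite sum3; under eq_fun do rewrite sum3.
  by apply: cvgD; [apply: cvgD|]; apply: ips_smooth_cvg => //; exact: hb.
rewrite (ipv_sum mO) => [|i]; last by apply: (L2M_int3 mO (ha i)).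
rewrite (ipv_sum mO) => [|i]; last by apply: (L2M_int3 mO (L2a i)).
move: c1; under eq_fun do rewrite E.
move=> c1; rewrite (cvg_unique _ c1 c2)//.
by apply: eq_bigr => i _; rewrite -/(ips _ _ _) sw.
Qed.

End Smoothing.

(** * The finite element spaces *)

Section Spaces.
Variable R : realType.
Variable M : mesh R.
Variable Omega : set 'rV[R]_3.
Hypothesis M_tri : triangulation M Omega.
Hypothesis Omega_dom : bounded_domain Omega.
Notation rV3 := 'rV[R]_3.
Notation mpoly3 := (mpoly.mpoly 3 R).
Implicit Types (K L e : {set 'I_(nvert M)}) (x y : rV3) (f g q phi : rV3 -> R)
  (u v A c E psi : rV3 -> rV3).

Let cell_tet K : K \in cells M -> tetrahedron K := @cell_tetrahedron R M Omega M_tri K.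
Let mO : mset3 Omega := Omega_mset Omega_dom.
Let bO : bounded_set Omega := Omega_bounded Omega_dom.

Lemma Udiv_poly s u : Udiv M Omega s u -> pw_polyv M s.+1 u.
Proof.
move=> [_ h] K /h[P [Q [dP dQ uP]]].
exists (fun i => P i + mpoly.mpolyX R (mpoly.mnm1 i) * Q).
  by move=> i; apply: deg_leD; [exact: deg_leW (dP i)|exact: deg_le_mulX].
move=> x Kx; rewrite uP//; apply/rowP => i.
by rewrite !mxE mpoly_evalD mpoly_evalM mpoly_evalX mulrC.
Qed.

Lemma Ucurl_poly s u : Ucurl M Omega s u -> pw_polyv M s.+1 u.
Proof.
move=> [_ h] K /h[P [Q [dP dQ uP]]].
exists (fun i => P i + (mpoly.mpolyX R (mpoly.mnm1 (i + 1)) * Q (i + 2)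
  - mpoly.mpolyX R (mpoly.mnm1 (i + 2)) * Q (i + 1))).
  move=> i; apply: deg_leD; first exact: deg_leW (dP i).
  by apply: deg_leD; [|apply: deg_leN]; exact: deg_le_mulX.
move=> x Kx; rewrite uP//; apply/rowP => i.
by rewrite !mxE mpoly_evalD mpoly_evalB !mpoly_evalM !mpoly_evalX.
Qed.

Lemma Udiv_L2v s u : Udiv M Omega s u -> L2v Omega u. Proof. by move=> [[[]]]. Qed.
Lemma Ucurl_L2v s u : Ucurl M Omega s u -> L2v Omega u. Proof. by move=> [[[]]]. Qed.

Lemma Udiv_balanced s u : Udiv M Omega s u -> balanced M u.
Proof.
move=> hu e ce x hx; have hp := Udiv_poly hu.
apply: (fjump_eq0 M_tri Omega_dom (Udiv_L2v hu) hp) => // x0 r r0.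
by apply: (H0div_green M_tri Omega_dom _ hp); [case: hu|exact: bubble_C1].
Qed.

Lemma trace_lin k u v a b K e x : K \in adj e -> pw_polyv M k u -> pw_polyv M k v -> hull e x ->
  trace K (fun y => a *: u y + b *: v y) x = a *: trace K u x + b *: trace K v x.
Proof.
rewrite inE => /andP[KM eK] hu hv hx; have tK := cell_tet KM.
have [hK _] := hull_sub_bary tK eK hx.
have [P dP uP] := hu K KM; have [Q dQ vQ] := hv K KM.
have cP i : continuous (mpoly_eval (P i)) by exact: C1_continuous (mpoly_eval_C1 _).
have cQ i : continuous (mpoly_eval (Q i)) by exact: C1_continuous (mpoly_eval_C1 _).
have c1 : {for x, continuous (mpoly_evalv P)} by exact: continuous_row.
have c2 : {for x, continuous (mpoly_evalv Q)} by exact: continuous_row.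
rewrite (trace_eq tK hK uP c1) (trace_eq tK hK vQ c2).
have cF i : continuous (mpoly_eval (a *: P i + b *: Q i)) by exact: C1_continuous (mpoly_eval_C1 _).
have c3 : {for x, continuous (mpoly_evalv (fun i => a *: P i + b *: Q i))} by exact: continuous_row.
rewrite (trace_eq tK hK _ c3).
  by apply/rowP => i; rewrite !mxE mpoly_evalD !mpoly_evalZ.
by move=> y Ky; rewrite uP// vQ//; apply/rowP => i; rewrite !mxE mpoly_evalD !mpoly_evalZ.
Qed.

Lemma balanced_lin k u v a b : pw_polyv M k u -> pw_polyv M k v -> balanced M u -> balanced M v ->
  balanced M (fun x => a *: u x + b *: v x).
Proof.
move=> hu hv bu bv e ce x hx.
transitivity (a * fjump e u x + b * fjump e v x); last by rewrite bu// bv// !mulr0 addr0.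
rewrite /fjump !mulr_sumr -big_split; apply: eq_bigr => K Ke /=.
by rewrite (trace_lin _ _ Ke hu hv hx) dotDl !dotZl.
Qed.

Lemma L2v_lin u v a b : L2v Omega u -> L2v Omega v -> L2v Omega (fun x => a *: u x + b *: v x).
Proof.
move=> hu hv i; rewrite (_ : (fun x => _) = (fun x => a * u x 0 i + b * v x 0 i)).
  exact: L2D mO (L2Z a mO (hu i)) (L2Z b mO (hv i)).
by apply/funext => x; rewrite !mxE.
Qed.

Lemma Udiv_lin s u v a b : Udiv M Omega s u -> Udiv M Omega s v ->
  Udiv M Omega s (fun x => a *: u x + b *: v x).
Proof.
move=> hu hv; have pu := Udiv_poly hu; have pv := Udiv_poly hv.
split.
  apply: (weak_div_green (k := s.+1) M_tri Omega_dom _ _ _).2.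
  - exact: L2v_lin (Udiv_L2v hu) (Udiv_L2v hv).
  - move=> K KM; have [P dP uP] := pu K KM; have [Q dQ vQ] := pv K KM.
    exists (fun i => a *: P i + b *: Q i).
      by move=> i; apply: deg_leD; exact: deg_leZ.
    move=> x Kx; rewrite uP// vQ//; apply/rowP => i.
    by rewrite !mxE mpoly_evalD !mpoly_evalZ.
  - exact: balanced_lin pu pv (Udiv_balanced hu) (Udiv_balanced hv).
move=> K KM; have [P [P' [dP dP' uP]]] := hu.2 K KM; have [Q [Q' [dQ dQ' vQ]]] := hv.2 K KM.
exists (fun i => a *: P i + b *: Q i), (a *: P' + b *: Q'); split.
- by move=> i; apply: deg_leD; exact: deg_leZ.
- by apply: deg_leD; exact: deg_leZ.
- move=> x Kx; rewrite uP// vQ//; apply/rowP => i.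
  by rewrite !mxE !mpoly_evalD !mpoly_evalZ; ring.
Qed.

Lemma Fh_lin m f g a b : Fh M Omega m f -> Fh M Omega m g ->
  Fh M Omega m (fun x => a * f x + b * g x).
Proof.
move=> [hf pf] [hg pg]; split.
  by apply: L2D => //; exact: L2Z.
move=> K KM; have [P dP fP] := pf K KM; have [Q dQ gQ] := pg K KM.
exists (a *: P + b *: Q); first by apply: deg_leD; exact: deg_leZ.
by move=> x Kx; rewrite fP// gQ// mpoly_evalD !mpoly_evalZ.
Qed.

Lemma Fh_one m : Fh M Omega m (fun=> 1).
Proof.
split; first by apply: continuous_L2 => //; exact: continuous_cst.
by move=> K _; exists (mpoly.mpolyC 3 1); [exact: deg_leC|move=> x _; rewrite mpoly_evalC].
Qed.

Lemma Fh_cwc m f : Fh M Omega m f -> cellwise_continuous M Omega f.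
Proof. by move=> [[mf _] pf]; exact: pw_poly_cwc mf pf. Qed.

Lemma ae_cells (P : rV3 -> Prop) : (forall K, K \in cells M -> forall x, cell_int K x -> P x) ->
  ae_on Omega P.
Proof.
by move=> h; apply: ae_onS (skeleton_null M_tri) => x _ [K KM Kx]; exact: h KM x Kx.
Qed.

Lemma eq_vol_cells f g : mfun3 Omega f -> mfun3 Omega g ->
  (forall K, K \in cells M -> forall x, cell_int K x -> f x = g x) ->
  vol_int Omega f = vol_int Omega g.
Proof. by move=> mf mg h; apply: vol_int_ae => //; exact: ae_cells. Qed.

Lemma cells_ae_eq k f (c : R) : pw_poly M k f -> ae_on Omega (fun x => f x = c) ->
  forall K, K \in cells M -> forall x, cell_int K x -> f x = c.
Proof.
move=> pf h K KM x Kx; have [P _ fP] := pf K KM.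
apply/eqP; rewrite -subr_eq0; apply/eqP; rewrite fP//.
have E : mpoly_eval P x - c = mpoly_eval (P - mpoly.mpolyC 3 c) x by rewrite mpoly_evalB mpoly_evalC.
rewrite E; apply: (@ae_open_eq0 _ (cell_int K)) => //; first exact: open_interior.
  exact: C1_continuous (mpoly_eval_C1 _).
move: h => [N [mN N0 hN]]; exists N; split=> // p /= hp; apply: hN => /= h; apply: hp => Kp.
rewrite mpoly_evalB mpoly_evalC -fP// h ?subrr//.
exact: (cell_int_Omega M_tri Omega_dom KM).
Qed.

Lemma sqr_int_eq0 k f : mfun3 Omega f -> pw_poly M k f -> vol_int Omega (fun x => f x ^+ 2) = 0 ->
  forall K, K \in cells M -> forall x, cell_int K x -> f x = 0.
Proof.
move=> mf pf h0; have cf := pw_poly_cwc mf pf.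
have i2 : int3 Omega (fun x => f x ^+ 2).
  by apply: (cwc_int3 M_tri Omega_dom); under eq_fun do rewrite expr2; exact: cwcM.
apply: (cells_ae_eq pf); apply: ae_onS (vol_int_eq0_ae mO i2 _ h0) => [x _ /eqP|x _].
  by rewrite sqrf_eq0 => /eqP.
exact: sqr_ge0.
Qed.

Lemma ips_weak_div k u d g : L2v Omega u -> pw_polyv M k u -> weak_div Omega u d ->
  L2 Omega g -> pw_C1 M g -> ips Omega d g = ips Omega (pw_div M u) g.
Proof.
move=> hu h wd hg pg; have [hd _] := wd.
have hD : L2 Omega (pw_div M u) by apply: (cwc_L2 M_tri Omega_dom); exact: pw_div_cwc h.
rewrite /ips !(vol_int_cells M_tri Omega_dom); try exact: L2M_int3.
apply: eq_bigr => K KM; have [q q1 gq] := pg K KM.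
transitivity (vol_int (cell_int K) (fun x => d x * q x)).
  by apply: eq_vol_int => x Kx; rewrite gq.
rewrite (weak_div_cell M_tri Omega_dom KM hu h wd q1).
by apply: eq_vol_int => x Kx; rewrite gq.
Qed.

Lemma divfree_pw_div u : divfree M u -> pw_div M u = fun=> 0.
Proof.
move=> du; apply/funext => x; rewrite /pw_div /on_cells big1// => K KM; rewrite patchE.
by case: ifPn => // /set_mem Kx; exact: du KM x Kx.
Qed.

Lemma pw_div_divfree k u : pw_polyv M k.+1 u -> vol_int Omega (fun x => pw_div M u x ^+ 2) = 0 ->
  divfree M u.
Proof.
move=> h h0 K KM x Kx; have [mD _] := pw_div_cwc (Omega := Omega) M_tri h.
have := sqr_int_eq0 mD (pw_poly_div M_tri h) h0 KM Kx.
by rewrite /pw_div (on_cellsE M_tri _ KM Kx).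
Qed.

Lemma divfree_weak s u : Udiv M Omega s u -> divfree M u -> weak_div Omega u (fun=> 0).
Proof.
move=> hu du; rewrite -(divfree_pw_div du).
exact: (weak_div_green M_tri Omega_dom (Udiv_L2v hu) (Udiv_poly hu) (Udiv_balanced hu)).1.
Qed.

Lemma weak_divfree s u : Udiv M Omega s u -> weak_div Omega u (fun=> 0) -> divfree M u.
Proof.
move=> hu wd; have pu := Udiv_poly hu; apply: (pw_div_divfree pu).
have pD := pw_poly_div M_tri pu.
have hD : L2 Omega (pw_div M u) by apply: (cwc_L2 M_tri Omega_dom); exact: pw_div_cwc pu.
have := ips_weak_div (Udiv_L2v hu) pu wd hD (pw_poly_C1 pD).
rewrite [LHS]vol_int_eq0 => [h|x _]; last by rewrite mul0r.
by rewrite [RHS]h; apply: eq_vol_int => x _; rewrite expr2.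
Qed.

Lemma wdiv_divfree s k u g : Udiv M Omega s u -> divfree M u -> L2 Omega g -> pw_poly M k g ->
  ips Omega g (wdiv Omega u) = 0.
Proof.
move=> hu du hg pg.
have wd : weak_div Omega u (wdiv Omega u) by apply: weak_div_wdiv; case: hu => -[].
transitivity (ips Omega (wdiv Omega u) g); first by apply: eq_vol_int => x _; rewrite mulrC.
rewrite (ips_weak_div (Udiv_L2v hu) (Udiv_poly hu) wd hg (pw_poly_C1 pg)).
by rewrite (divfree_pw_div du); apply: vol_int_eq0 => x _; rewrite mul0r.
Qed.

(** The mean value vanishes by Green's formula with the constant 1. *)
Lemma pw_div_Qh s u : Udiv M Omega s u -> Qh M Omega s (pw_div M u).
Proof.
move=> hu; have pu := Udiv_poly hu; have cD := pw_div_cwc (Omega := Omega) M_tri pu; split.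
- exact: (cwc_L2 M_tri Omega_dom).
- have := H0div_green M_tri Omega_dom hu.1 pu (@C1_cst R 1).
  move=> <-; apply: eq_vol_int => x _; rewrite /dot big1 ?add0r ?mulr1// => i _.
  by rewrite mxE pd_cst mulr0.
- exact: (pw_poly_div M_tri pu).
Qed.

(** Testing with the divergence itself shows that its square has a zero integral. *)
Lemma incompressible s u : Udiv M Omega s u ->
  (forall q, Qh M Omega s q -> ips Omega (wdiv Omega u) q = 0) -> divfree M u.
Proof.
move=> hu h; have pu := Udiv_poly hu; apply: (pw_div_divfree pu).
have QD := pw_div_Qh hu; have [hD _ pD] := QD.
have wd : weak_div Omega u (wdiv Omega u) by apply: weak_div_wdiv; case: hu => -[].
have := ips_weak_div (Udiv_L2v hu) pu wd hD (pw_poly_C1 pD).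
rewrite h// => h0; rewrite [RHS]h0.
Qed.

(** The curl lowers the degree by one, so it fits into the polynomial part of the
    Raviart-Thomas space. *)
Lemma curl_Udiv s E : Ucurl M Omega s E -> Udiv M Omega s (pw_curl M E).
Proof.
move=> hE; have pE := Ucurl_poly hE; split.
  by have [] := curl_conforming M_tri Omega_dom hE.1 pE.
move=> K KM; have [P dP EP] := pw_polyv_curl M_tri pE KM.
exists P, (mpoly.mpolyC 3 0); split => //; first exact: deg_leC.
by move=> x Kx; rewrite EP// mpoly_evalC scale0r addr0.
Qed.

Lemma wcurl_ipv s E v : Ucurl M Omega s E -> L2v Omega v -> pw_C1v M v ->
  ipv Omega (wcurl Omega E) v = ipv Omega (pw_curl M E) v.
Proof.
move=> hE hv pv; have pE := Ucurl_poly hE.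
have wc : weak_curl Omega E (wcurl Omega E) by apply: weak_curl_wcurl; case: hE => -[].
apply: (same_moments_ipv M_tri Omega_dom) => //.
- by case: wc.
- exact: (pw_curl_L2v M_tri Omega_dom pE).
- exact: (same_moments_curl M_tri Omega_dom (Ucurl_L2v hE) pE wc).
Qed.

(** The value 0 on the skeleton gives a bounded representative. *)
Definition on_cellsv u : rV3 -> rV3 := fun x => \row_i on_cells M (fun y => u y 0 i) x.

Lemma on_cellsvE K u x : K \in cells M -> cell_int K x -> on_cellsv u x = u x.
Proof. by move=> KM Kx; apply/rowP => i; rewrite mxE (on_cellsE M_tri _ KM Kx). Qed.

Lemma on_cells_off f x : ~ (exists2 K, K \in cells M & cell_int K x) -> on_cells M f x = 0.
Proof.
move=> hx; rewrite /on_cells big1// => K KM; rewrite patchE memNset// => Kx.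
by apply: hx; exists K.
Qed.

Lemma on_cells_approximable f : (forall K, K \in cells M ->
    exists2 g, continuous g & forall x, cell_int K x -> f x = g x) ->
  approximable Omega (on_cells M f).
Proof.
move=> h; split.
- by apply: (cwc_int3 M_tri Omega_dom); exact: (on_cells_cwc M_tri).
- have H K : exists B : R, 0 <= B /\ (K \in cells M -> forall x, cell_int K x -> `|f x| <= B).
    case: (boolP (K \in cells M)) => KM; last by exists 0.
    have [g cg fg] := h K KM.
    have [B B0 hB] := continuous_bounded (cell_int_bounded M_tri KM) cg.
    by exists B; split=> // _ x Kx; rewrite fg// hB.
  have [B hB] := choice H.
  have S0 : 0 <= \sum_(K in cells M) B K by apply: sumr_ge0 => K _; case: (hB K).
  exists (\sum_(K in cells M) B K) => // x _.
  have [[K KM Kx]|hx] := pselect (exists2 K, K \in cells M & cell_int K x).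
    rewrite (on_cellsE M_tri _ KM Kx); apply: le_trans ((hB K).2 KM x Kx) _.
    by rewrite (bigD1 K)//= lerDl sumr_ge0// => L _; case: (hB L).
  by rewrite on_cells_off// normr0.
- apply: ae_cells => K KM x Kx; have [g cg fg] := h K KM.
  apply: (@cvg_trans _ (g @ x)); last first.
    by rewrite (on_cellsE M_tri _ KM Kx) fg//; exact: cg.
  have nK : \forall y \near x, cell_int K y.
    exact: open_nbhs_nbhs (conj (@open_interior _ _) Kx).
  have E : \forall y \near x, g y = on_cells M f y.
    by apply: filterS nK => y Ky; rewrite (on_cellsE M_tri _ KM Ky) fg.
  exact: near_eq_cvg E.
Qed.

End Spaces.

(** * One time step *)

Section CrossProduct.
Variable R : realType.
Implicit Types a b c : 'rV[R]_3.

Lemma triple_swap a b c : dot (cross a b) c = - dot (cross c b) a.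
Proof. by rewrite !dotE !crossE; ring. Qed.

Lemma triple_rot a b c : dot (cross a b) c = dot (cross b c) a.
Proof. by rewrite !dotE !crossE; ring. Qed.

Lemma dot_cross_r a b : dot (cross a b) b = 0.
Proof. by rewrite !dotE !crossE; ring. Qed.

Lemma ipvC (D : set 'rV[R]_3) (u v : 'rV[R]_3 -> 'rV[R]_3) : ipv D u v = ipv D v u.
Proof. by apply: eq_vol_int => x _; rewrite /dotf dotC. Qed.

Lemma half_sum_eq0 (x y : R) : 0 = 2^-1 * x + 2^-1 * y -> y = - x.
Proof. by move=> h; lra. Qed.

End CrossProduct.

Section Fields.
Variable R : realType.
Variable M : mesh R.
Variable Omega : set 'rV[R]_3.
Hypothesis M_tri : triangulation M Omega.
Hypothesis Omega_dom : bounded_domain Omega.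
Notation rV3 := 'rV[R]_3.
Implicit Types (K L e : {set 'I_(nvert M)}) (x y : rV3) (f g : rV3 -> R) (u v A E : rV3 -> rV3).
Notation cwc := (cellwise_continuous M Omega).
Notation vol := (vol_int Omega).

Let mO : mset3 Omega := Omega_mset Omega_dom.
Let bO : bounded_set Omega := Omega_bounded Omega_dom.

Definition cwv u := forall i, cwc (fun x => u x 0 i).

Lemma Udiv_cwv s u : Udiv M Omega s u -> cwv u.
Proof. by move=> hu i; exact: (pw_polyv_cwc i (Udiv_L2v hu) (Udiv_poly hu)). Qed.

Lemma Ucurl_cwv s u : Ucurl M Omega s u -> cwv u.
Proof. by move=> hu i; exact: (pw_polyv_cwc i (Ucurl_L2v hu) (Ucurl_poly hu)). Qed.

Lemma cwc_dot u v : cwv u -> cwv v -> cwc (fun x => dot (u x) (v x)).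
Proof. by move=> hu hv; apply: cwc_sum => i; exact: cwcM. Qed.

Lemma cwc_lin f g a b : cwc f -> cwc g -> cwc (fun x => a * f x + b * g x).
Proof. by move=> hf hg; apply: cwcD; exact: cwcZ. Qed.

Lemma cwv_smul f u : cwc f -> cwv u -> cwv (fun x => f x *: u x).
Proof.
move=> hf hu i; rewrite (_ : (fun x => _) = fun x => f x * u x 0 i); first exact: cwcM.
by apply/funext => x; rewrite !mxE.
Qed.

Lemma cwv_cross u v : cwv u -> cwv v -> cwv (fun x => cross (u x) (v x)).
Proof.
move=> hu hv i; rewrite (_ : (fun x => _) = fun x =>
    1 * (u x 0 (i + 1) * v x 0 (i + 2)) + - 1 * (u x 0 (i + 2) * v x 0 (i + 1))).
  by apply: cwc_lin; exact: cwcM.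
by apply/funext => x; rewrite !mxE; ring.
Qed.

Lemma vol_lin f g a b : cwc f -> cwc g ->
  vol (fun x => a * f x + b * g x) = a * vol f + b * vol g.
Proof.
move=> hf hg; have i1 := cwc_int3 M_tri Omega_dom hf; have i2 := cwc_int3 M_tri Omega_dom hg.
by rewrite vol_intD ?vol_intZ//; exact: int3Z.
Qed.

Lemma cwc_sqr f : cwc f -> cwc (fun x => f x ^+ 2).
Proof. by move=> hf; under eq_fun do rewrite expr2; exact: cwcM. Qed.

Lemma cwc_mfun f : cwc f -> mfun3 Omega f. Proof. by case. Qed.

Lemma midvE u v : midv u v = fun x => 2^-1 *: u x + 2^-1 *: v x.
Proof. by apply/funext => x; rewrite /midv scalerDr. Qed.

Lemma midsE f g : mids f g = fun x => 2^-1 * f x + 2^-1 * g x.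
Proof. by apply/funext => x; rewrite /mids mulrDl ![_ / 2]mulrC. Qed.

Lemma face_int_ge0 e f : #|e| = 3%N -> (forall x, hull e x -> 0 <= f x) -> 0 <= face_int e f.
Proof.
move=> ce h; rewrite mulr_ge0 ?sqrtr_ge0//; apply: Rintegral_ge0 => t ht.
by apply: h; exact: hull_face_param.
Qed.

Lemma dot_ge0 (x : rV3) : 0 <= dot x x.
Proof. by apply: sumr_ge0 => i _; rewrite -expr2 sqr_ge0. Qed.

Lemma ipv_self_eq0 s u : Udiv M Omega s u -> ipv Omega u u = 0 ->
  forall K, K \in cells M -> forall x, cell_int K x -> u x = 0.
Proof.
move=> hu h K KM x Kx; have cu := Udiv_cwv hu.
have E : \sum_(i < 3) vol (fun x => u x 0 i ^+ 2) = 0.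
  rewrite -[RHS]h ipv_sum//.
  by move=> i; apply: (cwc_int3 M_tri Omega_dom); exact: cwcM.
apply/rowP => i; rewrite mxE.
apply: (@sqr_int_eq0 _ _ _ M_tri Omega_dom s.+1 (fun y => u y 0 i) _ _ _ K KM x Kx).
- exact: cwc_mfun (cu i).
- move=> L LM; have [P dP uP] := Udiv_poly hu LM; exists (P i) => // y Ly.
  by rewrite uP// mxE.
- by apply: (psumr_eq0P _ E) => // j _; apply: vol_int_ge0 => y _; exact: sqr_ge0.
Qed.

Lemma domain_radius : exists2 rad : R, 0 < rad & forall x, Omega x -> `|x| < rad.
Proof.
have [N [Nr hN]] := bO; exists (`|N| + 2) => [|x Ox]; first by rewrite ltr_wpDl.
apply: (@le_lt_trans _ _ (`|N| + 1)); last by rewrite ltrD2l; lra.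
by apply: (hN (`|N| + 1)) => //; rewrite (le_lt_trans (ler_norm N))// ltrDl.
Qed.

Lemma ipv_cells A u v : L2v Omega A -> L2v Omega u -> L2v Omega v ->
  (forall K, K \in cells M -> forall x, cell_int K x -> u x = v x) ->
  ipv Omega A u = ipv Omega A v.
Proof.
move=> hA hu hv h.
have mdot w : L2v Omega w -> mfun3 Omega (dotf A w).
  move=> hw; apply: int3_mfun3; apply: int3_sum => // i _.
  exact: L2M_int3 mO (hA i) (hw i).
by apply: (eq_vol_cells M_tri Omega_dom); [exact: mdot|exact: mdot|move=> K KM x Kx; rewrite /dotf (h K KM x Kx)].
Qed.

Lemma ipv_linr A u v a b : L2v Omega A -> L2v Omega u -> L2v Omega v ->
  ipv Omega A (fun x => a *: u x + b *: v x) = a * ipv Omega A u + b * ipv Omega A v.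
Proof.
move=> hA hu hv.
have i0 w : L2v Omega w -> int3 Omega (dotf A w).
  by move=> hw; apply: int3_sum => // i _; exact: L2M_int3 mO (hA i) (hw i).
rewrite /ipv -!vol_intZ -?vol_intD//; try exact: i0; try exact: int3Z (i0 _ _).
by apply: eq_vol_int => x _; rewrite /dotf dotDr !dotZr.
Qed.

Lemma cwv_L2v u : cwv u -> L2v Omega u.
Proof. by move=> hu i; exact: (cwc_L2 M_tri Omega_dom). Qed.

(** Two weak curls of A have the same moments, so the boundary condition, stated with
    one of them, also holds with B. *)
Lemma potential_green A B psi : H0curl Omega A -> weak_curl Omega A B -> C1v psi ->
  ipv Omega A (curl psi) = ipv Omega B psi.
Proof.
move=> [hA g0] wB psi1; have wc := weak_curl_wcurl hA.
have := g0 psi psi1; rewrite (same_moments_ipv M_tri Omega_dom (c' := B)).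
- by move=> /eqP; rewrite subr_eq0 => /eqP.
- by case: wc.
- by case: wB.
- exact: (C1v_L2v Omega_dom).
- exact: (same_moments_weak M_tri Omega_dom wc wB).
- exact: C1v_pw.
Qed.

End Fields.

Section TimeStep.
Variable R : realType.
Variable M : mesh R.
Variable Omega : set 'rV[R]_3.
Hypothesis M_tri : triangulation M Omega.
Hypothesis Omega_dom : bounded_domain Omega.
Notation rV3 := 'rV[R]_3.
Notation cwc := (cellwise_continuous M Omega).
Notation vol := (vol_int Omega).
Variables (s m : nat)
  (beta : {set 'I_(nvert M)} -> (rV3 -> rV3) -> rV3 -> R)
  (W : {set 'I_(nvert M)} -> (rV3 -> rV3) -> (rV3 -> rV3) -> rV3 -> R) (dt : R).
Hypothesis W_weight : upwind_weight Omega s beta W.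
Hypothesis dt_gt0 : 0 < dt.
Variables (u u' B B' w J H U E alpha : rV3 -> rV3) (rho rho' theta p' : rV3 -> R).
Hypothesis u_in : Udiv M Omega s u.
Hypothesis u'_in : Udiv M Omega s u'.
Hypothesis B_in : Udiv M Omega s B.
Hypothesis B'_in : Udiv M Omega s B'.
Hypothesis rho_in : Fh M Omega m rho.
Hypothesis rho'_in : Fh M Omega m rho'.
Hypothesis p'_in : Qh M Omega s p'.
Hypothesis theta_in : Fh M Omega m theta.
Hypothesis w_in : Ucurl M Omega s w.
Hypothesis J_in : Ucurl M Omega s J.
Hypothesis H_in : Ucurl M Omega s H.
Hypothesis U_in : Ucurl M Omega s U.
Hypothesis E_in : Ucurl M Omega s E.
Hypothesis alpha_in : Ucurl M Omega s alpha.
Notation um := (midv u u').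
Notation Bm := (midv B B').
Notation rm := (mids rho rho').
Hypothesis momentum : forall v, Udiv M Omega s v ->
  ipv Omega (fun x => dt^-1 *: (rho' x *: u' x - rho x *: u x)) v + ipv Omega alpha v
  + bht W um theta rm v - ips Omega p' (wdiv Omega v) = 0.
Hypothesis induction : forall C, Udiv M Omega s C ->
  ipv Omega (fun x => dt^-1 *: (B' x - B x)) C + ipv Omega (wcurl Omega E) C = 0.
Hypothesis density : forall sigma, Fh M Omega m sigma ->
  ips Omega (fun x => dt^-1 * (rho' x - rho x)) sigma + bht W um sigma rm um = 0.
Hypothesis w_def : forall z, Ucurl M Omega s z ->
  ipv Omega w z = ipv Omega (midv (smul rho u) (smul rho' u')) (wcurl Omega z).
Hypothesis J_def : forall z, Ucurl M Omega s z -> ipv Omega J z = ipv Omega Bm (wcurl Omega z).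
Hypothesis theta_def : forall tau, Fh M Omega m tau ->
  ips Omega theta tau = 2^-1 * ips Omega (dotf u u') tau.
Hypothesis H_def : forall z, Ucurl M Omega s z -> ipv Omega H z = ipv Omega Bm z.
Hypothesis U_def : forall z, Ucurl M Omega s z -> ipv Omega U z = ipv Omega um z.
Hypothesis E_def : forall z, Ucurl M Omega s z -> ipv Omega E z = - ipv Omega (crossf U H) z.
Hypothesis alpha_def : forall z, Ucurl M Omega s z ->
  ipv Omega alpha z = ipv Omega (fun x => crossf w U x - crossf J H x) z.
Hypothesis du : divfree M u.
Hypothesis du' : divfree M u'.
Hypothesis dB : divfree M B.
Hypothesis dB' : divfree M B'.

Let mO : mset3 Omega := Omega_mset Omega_dom.
Let bO : bounded_set Omega := Omega_bounded Omega_dom.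
Let dt0 : dt != 0. Proof. by rewrite gt_eqF. Qed.

Let cr : cwc rho := Fh_cwc rho_in.
Let cr' : cwc rho' := Fh_cwc rho'_in.
Let cth : cwc theta := Fh_cwc theta_in.
Let cu := Udiv_cwv u_in.
Let cu' := Udiv_cwv u'_in.
Let cB := Udiv_cwv B_in.
Let cB' := Udiv_cwv B'_in.

Lemma um_in : Udiv M Omega s um.
Proof. by rewrite midvE; exact: Udiv_lin. Qed.

Lemma Bm_in : Udiv M Omega s Bm.
Proof. by rewrite midvE; exact: Udiv_lin. Qed.

Lemma rm_in : Fh M Omega m rm.
Proof. by rewrite midsE; exact: (Fh_lin Omega_dom). Qed.

Lemma divfree_lin v v' a b : Udiv M Omega s v -> Udiv M Omega s v' -> divfree M v -> divfree M v' ->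
  divfree M (fun x => a *: v x + b *: v' x).
Proof.
move=> hv hv' dv dv' K KM x Kx.
have [P dP vP] := Udiv_poly hv KM; have [P' dP' vP'] := Udiv_poly hv' KM.
have L y : cell_int K y -> a *: v y + b *: v' y = mpoly_evalv (fun i => a *: P i + b *: P' i) y.
  move=> Ky; rewrite vP// vP'//; apply/rowP => i; rewrite !mxE.
  by rewrite mpoly_evalD !mpoly_evalZ.
rewrite (dvg_cell Kx L); have := dv K KM x Kx; rewrite (dvg_cell Kx vP).
have := dv' K KM x Kx; rewrite (dvg_cell Kx vP') !sum3 !mpoly_evalD.
rewrite !mpoly.mderivD !mpoly.mderivZ !mpoly_evalD !mpoly_evalZ.
move: (mpoly_eval _ x) (mpoly_eval _ x) (mpoly_eval _ x) => a1 a2 a3 h1.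
move: (mpoly_eval _ x) (mpoly_eval _ x) (mpoly_eval _ x) => b1 b2 b3 h2.
have -> : a3 = - a2 - a1 by lra.
have -> : b3 = - b2 - b1 by lra.
by ring.
Qed.

Lemma dum : divfree M um.
Proof. by rewrite midvE; exact: divfree_lin. Qed.

Lemma dBm : divfree M Bm.
Proof. by rewrite midvE; exact: divfree_lin. Qed.

Definition stabilization v f g :=
  \sum_(e in int_faces M) face_int e (fun x => W e um v x * dot (jump e f x) (jump e g x)).

Lemma stabilization_cst v f g c :
  (forall K, K \in cells M -> forall x, cell_int K x -> g x = c) -> stabilization v f g = 0.
Proof.
move=> h; apply: big1 => e ei; have [ce _ _ _ _] := int_face_sides ei.
rewrite -[RHS](face_int0 e); apply: eq_face_int => // x hx.
by rewrite (jump_cst M_tri ei hx h) dot0r mulr0.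
Qed.

Lemma stabilization_ge0 f : 0 <= stabilization um f f.
Proof.
apply: sumr_ge0 => e ei; have [ce _ _ _ _] := int_face_sides ei.
have [b0 _ bE _ _] := W_weight ei um_in.
by apply: face_int_ge0 => // x hx; rewrite bE// mulr_ge0 ?dot_ge0// b0.
Qed.

Lemma stabilization_beta0 f : (forall e v x, e \in int_faces M -> Udiv M Omega s v -> hull e x ->
  beta e v x = 0) -> stabilization um f f = 0.
Proof.
move=> h; apply: big1 => e ei; have [ce _ _ _ _] := int_face_sides ei.
have [_ _ bE _ _] := W_weight ei um_in.
rewrite -[RHS](face_int0 e); apply: eq_face_int => // x hx.
by rewrite bE// h ?mul0r//; exact: um_in.
Qed.

(** A constant has neither gradient nor jumps. *)
Lemma step_mass : vol rho' = vol rho.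
Proof.
have := density (Fh_one M Omega_dom m); rewrite /bht (@bh_cst _ _ _ M_tri _ _ _ 1)//.
have -> : \sum_(e in int_faces M) face_int e (fun x => W e um um x * dot (jump e (fun=> 1) x) (jump e rm x)) = 0.
  apply: big1 => e ei; have [ce _ _ _ _] := int_face_sides ei.
  rewrite -[RHS](face_int0 e); apply: eq_face_int => // x hx.
  by rewrite (jump_cst M_tri (c := 1) ei hx)// dotC dot0r mulr0.
rewrite !addr0 => h; apply/eqP; rewrite -subr_eq0 -(mulrI_eq0 _ (mulfI (_ : dt^-1 != 0))) ?invr_eq0//.
apply/eqP; rewrite -[RHS]h.
transitivity (vol (fun x => dt^-1 * rho' x + - dt^-1 * rho x)); last first.
  by apply: eq_vol_int => x _; ring.
by rewrite (vol_lin M_tri Omega_dom)//; ring.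
Qed.

(** With sigma = rho_{k+1/2} the transport form vanishes and only the stabilization
    remains. *)
Lemma step_density : vol (fun x => rho' x ^+ 2) + 2 * dt * stabilization um rm rm
  = vol (fun x => rho x ^+ 2).
Proof.
have := density rm_in; rewrite /bht (bh_diag M_tri (Udiv_poly um_in) (Udiv_balanced M_tri Omega_dom um_in) dum).
  rewrite add0r -/(stabilization um rm rm).
  have -> : ips Omega (fun x => dt^-1 * (rho' x - rho x)) rm =
      (dt^-1 / 2) * vol (fun x => rho' x ^+ 2) + - (dt^-1 / 2) * vol (fun x => rho x ^+ 2).
    rewrite -(vol_lin M_tri Omega_dom); [|exact: cwc_sqr|exact: cwc_sqr].
    by apply: eq_vol_int => x _; rewrite /mids; field.
  move: (vol _) (vol _) (stabilization _ _ _) => b a c h.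
  have h2 : 2 * dt * (dt^-1 / 2 * a + - (dt^-1 / 2) * b + c) = 0 by rewrite h mulr0.
  apply/eqP; rewrite -subr_eq0 -[X in _ == X]h2; apply/eqP; field; exact: dt0.
exact: pw_poly_C1 (rm_in.2).
Qed.

Lemma step_density_le : vol (fun x => rho' x ^+ 2) <= vol (fun x => rho x ^+ 2).
Proof.
rewrite -step_density lerDl mulr_ge0 ?stabilization_ge0// mulr_ge0// ltW//.
Qed.

(** By conservation of mass and decay of the integral of rho^2, the integral of (rho -
    1)^2 decays as well. *)
Lemma step_one : (forall K, K \in cells M -> forall x, cell_int K x -> rho x = 1) ->
  forall K, K \in cells M -> forall x, cell_int K x -> rho' x = 1.
Proof.
move=> h.
have c1 : cwc (fun=> 1) by exact: cwc_cst.
have Q f : cwc f -> vol (fun x => (1 * f x + - 1 * 1) ^+ 2)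
    = vol (fun x => f x ^+ 2) - 2 * vol f + vol (fun=> 1).
  move=> cf; transitivity (vol (fun x => 1 * (1 * f x ^+ 2 + - 2 * f x) + 1 * 1)).
    by apply: eq_vol_int => x _; ring.
  rewrite (vol_lin M_tri Omega_dom) ?(vol_lin M_tri Omega_dom)//; try exact: cwc_sqr.
    by ring.
  by apply: cwc_lin => //; exact: cwc_sqr.
have h0 : vol (fun x => (1 * rho x + - 1 * 1) ^+ 2) = 0.
  rewrite -[RHS](vol_int0 Omega); apply: (eq_vol_cells M_tri Omega_dom).
  - by apply: cwc_mfun; apply: cwc_sqr; exact: (cwc_lin 1 (- 1) cr c1).
  - by apply: (@cwc_mfun _ M); exact: cwc_cst.
  - by move=> K KM x Kx; rewrite (h K KM x Kx); ring.
have F1 : Fh M Omega m (fun x => 1 * rho' x + - 1 * 1).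
  by apply: (Fh_lin Omega_dom) => //; exact: Fh_one.
have h1 : vol (fun x => (1 * rho' x + - 1 * 1) ^+ 2) = 0.
  apply/eqP; rewrite eq_le; apply/andP; split; last by apply: vol_int_ge0 => x _; exact: sqr_ge0.
  rewrite -[leRHS]h0 !Q// step_mass; have := step_density_le; lra.
move=> K KM x Kx; have := sqr_int_eq0 M_tri Omega_dom (cwc_mfun (Fh_cwc F1)) F1.2 h1 KM Kx.
by lra.
Qed.

Let cum := Udiv_cwv um_in.
Let cBm := Udiv_cwv Bm_in.
Let cU := Ucurl_cwv U_in.
Let cH := Ucurl_cwv H_in.
Let cJ := Ucurl_cwv J_in.
Let cw := Ucurl_cwv w_in.

Let pressure_free v : Udiv M Omega s v -> divfree M v -> ips Omega p' (wdiv Omega v) = 0.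
Proof. by move=> hv dv; have [hp _ pp] := p'_in; exact: (wdiv_divfree M_tri Omega_dom hv dv hp pp). Qed.

Lemma vol_opp f : cwc f -> vol (fun x => - f x) = - vol f.
Proof.
move=> hf; rewrite -[RHS]mulN1r -(vol_intZ _ mO (cwc_int3 M_tri Omega_dom hf)).
by apply: eq_vol_int => x _; rewrite mulN1r.
Qed.

Lemma cwc_triple a b c : cwv M Omega a -> cwv M Omega b -> cwv M Omega c ->
  cwc (fun x => dot (cross (a x) (b x)) (c x)).
Proof. by move=> ha hb hc; apply: cwc_dot => //; exact: cwv_cross. Qed.

(** The convective part w x U is orthogonal to U. *)
Lemma lorentz_work : ipv Omega alpha um = - vol (fun x => dot (cross (J x) (H x)) (U x)).
Proof.
rewrite ipvC -U_def// ipvC alpha_def// -vol_opp; last exact: cwc_triple.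
apply: eq_vol_int => x _; rewrite /dotf /crossf dotC dotBr dotC dot_cross_r.
by rewrite dotC sub0r.
Qed.

(** J stands for the curl of B_{k+1/2}, so the curl of E against B_{k+1/2} is E against
    J, hence the opposite of the work of the Lorentz force. *)
Lemma electric_work : ipv Omega (wcurl Omega E) Bm = vol (fun x => dot (cross (J x) (H x)) (U x)).
Proof.
rewrite ipvC -J_def// ipvC E_def// -[RHS]opprK; congr (- _).
rewrite -vol_opp; last exact: cwc_triple.
by apply: eq_vol_int => x _; rewrite /dotf /crossf triple_swap.
Qed.

(** With v = u_{k+1/2} and sigma = theta the transport terms of momentum and density
    coincide; by definition of theta their difference leaves the increment of the
    kinetic energy. *)
Lemma step_energy :
  vol (fun x => rho' x * dot (u' x) (u' x) + dot (B' x) (B' x))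
  = vol (fun x => rho x * dot (u x) (u x) + dot (B x) (B x)).
Proof.
have h1 := momentum um_in; rewrite (pressure_free um_in dum) subr0 lorentz_work in h1.
have h2 := induction Bm_in; rewrite electric_work in h2.
have h3 := density theta_in.
have drho : Fh M Omega m (fun x => 1 * rho' x + - 1 * rho x) by exact: (Fh_lin Omega_dom).
have h4 := theta_def drho.
have c1 : cwc (fun x => dot (u x) (u' x) * (1 * rho' x + - 1 * rho x)).
  by apply: cwcM; [exact: cwc_dot|exact: cwc_lin].
have h5 : ips Omega (fun x => dt^-1 * (rho' x - rho x)) theta
    = dt^-1 * (2^-1 * ips Omega (dotf u u') (fun x => 1 * rho' x + - 1 * rho x)).
  rewrite -h4 -(vol_intZ _ mO (cwc_int3 M_tri Omega_dom _)); last first.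
    by apply: cwcM => //; exact: cwc_lin.
  by apply: eq_vol_int => x _; ring.
rewrite h5 in h3.
have ce : cwc (fun x => rho' x * dot (u' x) (u' x) + dot (B' x) (B' x)).
  by apply: cwcD; [apply: cwcM => //|]; exact: cwc_dot.
have ce0 : cwc (fun x => rho x * dot (u x) (u x) + dot (B x) (B x)).
  by apply: cwcD; [apply: cwcM => //|]; exact: cwc_dot.
have cB1 : cwc (fun x => dot (dt^-1 *: (B' x - B x)) (Bm x)).
  apply: cwc_dot => // i; rewrite (_ : (fun x => _) = fun x => dt^-1 * B' x 0 i + - dt^-1 * B x 0 i).
    exact: cwc_lin.
  by apply/funext => x; rewrite !mxE; ring.
have cu1 : cwc (fun x => dot (dt^-1 *: (rho' x *: u' x - rho x *: u x)) (um x)).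
  apply: cwc_dot => // i.
  rewrite (_ : (fun x => _) = fun x => dt^-1 * (rho' x * u' x 0 i) + - dt^-1 * (rho x * u x 0 i)).
    by apply: cwc_lin; exact: cwcM.
  by apply/funext => x; rewrite !mxE; ring.
have key : dt^-1 / 2 * vol (fun x => rho' x * dot (u' x) (u' x) + dot (B' x) (B' x))
    + - (dt^-1 / 2) * vol (fun x => rho x * dot (u x) (u x) + dot (B x) (B x))
  = 1 * (1 * ipv Omega (fun x => dt^-1 *: (rho' x *: u' x - rho x *: u x)) um
    + 1 * ipv Omega (fun x => dt^-1 *: (B' x - B x)) Bm)
    + - (dt^-1 / 2) * ips Omega (dotf u u') (fun x => 1 * rho' x + - 1 * rho x).
  rewrite -(vol_lin M_tri Omega_dom)// -(vol_lin M_tri Omega_dom)//.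
  rewrite -(vol_lin M_tri Omega_dom)//; last exact: cwc_lin.
  apply: eq_vol_int => x _; rewrite /dotf /midv !dotE !mxE.
  move: (u x) (u' x) (B x) (B' x) (rho x) (rho' x) => a a' b b' r r'.
  by field.
set X := vol (fun x => dot (cross (J x) (H x)) (U x)) in h1 h2.
move: key h1 h2 h3.
move: X (vol (fun x => rho' x * _ + _)) (vol (fun x => rho x * _ + _))
  (ipv Omega _ um) (ipv Omega _ Bm) (ips Omega (dotf u u') _) (bht _ _ _ _ _) => X e1 e0 i1 i2 i3 b key h1 h2 h3.
have k2 : 2 * dt * (dt^-1 / 2 * e1 + - (dt^-1 / 2) * e0) = 0.
  rewrite key; have -> : i1 = X - b by lra.
  have -> : i2 = - X by lra.
  have -> : b = - (dt^-1 * (2^-1 * i3)) by lra.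
  by field.
apply/eqP; rewrite -subr_eq0 -[X in _ == X]k2; apply/eqP; field; exact: dt0.
Qed.

(** With v = B_{k+1/2} and C = u_{k+1/2} there remain (w x U) . H and - (U x H) . w, of
    zero sum. *)
Lemma step_cross_helicity : (forall K, K \in cells M -> forall x, cell_int K x -> rho x = 1) ->
  ipv Omega u' B' = ipv Omega u B.
Proof.
move=> r1; have r1' := step_one r1.
have rm1 K : K \in cells M -> forall x, cell_int K x -> rm x = 1.
  by move=> KM x Kx; rewrite /mids (r1 K KM x Kx) (r1' K KM x Kx); field.
have bB := Udiv_balanced M_tri Omega_dom Bm_in.
have h1 := momentum Bm_in; rewrite (pressure_free Bm_in dBm) subr0 in h1.
have z : bht W um theta rm Bm = 0.
  rewrite /bht (bh_one M_tri (Udiv_poly Bm_in) bB dBm (pw_poly_C1 theta_in.2) rm1) add0r.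
  exact: (stabilization_cst _ _ rm1).
rewrite z addr0 in h1.
have Lcurl : L2v Omega (wcurl Omega E).
  have wc : weak_curl Omega E (wcurl Omega E) by apply: weak_curl_wcurl; case: E_in => -[].
  by case: wc.
have h2 := induction um_in.
have a1 : ipv Omega alpha Bm = vol (fun x => dot (cross (w x) (U x)) (H x)).
  rewrite ipvC -H_def// ipvC alpha_def//; apply: eq_vol_int => x _.
  by rewrite /dotf /crossf dotC dotBr dotC (dotC (H x)) dot_cross_r subr0.
have a2 : ipv Omega (wcurl Omega E) um = - vol (fun x => dot (cross (w x) (U x)) (H x)).
  have -> : ipv Omega (wcurl Omega E) um = ipv Omega w E.
    rewrite w_def// (ipvC Omega (midv _ _)); apply: (ipv_cells M_tri Omega_dom) => //.
    - exact: (cwv_L2v M_tri Omega_dom).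
    - rewrite midvE; apply: (L2v_lin Omega_dom); apply: (cwv_L2v M_tri Omega_dom);
        exact: cwv_smul.
    - by move=> K KM x Kx; rewrite /midv /smul (r1 K KM x Kx) (r1' K KM x Kx) !scale1r.
  rewrite ipvC E_def//; congr (- _); apply: eq_vol_int => x _.
  by rewrite /dotf /crossf triple_rot triple_rot.
rewrite a1 in h1; rewrite a2 in h2.
have cB1 : cwc (fun x => dot (dt^-1 *: (B' x - B x)) (um x)).
  apply: cwc_dot => // i; rewrite (_ : (fun x => _) = fun x => dt^-1 * B' x 0 i + - dt^-1 * B x 0 i).
    exact: cwc_lin.
  by apply/funext => x; rewrite !mxE; ring.
have cu1 : cwc (fun x => dot (dt^-1 *: (u' x - u x)) (Bm x)).
  apply: cwc_dot => // i; rewrite (_ : (fun x => _) = fun x => dt^-1 * u' x 0 i + - dt^-1 * u x 0 i).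
    exact: cwc_lin.
  by apply/funext => x; rewrite !mxE; ring.
have cu2 : cwc (fun x => dot (dt^-1 *: (rho' x *: u' x - rho x *: u x)) (Bm x)).
  apply: cwc_dot => // i.
  rewrite (_ : (fun x => _) = fun x => dt^-1 * (rho' x * u' x 0 i) + - dt^-1 * (rho x * u x 0 i)).
    by apply: cwc_lin; exact: cwcM.
  by apply/funext => x; rewrite !mxE; ring.
have e1 : ipv Omega (fun x => dt^-1 *: (rho' x *: u' x - rho x *: u x)) Bm =
    ipv Omega (fun x => dt^-1 *: (u' x - u x)) Bm.
  apply: (eq_vol_cells M_tri Omega_dom); [exact: cwc_mfun cu2|exact: cwc_mfun cu1|].
  by move=> K KM x Kx; rewrite /dotf (r1 K KM x Kx) (r1' K KM x Kx) !scale1r.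
rewrite e1 in h1.
have key : dt^-1 * ipv Omega u' B' + - dt^-1 * ipv Omega u B
  = 1 * ipv Omega (fun x => dt^-1 *: (u' x - u x)) Bm + 1 * ipv Omega (fun x => dt^-1 *: (B' x - B x)) um.
  rewrite -(vol_lin M_tri Omega_dom); [|exact: cwc_dot|exact: cwc_dot].
  rewrite -(vol_lin M_tri Omega_dom)//.
  apply: eq_vol_int => x _; rewrite /dotf /midv !dotE !mxE.
  move: (u x) (u' x) (B x) (B' x) => a a' b b'.
  by field.
move: key h1 h2; move: (ipv Omega _ Bm) (ipv Omega _ um) (ipv Omega u' B') (ipv Omega u B)
  (vol (fun x => dot (cross (w x) (U x)) (H x))) => i1 i2 e e0 X key h1 h2.
have e12 : i1 + i2 = 0 by rewrite -[RHS](addr0 0) -{1}h1 -h2; ring.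
have k2 : dt * (dt^-1 * e + - dt^-1 * e0) = 0 by rewrite key !mul1r e12 mulr0.
apply/eqP; rewrite -subr_eq0 -[X in _ == X]k2; apply/eqP; field; exact: dt0.
Qed.

(** The residual B_{k+1} - B_k + dt curl E is itself an admissible test function. *)
Lemma step_induction K x : K \in cells M -> cell_int K x -> B' x = B x - dt *: pw_curl M E x.
Proof.
move=> KM Kx; pose C := pw_curl M E.
have hC : Udiv M Omega s C := curl_Udiv M_tri Omega_dom E_in.
pose D y := 1 *: (1 *: B' y + - 1 *: B y) + dt *: C y.
have hD : Udiv M Omega s D by apply: Udiv_lin => //; exact: Udiv_lin.
have cC := Udiv_cwv hC; have cD := Udiv_cwv hD.
have := induction hD; rewrite (wcurl_ipv M_tri Omega_dom E_in (Udiv_L2v hD)); last first.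
  exact: pw_polyv_C1v (Udiv_poly hD).
have cB1 : cwc (fun y => dot (dt^-1 *: (B' y - B y)) (D y)).
  apply: cwc_dot => // i; rewrite (_ : (fun x => _) = fun x => dt^-1 * B' x 0 i + - dt^-1 * B x 0 i).
    exact: cwc_lin.
  by apply/funext => y; rewrite !mxE; ring.
have -> : ipv Omega (fun y => dt^-1 *: (B' y - B y)) D + ipv Omega C D = dt^-1 * ipv Omega D D + 0 * ipv Omega D D.
  transitivity (1 * ipv Omega (fun y => dt^-1 *: (B' y - B y)) D + 1 * ipv Omega C D); first by rewrite !mul1r.
  rewrite -(vol_lin M_tri Omega_dom)//; last exact: cwc_dot.
  rewrite -(vol_lin M_tri Omega_dom); [|exact: cwc_dot|exact: cwc_dot].
  apply: eq_vol_int => y _; rewrite /dotf.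
  have DE : D y = (B' y - B y) + dt *: C y by rewrite /D !scale1r scaleN1r.
  have DD : dot (D y) (D y) = dot (B' y - B y) (D y) + dt * dot (C y) (D y).
    by rewrite {1}DE dotDl dotZl.
  rewrite dotZl DD; move: (dot _ _) (dot _ _) => p q; field; exact: dt0.
rewrite mul0r addr0 => /eqP; rewrite mulf_eq0 invr_eq0 (negbTE dt0) /= => /eqP D0.
have := ipv_self_eq0 M_tri Omega_dom hD D0 KM Kx; rewrite /D !scale1r scaleN1r => /eqP.
by rewrite addr_eq0 subr_eq => /eqP ->; rewrite addrC.
Qed.

Lemma step_weak_div : weak_div Omega B (fun=> 0) -> weak_div Omega B' (fun=> 0).
Proof.
move=> [h0 wB]; split=> // phi tphi; have [phi1 _ _] := tphi.
have [_ _ [_ wC]] := curl_conforming M_tri Omega_dom E_in.1 (Ucurl_poly E_in).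
have hC : Udiv M Omega s (pw_curl M E) := curl_Udiv M_tri Omega_dom E_in.
have Lg : L2v Omega (grad phi).
  move=> i; apply: continuous_L2 => //; have [_ cp] := phi1.
  by apply: eq_continuous_fun (cp i) => x; rewrite mxE.
have z f : ips Omega (fun=> 0) f = 0 by apply: vol_int_eq0 => x _; rewrite mul0r.
rewrite z oppr0 ipvC (ipv_cells M_tri Omega_dom (v := fun x => 1 *: B x + - dt *: pw_curl M E x)) //.
- rewrite (ipv_linr Omega_dom _ _ Lg (Udiv_L2v B_in) (Udiv_L2v hC)) !(ipvC Omega (grad phi)).
  by rewrite wB// wC// !z; ring.
- exact: Udiv_L2v B'_in.
- by apply: (L2v_lin Omega_dom); [exact: Udiv_L2v B_in|exact: Udiv_L2v hC].
- by move=> K KM x Kx; rewrite (step_induction KM Kx) scale1r scaleNr.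
Qed.

(** By symmetry of the curl the increment is - dt (<A, curl E> + <A', curl E>) = - 2 dt
    <E, B_{k+1/2}>, and E is orthogonal to B_{k+1/2} since <E, B_{k+1/2}> = <E, H> = -
    <U x H, H>. *)
Lemma step_magnetic_helicity A A' : H0curl Omega A -> weak_curl Omega A B ->
  H0curl Omega A' -> weak_curl Omega A' B' -> ipv Omega A' B' = ipv Omega A B.
Proof.
move=> hA wA hA' wA'.
have [rad rad0 Orad] := domain_radius Omega_dom.
have oO : open Omega by case: Omega_dom.
have LA : L2v Omega A by case: hA => -[].
have LA' : L2v Omega A' by case: hA' => -[].
have pE := Ucurl_poly E_in; have LE := Ucurl_L2v E_in.
have hC : Udiv M Omega s (pw_curl M E) := curl_Udiv M_tri Omega_dom E_in.
have LC := Udiv_L2v hC.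
pose b := on_cellsv M B; pose b' := on_cellsv M B'; pose C := pw_curl M E.
have ext (F : rV3 -> rV3) : (forall i, cwc (fun x => F x 0 i)) -> forall i, approximable Omega (fun x => on_cellsv M F x 0 i).
  move=> hF i; rewrite (_ : (fun x => _) = on_cells M (fun x => F x 0 i)).
    by apply: (on_cells_approximable M_tri Omega_dom) => K KM; exact: (hF i).2.
  by apply/funext => x; rewrite mxE.
have ab := ext B cB; have ab' := ext B' cB'.
have aC i : approximable Omega (fun x => C x 0 i).
  rewrite (_ : (fun x => _) = on_cells M (fun x => curl E x 0 i)); last first.
    by apply/funext => x; rewrite mxE.
  apply: (on_cells_approximable M_tri Omega_dom) => K KM; have [P dP EP] := pE K KM.
  exists (mpoly_eval (mcurl P i)); first exact: C1_continuous (mpoly_eval_C1 _).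
  by move=> x Kx; rewrite (curl_cell _ Kx EP).
have Lb : L2v Omega b by move=> i; exact: (approximable_L2 oO (ab i)).
have Lb' : L2v Omega b' by move=> i; exact: (approximable_L2 oO (ab' i)).
have LB := Udiv_L2v B_in; have LB' := Udiv_L2v B'_in.
have gA psi : C1v psi -> ipv Omega A (curl psi) = ipv Omega b psi.
  move=> psi1; rewrite (potential_green M_tri Omega_dom hA wA psi1) !(ipvC Omega _ psi).
  apply: (ipv_cells M_tri Omega_dom) => //; first exact: (C1v_L2v Omega_dom).
  by move=> K KM x Kx; rewrite /b (on_cellsvE M_tri _ KM Kx).
have gA' psi : C1v psi -> ipv Omega A' (curl psi) = ipv Omega b' psi.
  move=> psi1; rewrite (potential_green M_tri Omega_dom hA' wA' psi1) !(ipvC Omega _ psi).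
  apply: (ipv_cells M_tri Omega_dom) => //; first exact: (C1v_L2v Omega_dom).
  by move=> K KM x Kx; rewrite /b' (on_cellsvE M_tri _ KM Kx).
have gE psi : C1v psi -> ipv Omega E (curl psi) = ipv Omega C psi.
  by move=> psi1; rewrite (H0curl_green M_tri Omega_dom E_in.1 pE psi1).
have S1 := curl_symmetric oO rad0 Orad LA' LA gA' gA ab' ab.
have S2 := curl_symmetric oO rad0 Orad LA LE gA gE ab aC.
have S3 := curl_symmetric oO rad0 Orad LA' LE gA' gE ab' aC.
have bE : b' = fun x => 1 *: b x + - dt *: C x.
  apply/funext => x; have [[K KM Kx]|hx] := pselect (exists2 K, K \in cells M & cell_int K x).
    rewrite /b /b' !(on_cellsvE M_tri _ KM Kx) (step_induction KM Kx).
    by rewrite scale1r scaleNr.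
  by apply/rowP => i; rewrite !mxE !(on_cells_off _ hx); ring.
have toB F G : L2v Omega F -> L2v Omega G -> L2v Omega (on_cellsv M G) ->
    ipv Omega F G = ipv Omega F (on_cellsv M G).
  move=> hF hG hG'; apply: (ipv_cells M_tri Omega_dom) => // K KM x Kx.
  by rewrite (on_cellsvE M_tri _ KM Kx).
rewrite (toB A' B')// (toB A B)// -/b -/b'.
have k1 : ipv Omega A' b' = 1 * ipv Omega A' b + - dt * ipv Omega A' C.
  by rewrite {1}bE; exact: (ipv_linr Omega_dom).
have k2 : ipv Omega A b' = 1 * ipv Omega A b + - dt * ipv Omega A C.
  by rewrite {1}bE; exact: (ipv_linr Omega_dom).
have k3 : ipv Omega E Bm = 0.
  rewrite ipvC -H_def// ipvC E_def// [X in - X]vol_int_eq0 ?oppr0// => x _.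
  by rewrite /dotf /crossf dot_cross_r.
have k4 : ipv Omega E Bm = 2^-1 * ipv Omega E b + 2^-1 * ipv Omega E b'.
  by rewrite midvE (ipv_linr Omega_dom _ _ LE LB LB') (toB E B)// (toB E B')//.
rewrite (ipvC Omega b' A) in S1; rewrite (ipvC Omega b E) in S2; rewrite (ipvC Omega b' E) in S3.
rewrite k3 in k4; rewrite S3 S1 in k1; rewrite S2 in k2; rewrite k1 k2.
rewrite (half_sum_eq0 k4).
by ring.
Qed.

End TimeStep.

(** * The conservation laws *)

Theorem proposition6p1 (R : realType) (Omega : set 'rV[R]_3) (M : mesh R)
  (s m : nat)
  (beta : {set 'I_(nvert M)} -> ('rV[R]_3 -> 'rV[R]_3) -> 'rV[R]_3 -> R)
  (W : {set 'I_(nvert M)} -> ('rV[R]_3 -> 'rV[R]_3) ->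
       ('rV[R]_3 -> 'rV[R]_3) -> 'rV[R]_3 -> R)
  (dt : R)
  (u B : nat -> 'rV[R]_3 -> 'rV[R]_3) (rho p : nat -> 'rV[R]_3 -> R)
  (theta : nat -> 'rV[R]_3 -> R)
  (w J H U E alpha : nat -> 'rV[R]_3 -> 'rV[R]_3)
  (Omega_dom : bounded_domain Omega)
  (M_tri : triangulation M Omega)
  (W_weight : upwind_weight Omega s beta W)
  (dt_gt0 : 0 < dt)
  (u_in : forall k, Udiv M Omega s (u k))
  (B_in : forall k, Udiv M Omega s (B k))
  (rho_in : forall k, Fh M Omega m (rho k))
  (p_in : forall k, Qh M Omega s (p k))
  (theta_in : forall k, Fh M Omega m (theta k))
  (w_in : forall k, Ucurl M Omega s (w k))
  (J_in : forall k, Ucurl M Omega s (J k))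
  (H_in : forall k, Ucurl M Omega s (H k))
  (U_in : forall k, Ucurl M Omega s (U k))
  (E_in : forall k, Ucurl M Omega s (E k))
  (alpha_in : forall k, Ucurl M Omega s (alpha k))
  (momentum_eq : forall k v, Udiv M Omega s v ->
     ipv Omega (fun x => dt^-1 *: (rho k.+1 x *: u k.+1 x - rho k x *: u k x)) v
     + ipv Omega (alpha k) v
     + bht W (midv (u k) (u k.+1)) (theta k) (mids (rho k) (rho k.+1)) v
     - ips Omega (p k.+1) (wdiv Omega v) = 0)
  (induction_eq : forall k C, Udiv M Omega s C ->
     ipv Omega (fun x => dt^-1 *: (B k.+1 x - B k x)) C
     + ipv Omega (wcurl Omega (E k)) C = 0)
  (density_eq : forall k sigma, Fh M Omega m sigma ->
     ips Omega (fun x => dt^-1 * (rho k.+1 x - rho k x)) sigma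
     + bht W (midv (u k) (u k.+1)) sigma (mids (rho k) (rho k.+1))
         (midv (u k) (u k.+1)) = 0)
  (incompressibility_eq : forall k q, Qh M Omega s q ->
     ips Omega (wdiv Omega (u k.+1)) q = 0)
  (w_eq : forall k z, Ucurl M Omega s z ->
     ipv Omega (w k) z =
     ipv Omega (midv (smul (rho k) (u k)) (smul (rho k.+1) (u k.+1)))
       (wcurl Omega z))
  (J_eq : forall k kappa, Ucurl M Omega s kappa ->
     ipv Omega (J k) kappa =
     ipv Omega (midv (B k) (B k.+1)) (wcurl Omega kappa))
  (theta_eq : forall k tau, Fh M Omega m tau ->
     ips Omega (theta k) tau = 2^-1 * ips Omega (dotf (u k) (u k.+1)) tau)
  (H_eq : forall k G, Ucurl M Omega s G ->
     ipv Omega (H k) G = ipv Omega (midv (B k) (B k.+1)) G)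
  (U_eq : forall k V, Ucurl M Omega s V ->
     ipv Omega (U k) V = ipv Omega (midv (u k) (u k.+1)) V)
  (E_eq : forall k F, Ucurl M Omega s F ->
     ipv Omega (E k) F = - ipv Omega (crossf (U k) (H k)) F)
  (alpha_eq : forall k b, Ucurl M Omega s b ->
     ipv Omega (alpha k) b =
     ipv Omega (fun x => crossf (w k) (U k) x - crossf (J k) (H k) x) b)
  (div_u0 : weak_div Omega (u 0) (fun=> 0))
  (div_B0 : weak_div Omega (B 0) (fun=> 0)) :
  (forall k, vol_int Omega (rho k.+1) = vol_int Omega (rho k)) /\
  (forall k, vol_int Omega (fun x => rho k.+1 x ^+ 2)
             <= vol_int Omega (fun x => rho k x ^+ 2)) /\
  ((forall e v x, e \in int_faces M -> Udiv M Omega s v -> hull e x ->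
      beta e v x = 0) ->
   forall k, vol_int Omega (fun x => rho k.+1 x ^+ 2)
             = vol_int Omega (fun x => rho k x ^+ 2)) /\
  (forall k,
     vol_int Omega (fun x => rho k.+1 x * dot (u k.+1 x) (u k.+1 x)
                             + dot (B k.+1 x) (B k.+1 x))
     = vol_int Omega (fun x => rho k x * dot (u k x) (u k x)
                               + dot (B k x) (B k x))) /\
  (ae_on Omega (fun x => rho 0 x = 1) ->
   forall k, ipv Omega (u k.+1) (B k.+1) = ipv Omega (u k) (B k)) /\
  (forall k (A A' : 'rV[R]_3 -> 'rV[R]_3),
     H0curl Omega A -> weak_curl Omega A (B k) ->
     H0curl Omega A' -> weak_curl Omega A' (B k.+1) ->
     ipv Omega A' (B k.+1) = ipv Omega A (B k)) /\
  (forall k, weak_div Omega (u k) (fun=> 0)) /\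
  (forall k, weak_div Omega (B k) (fun=> 0)).
Proof.
have du k : divfree M (u k).
  case: k => [|k]; first exact: (weak_divfree M_tri Omega_dom (u_in 0) div_u0).
  exact: (incompressible M_tri Omega_dom (u_in k.+1) (incompressibility_eq k)).
have wB k : weak_div Omega (B k) (fun=> 0).
  elim: k => [//|k IH].
  exact: (step_weak_div M_tri Omega_dom dt_gt0 (B_in k) (B_in k.+1) (E_in k) (induction_eq k) IH).
have dB k : divfree M (B k) := weak_divfree M_tri Omega_dom (B_in k) (wB k).
split; [move=> k|split; [move=> k|split; [move=> b0 k|split; [move=> k|
  split; [move=> r0 k|split; [move=> k A A' hA wA hA' wA'|split; [move=> k|exact: wB]]]]]]].
- exact: (step_mass M_tri Omega_dom dt_gt0 (rho_in k) (rho_in k.+1) (density_eq k)).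
- exact: (step_density_le M_tri Omega_dom W_weight dt_gt0 (u_in k) (u_in k.+1)
    (rho_in k) (rho_in k.+1) (density_eq k) (du k) (du k.+1)).
- rewrite -(step_density M_tri Omega_dom dt_gt0 (u_in k) (u_in k.+1)
    (rho_in k) (rho_in k.+1) (density_eq k) (du k) (du k.+1)).
  by rewrite (stabilization_beta0 M_tri Omega_dom W_weight (u_in k) (u_in k.+1) _ b0) mulr0 addr0.
- exact: (step_energy M_tri Omega_dom dt_gt0 (u_in k) (u_in k.+1) (B_in k) (B_in k.+1)
    (rho_in k) (rho_in k.+1) (p_in k.+1) (theta_in k) (J_in k) (H_in k) (U_in k) (E_in k)
    (alpha_in k) (momentum_eq k) (induction_eq k) (density_eq k) (J_eq k) (theta_eq k)
    (U_eq k) (E_eq k) (alpha_eq k) (du k) (du k.+1)).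
- have r1 : forall j K, K \in cells M -> forall x, cell_int K x -> rho j x = 1.
    elim=> [|j IH] K KM x Kx.
      exact: (cells_ae_eq M_tri Omega_dom (rho_in 0).2 r0 KM Kx).
    exact: (step_one M_tri Omega_dom W_weight dt_gt0 (u_in j) (u_in j.+1)
      (rho_in j) (rho_in j.+1) (density_eq j) (du j) (du j.+1) IH KM Kx).
  exact: (step_cross_helicity M_tri Omega_dom W_weight dt_gt0 (u_in k) (u_in k.+1)
    (B_in k) (B_in k.+1) (rho_in k) (rho_in k.+1) (p_in k.+1) (theta_in k) (w_in k) (H_in k)
    (E_in k) (alpha_in k) (momentum_eq k) (induction_eq k) (density_eq k) (w_eq k) (H_eq k)
    (E_eq k) (alpha_eq k) (du k) (du k.+1) (dB k) (dB k.+1) (r1 k)).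
- exact: (step_magnetic_helicity M_tri Omega_dom dt_gt0 (B_in k) (B_in k.+1) (H_in k) (E_in k)
    (induction_eq k) (H_eq k) (E_eq k) hA wA hA' wA').
- exact: (divfree_weak M_tri Omega_dom (u_in k) (du k)).
Qed.
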